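(* Let $\wp,\zeta$ be the Weierstrass functions of the torus $$\wp'(\alpha)^2=4\Big(\wp(\alpha)-\tfrac{\sqrt2}{3}\Big)\Big(\wp(\alpha)+\tfrac{3+\sqrt2}{6}\Big)\Big(\wp(\alpha)-\tfrac{3-\sqrt2}{6}\Big),$$ with half-periods $\omega,\omega'$ such that $\wp(\omega)=\frac{\sqrt2}{3}$ and $\wp(\omega')=-\frac{3+\sqrt2}{6}$, and let $\varkappa$ be such that $\wp(\varkappa)=-\frac72-\frac{13}{6}\sqrt2$ and $\wp'(\varkappa)=\sqrt[4]{32}\,(7+5\sqrt2)\,i$. Consider the Fuchsian equation of Burnside's parametrization of $y^2=x^5-x$, $$\Psi_{xx}=-\frac14\,\frac{x^8+14x^4+1}{(x^5-x)^2}\,\Psi ,$$ and the change of variables $(x,\Psi)\mapsto(\alpha,\Xi)$ given by $$\wp(\alpha)=-\frac{3+\sqrt2}{6}+\frac{1+\sqrt2}{x-i}-i\,\frac{1+\sqrt2}{x+1},\qquad \Xi(\alpha)=\sqrt{\alpha_x}\,\Psi(x).$$ Then this change of variables transforms the equation into the following linear differential equation on the torus, which is Fuchsian with five regular singularities $\alpha\in\{0,\omega,\omega',\varkappa,-\varkappa\}$ (modulo periods): $$\Xi_{\alpha\alpha}=\Big\{-\tfrac14\big(\wp(\alpha)+\wp(\alpha-\omega)+\wp(\alpha-\omega')\big)-\tfrac3{16}\big(\wp(\alpha-\varkappa)+\wp(\alpha+\varkappa)\big)+\tfrac{9}{64}\sqrt[4]{8}\,i\,\big(\zeta(\alpha-\varkappa)-\zeta(\alpha+\varkappa)\big)+\tfrac9{32}\big(\sqrt[4]{8}\,i\,\zeta(\varkappa)+2\sqrt2+2\big)\Big\}\,\Xi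 .$$
   Context: $\wp,\zeta$ are the Weierstrass functions with invariants $g_2=\frac53$, $g_3=-\frac{7}{27}\sqrt2$; $\omega,\omega'$ denote half-periods (period lattice $2\omega\mathbb{Z}+2\omega'\mathbb{Z}$), here $\omega>0$ and $\omega'=\frac{i}{\sqrt2}\,\omega$. All fourth roots of positive numbers are positive. Subscripts denote derivatives; $\alpha_x=d\alpha/dx$. *)

(* Defs.v *)
From Stdlib Require Import Reals ZArith List.
From Coquelicot Require Import Coquelicot.
Open Scope C_scope.

(* The value is meaningful only when both real sequences converge. *)
Definition C_lim_seq (u : nat -> C) : C :=
  (real (Lim_seq (fun N => Re (u N))), real (Lim_seq (fun N => Im (u N)))).

(* The lattice 2 w Z + 2 w' Z: w and w' are half-periods. *)
Definition period (w w' : C) (m n : Z) : C :=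
  2 * RtoC (IZR m) * w + 2 * RtoC (IZR n) * w'.

Definition lattice (w w' z : C) : Prop := exists m n : Z, z = period w w' m n.

Definition sum_sym (N : nat) (f : Z -> C) : C :=
  sum_n (fun k : nat => f (Z.of_nat k - Z.of_nat N)%Z) (2 * N).

(* Sum of f over the non-zero lattice points, as the limit over the squares
   -N <= m, n <= N.  The two series below converge absolutely off the lattice,
   so this choice of exhaustion does not affect their sums. *)
Definition sum_lattice' (w w' : C) (f : C -> C) : C :=
  C_lim_seq (fun N => sum_sym N (fun m => sum_sym N (fun n =>
    if ((m =? 0)%Z && (n =? 0)%Z)%bool then RtoC 0 else f (period w w' m n)))).

(* On the lattice itself these two functions take meaningless values
   (division by zero is total). *)
Definition weierstrass_p (w w' z : C) : C :=
  1 / z ^ 2 + sum_lattice' w w' (fun l => 1 / (z - l) ^ 2 - 1 / l ^ 2).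

Definition weierstrass_zeta (w w' z : C) : C :=
  1 / z + sum_lattice' w w' (fun l => 1 / (z - l) + 1 / l + z / l ^ 2).

Definition root4 (x : R) : R := sqrt (sqrt x).

(* The target is pinned to C_NormedModule, the instance used by C_derive;
   AbsRing_NormedModule C_AbsRing has the same carrier. *)
Notation is_C_derive f z l :=
  (@is_derive C_AbsRing C_NormedModule f z l) (only parsing).
Notation ex_C_derive f z :=
  (@ex_derive C_AbsRing C_NormedModule f z) (only parsing).

Definition holomorphic_at (f : C -> C) (a : C) : Prop :=
  locally a (fun z : C => ex_C_derive f z).

(* f, considered on a punctured neighbourhood of a, extends holomorphically
   to a; the value f a is disregarded. *)
Definition removable (f : C -> C) (a : C) : Prop :=
  exists g : C -> C, holomorphic_at g a /\ locally' a (fun z : C => g z = f z).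

(* f'' = Q f on U; f1 is the first derivative. *)
Definition solves (U : C -> Prop) (Q f : C -> C) : Prop :=
  exists f1 : C -> C, forall z : C, U z ->
    is_C_derive f z (f1 z) /\ is_C_derive f1 z (Q z * f z).

(* For an equation f'' = Q f, without first-order term, a singular point is
   regular iff (z - a)^2 Q(z) is holomorphic at a. *)
Definition regular_singular (Q : C -> C) (a : C) : Prop :=
  ~ removable Q a /\ removable (fun z => (z - a) ^ 2 * Q z) a.

(* f'' = Q f is an equation on the torus C / (2 w Z + 2 w' Z), and its
   singular points are exactly the classes of the elements of s, which are
   pairwise distinct and are regular singularities. *)
Definition fuchsian_on_torus (w w' : C) (Q : C -> C) (s : list C) : Prop :=
  let singular z := exists a, In a s /\ lattice w w' (z - a) in
  (forall z m n, ~ singular z -> Q (z + period w w' m n) = Q z) /\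
  (forall z, ~ singular z -> holomorphic_at Q z) /\
  (forall a, In a s -> regular_singular Q a) /\
  ForallOrdPairs (fun a b => ~ lattice w w' (a - b)) s.

(* a maps V to W, b maps W to V; their values elsewhere are irrelevant. *)
Definition biholomorphic (V W : C -> Prop) (a b : C -> C) : Prop :=
  open V /\ open W /\
  (forall x, V x -> W (a x) /\ b (a x) = x /\ ex_C_derive a x) /\
  (forall z, W z -> V (b z) /\ a (b z) = z /\ ex_C_derive b z).

Definition burnside_coeff (x : C) : C :=
  - (1 / 4) * ((x ^ 8 + 14 * x ^ 4 + 1) / (x ^ 5 - x) ^ 2).

Definition burnside_subst (x : C) : C :=
  - ((3 + sqrt 2) / 6) + (1 + sqrt 2) / (x - Ci)
  - Ci * ((1 + sqrt 2) / (x + 1)).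

Definition torus_coeff (w w' kappa z : C) : C :=
  let wp := weierstrass_p w w' in
  let zeta := weierstrass_zeta w w' in
  - (1 / 4) * (wp z + wp (z - w) + wp (z - w'))
  - (3 / 16) * (wp (z - kappa) + wp (z + kappa))
  + (9 / 64) * root4 8 * Ci * (zeta (z - kappa) - zeta (z + kappa))
  + (9 / 32) * (root4 8 * Ci * zeta kappa + 2 * sqrt 2 + 2).

(* Main.v *)
(* Both Weierstrass functions are differentiated term by term, which gives
   zeta' = - P and the periods of P, while zeta (z + p) - zeta z does not depend
   on z.  A Liouville theorem then gives the addition theorem
     (P u - P v) (zeta (u + v) + zeta (u - v) - 2 zeta u) = P' u,
   and differentiating it in u gives P (u + v) + P (u - v).  With the differential
   equation of P, the coefficient of the torus equation becomes a rational
   function of P(alpha), in which zeta(kappa) cancels.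

   With s = sqrt(alpha_x) and L = s'/s, the substitution Xi = s Psi turns
   Psi'' = q Psi into the equation with coefficient (L' - L^2 + q) / s^4.
   Differentiating P(alpha) = burnside_subst x shows that
     s^4 = (1 - i)/2 * (x + r)^2 / (x^5 - x),   r = exp(- i pi/4),
   away from the ramification point x = r, hence everywhere by continuity; what
   remains is an identity between rational functions of x. *)

Require Import Defs.
From Stdlib Require Import Reals ZArith List.
From Coquelicot Require Import Coquelicot.
From Stdlib Require Import ssreflect Lra Lia Psatz ClassicalEpsilon.
Import ListNotations.
Open Scope C_scope.

(** * Complex differentiation *)

(** Isolated singularities are not removed by a general theorem. The defect of the addition theorem
    is set to 0 at its singular points, shown continuous there by explicit expansions, and fed to a
    Liouville theorem that asks for derivatives only where the function does not vanish. The
    substitution has degree 2 in x. The branch points 0, 1, -1, i, -i and infinity of y^2 = x^5 - x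
    lie over the values infinity, e1 = P(w) and e2 = P(w'); the critical points r and -r lie over
    the third root e3 and over P(kappa). At x = r the derivative of the substitution and P'(alpha)
    vanish together, so alpha_x is not determined by division and a limit is taken. At x = -r the
    derivative vanishes but P'(alpha) does not, which would force alpha_x = 0: no biholomorphic
    branch passes through -r, and this is the point over which the singularities kappa and -kappa
    lie. *)

Lemma Cmod_minus_sym (x y : C) : Cmod (x - y) = Cmod (y - x).
Proof. rewrite -Cmod_opp; congr Cmod; ring. Qed.

Lemma Cmod_triangle_minus (x y : C) : (Cmod (x - y) <= Cmod x + Cmod y)%R.
Proof. rewrite -(Cmod_opp y); exact: Cmod_triangle. Qed.

Lemma Cmod_triangle_rev (x y : C) : (Cmod x - Cmod y <= Cmod (x - y))%R.
Proof.
have -> : x = (x - y) + y by ring.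
have := Cmod_triangle (x - y) y.
replace (x - y + y - y) with (x - y) by ring. lra.
Qed.

Lemma RtoC_neq (x y : R) : x <> y -> RtoC x <> RtoC y.
Proof. by move=> n /RtoC_inj. Qed.

Lemma Cinv_neq_0 (x : C) : x <> 0 -> / x <> 0.
Proof.
move=> n E; have := Cinv_r x n; rewrite E Cmult_0_r => /RtoC_inj; lra.
Qed.

Lemma Cminus_eq_0 (x y : C) : x - y = 0 -> x = y.
Proof. move=> H; have -> : x = (x - y) + y by ring. by rewrite H Cplus_0_l. Qed.

Lemma Cminus_neq_0 (x y : C) : x <> y -> x - y <> 0.
Proof. by move=> H /Cminus_eq_0. Qed.

Lemma C_locally_iff (z : C) (P : C -> Prop) :
  locally (T := C_UniformSpace) z P <->
  exists d : R, (0 < d)%R /\ forall y, (Cmod (y - z) < d)%R -> P y.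
Proof.
rewrite locally_C; split.
- move=> [d Hd]; exists d; split; first exact: cond_pos.
  move=> y Hy; exact: Hd.
- move=> [d [d0 Hd]]; exists (mkposreal d d0) => y Hy; exact: Hd.
Qed.

Lemma C_locally'_iff (z : C) (P : C -> Prop) :
  locally' (T := C_UniformSpace) z P <->
  exists d : R, (0 < d)%R /\ forall y, y <> z -> (Cmod (y - z) < d)%R -> P y.
Proof.
rewrite /locally' /within C_locally_iff; split=> -[d [d0 H]]; exists d; split=> // y.
  by move=> ? ?; apply: H.
by move=> ? ?; apply: H.
Qed.

Lemma C_continuous_iff (f : C -> C) (z : C) :
  continuous (T := C_UniformSpace) (U := C_UniformSpace) f z <->
  forall eps : R, (0 < eps)%R -> exists d : R, (0 < d)%R /\
    forall y, (Cmod (y - z) < d)%R -> (Cmod (f y - f z) < eps)%R.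
Proof.
split.
- move=> H eps e0; apply/C_locally_iff; apply: (H (fun y => (Cmod (y - f z) < eps)%R)).
  apply/C_locally_iff; by exists eps.
- move=> H P /C_locally_iff [e [e0 He]].
  have [d [d0 Hd]] := H e e0.
  apply/C_locally_iff; exists d; split=> // y Hy; apply: He; exact: Hd.
Qed.

Lemma is_C_derive_iff (f : C -> C) (z l : C) :
  is_C_derive f z l <->
  forall eps : R, (0 < eps)%R -> exists d : R, (0 < d)%R /\
    forall t, (Cmod t < d)%R -> (Cmod (f (z + t)%C - f z - t * l) <= eps * Cmod t)%R.
Proof.
split.
- move=> [_ H] eps e0.
  have := H z (fun P HP => HP) (mkposreal eps e0).
  move=> [d Hd]; exists d; split; first exact: cond_pos.
  move=> t Ht.
  have := Hd (Cplus z t).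
  have E : @minus C_AbsRing (Cplus z t) z = t :> C.
    by rewrite /minus /plus /opp /=; ring.
  move=> /(_ _) H1.
  have H2 : ball (M := AbsRing_UniformSpace C_AbsRing) z d (Cplus z t).
    rewrite /ball /= /AbsRing_ball /abs /=. by rewrite E.
  move: (H1 H2).
  rewrite /norm /= /minus /plus /opp /scal /= /mult /=.
  by have -> : z + t + - z = t by ring.
- move=> H; split.
    exact: (is_linear_scal_l (K := C_AbsRing) (V := C_NormedModule)).
  move=> x Hx eps.
  (* The definition quantifies over all limit points of the filter; the neighbourhoods of z have no
     other. *)
  have -> : x = z.
    symmetry; exact: (is_filter_lim_locally_unique (V := AbsRing_NormedModule C_AbsRing)).
  have [d [d0 Hd]] := H eps (cond_pos eps).
  exists (mkposreal d d0) => y Hy.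
  have := Hd (y - z) Hy.
  have -> : z + (y - z) = y by ring.
  done.
Qed.

(* Caratheodory's form of differentiability: all the differentiation rules
   reduce to continuity of the slope. *)
Lemma is_C_derive_slope (f : C -> C) (z l : C) :
  is_C_derive f z l <->
  exists p : C -> C, p z = l /\ continuous p z /\
    locally (T := C_UniformSpace) z (fun y => f y - f z = (y - z) * p y).
Proof.
rewrite is_C_derive_iff; split.
- move=> H.
  pose p y := if Ceq_dec y z is left _ then l else (f y - f z) / (y - z).
  exists p; split; first by rewrite /p; case: Ceq_dec.
  split.
    apply/C_continuous_iff => eps e0.
    have [d [d0 Hd]] := H (eps / 2)%R ltac:(lra).
    exists d; split=> // y Hy.
    rewrite /p; case: (Ceq_dec z z) => // _.
    case: Ceq_dec => [_|n].
      by have -> : l - l = 0; [ring|rewrite Cmod_0].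
    have n' := Cminus_neq_0 _ _ n.
    have := Hd (y - z) Hy.
    have -> : z + (y - z) = y by ring.
    have -> : f y - f z - (y - z) * l = (y - z) * ((f y - f z) / (y - z) - l) by field.
    rewrite Cmod_mult => H1.
    have H2 : (0 < Cmod (y - z))%R by apply/Cmod_gt_0.
    have H3 : (Cmod ((f y - f z) / (y - z) - l) <= eps / 2)%R.
      apply: (Rmult_le_reg_l (Cmod (y - z))) => //; lra.
    lra.
  apply/C_locally_iff; exists 1%R; split; first lra.
  move=> y _; rewrite /p; case: Ceq_dec => [->|n]; first ring.
  field; exact: Cminus_neq_0.
- move=> [p [<- [/C_continuous_iff H /C_locally_iff [d1 [d10 H1]]]]] eps e0.
  have [d [d0 Hd]] := H eps e0.
  exists (Rmin d d1); split; first exact: Rmin_pos.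
  move=> t Ht.
  have E : z + t - z = t by ring.
  have T1 : (Cmod (z + t - z) < d)%R by rewrite E; apply: Rlt_le_trans Ht (Rmin_l _ _).
  have T2 : (Cmod (z + t - z) < d1)%R by rewrite E; apply: Rlt_le_trans Ht (Rmin_r _ _).
  rewrite (H1 _ T2) E.
  have -> : t * p (z + t) - t * p z = t * (p (z + t) - p z) by ring.
  rewrite Cmod_mult Rmult_comm.
  apply: Rmult_le_compat_r; first exact: Cmod_ge_0.
  apply: Rlt_le; exact: Hd.
Qed.

Lemma C_continuous_const (c z : C) : continuous (fun _ : C => c) z.
Proof. exact: continuous_const. Qed.

Lemma C_continuous_id (z : C) : continuous (fun y : C => y) z.
Proof. exact: continuous_id. Qed.

Lemma C_continuous_plus (f g : C -> C) (z : C) :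
  continuous f z -> continuous g z -> continuous (fun y => f y + g y) z.
Proof. exact: (continuous_plus (V := C_NormedModule) f g z). Qed.

Lemma C_continuous_opp (f : C -> C) (z : C) :
  continuous f z -> continuous (fun y => - f y) z.
Proof. exact: (continuous_opp (V := C_NormedModule) f z). Qed.

Lemma C_continuous_minus (f g : C -> C) (z : C) :
  continuous f z -> continuous g z -> continuous (fun y => f y - g y) z.
Proof. exact: (continuous_minus (V := C_NormedModule) f g z). Qed.

Lemma C_continuous_comp (f g : C -> C) (z : C) :
  continuous f z -> continuous g (f z) -> continuous (fun y => g (f y)) z.
Proof. exact: continuous_comp. Qed.

Lemma C_continuous_mult (f g : C -> C) (z : C) :
  continuous f z -> continuous g z -> continuous (fun y => f y * g y) z.
Proof.
move=> /C_continuous_iff Hf /C_continuous_iff Hg; apply/C_continuous_iff => eps e0.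
have Pf := Cmod_ge_0 (f z). have Pg := Cmod_ge_0 (g z).
set M := (Cmod (f z) + Cmod (g z) + 1)%R.
have M0 : (0 < M)%R by rewrite /M; lra.
set e := Rmin 1 (eps / (2 * M)).
have q0 : (0 < eps / (2 * M))%R by apply: Rdiv_lt_0_compat; lra.
have e1 : (0 < e)%R by apply: Rmin_pos; lra.
have [d1 [d10 H1]] := Hf e e1.
have [d2 [d20 H2]] := Hg e e1.
exists (Rmin d1 d2); split; first exact: Rmin_pos.
move=> y Hy.
have T1 := H1 y (Rlt_le_trans _ _ _ Hy (Rmin_l _ _)).
have T2 := H2 y (Rlt_le_trans _ _ _ Hy (Rmin_r _ _)).
have -> : f y * g y - f z * g z =
  (f y - f z) * (g y - g z) + (f y - f z) * g z + f z * (g y - g z) by ring.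
have e2 : (e <= 1)%R by exact: Rmin_l.
have e3 : (e * M <= eps / 2)%R.
  have : (e <= eps / (2 * M))%R by exact: Rmin_r.
  move=> /(Rmult_le_compat_r M _ _ (Rlt_le _ _ M0)).
  replace (eps / (2 * M) * M)%R with (eps / 2)%R; first done. field; lra.
apply: Rle_lt_trans (Cmod_triangle _ _) _.
have := Cmod_triangle ((f y - f z) * (g y - g z)) ((f y - f z) * g z).
rewrite !Cmod_mult => H3.
have P1 := Cmod_ge_0 (f y - f z). have P2 := Cmod_ge_0 (g y - g z).
have : (Cmod (f y - f z) * Cmod (g y - g z) <= e * 1)%R by apply: Rmult_le_compat; lra.
have : (Cmod (f y - f z) * Cmod (g z) <= e * Cmod (g z))%R by apply: Rmult_le_compat_r; lra.
have : (Cmod (f z) * Cmod (g y - g z) <= Cmod (f z) * e)%R by apply: Rmult_le_compat_l; lra.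
move: e3; rewrite /M; lra.
Qed.

Lemma C_continuous_locally_neq (f : C -> C) (z c : C) :
  continuous f z -> f z <> c -> locally (T := C_UniformSpace) z (fun y => f y <> c).
Proof.
move=> /C_continuous_iff Hf n.
have n' : (0 < Cmod (f z - c))%R by apply/Cmod_gt_0/Cminus_neq_0.
have [d [d0 H]] := Hf _ n'.
apply/C_locally_iff; exists d; split=> // y Hy E.
by have := H y Hy; rewrite E Cmod_minus_sym; lra.
Qed.

Lemma C_continuous_inv (f : C -> C) (z : C) :
  continuous f z -> f z <> 0 -> continuous (fun y => / f y) z.
Proof.
move=> /C_continuous_iff Hf n; apply/C_continuous_iff => eps e0.
have a0 : (0 < Cmod (f z))%R by apply/Cmod_gt_0.
set a := Cmod (f z).
set e := Rmin (a / 2) (eps * a * a / 2).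
have e1 : (0 < e)%R.
  apply: Rmin_pos; first by rewrite /a; lra.
  have : (0 < eps * a * a)%R by repeat apply: Rmult_lt_0_compat.
  lra.
have [d [d0 H]] := Hf e e1.
exists d; split=> // y Hy.
have T := H y Hy.
have L1 : (e <= a / 2)%R by exact: Rmin_l.
have L2 : (e <= eps * a * a / 2)%R by exact: Rmin_r.
have L3 : (a / 2 < Cmod (f y))%R.
  have := Cmod_triangle_rev (f z) (f y); rewrite Cmod_minus_sym -/a; lra.
have n2 : f y <> 0 by move=> E; move: L3; rewrite E Cmod_0 /a; lra.
have -> : / f y - / f z = - (f y - f z) / (f y * f z) by field.
rewrite Cmod_div; last by apply: Cmult_neq_0.
rewrite Cmod_opp Cmod_mult -/a.
have p : (0 < Cmod (f y) * a)%R by apply: Rmult_lt_0_compat; rewrite /a; lra.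
apply: (Rmult_lt_reg_r (Cmod (f y) * a)) => //.
replace (Cmod (f y - f z) / (Cmod (f y) * a) * (Cmod (f y) * a))%R
  with (Cmod (f y - f z)) by (field; split; rewrite /a; lra).
apply: Rlt_le_trans T _.
apply: Rle_trans L2 _.
have : (0 < eps * a)%R by apply: Rmult_lt_0_compat.
nra.
Qed.

Lemma C_continuous_ext_loc (f g : C -> C) (z : C) :
  locally (T := C_UniformSpace) z (fun y => f y = g y) -> continuous f z -> continuous g z.
Proof. by move=> H; apply: continuous_ext_loc; apply: filter_imp H. Qed.

Lemma is_C_derive_continuous (f : C -> C) (z l : C) :
  is_C_derive f z l -> continuous f z.
Proof.
move=> /is_C_derive_slope [p [_ [Hp H]]].
apply: (C_continuous_ext_loc (fun y => f z + (y - z) * p y)).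
  apply: filter_imp H => y <-; ring.
apply: C_continuous_plus; first exact: C_continuous_const.
apply: C_continuous_mult => //.
apply: C_continuous_minus; [exact: C_continuous_id|exact: C_continuous_const].
Qed.

Lemma is_C_derive_ext_loc (f g : C -> C) (z l : C) :
  locally (T := C_UniformSpace) z (fun y => f y = g y) ->
  is_C_derive f z l -> is_C_derive g z l.
Proof. by move=> /locally_C H; apply: is_derive_ext_loc. Qed.

Lemma is_C_derive_const (c z : C) : is_C_derive (fun _ => c) z (RtoC 0).
Proof. exact: (is_derive_const (K := C_AbsRing) (V := C_NormedModule) c z). Qed.

Lemma is_C_derive_id (z : C) : is_C_derive (fun y => y) z (RtoC 1).
Proof.
apply/is_C_derive_slope; exists (fun _ => 1); split=> //; split.
  exact: C_continuous_const.
apply/C_locally_iff; exists 1%R; split; [lra|move=> y _; ring].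
Qed.

Lemma is_C_derive_plus (f g : C -> C) (z a b : C) :
  is_C_derive f z a -> is_C_derive g z b -> is_C_derive (fun y => f y + g y) z (a + b).
Proof. exact: (is_derive_plus (K := C_AbsRing) (V := C_NormedModule) f g z a b). Qed.

Lemma is_C_derive_opp (f : C -> C) (z a : C) :
  is_C_derive f z a -> is_C_derive (fun y => - f y) z (- a).
Proof. exact: (is_derive_opp (K := C_AbsRing) (V := C_NormedModule) f z a). Qed.

Lemma is_C_derive_minus (f g : C -> C) (z a b : C) :
  is_C_derive f z a -> is_C_derive g z b -> is_C_derive (fun y => f y - g y) z (a - b).
Proof. exact: (is_derive_minus (K := C_AbsRing) (V := C_NormedModule) f g z a b). Qed.

Lemma is_C_derive_mult (f g : C -> C) (z a b : C) :
  is_C_derive f z a -> is_C_derive g z b ->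
  is_C_derive (fun y => f y * g y) z (a * g z + f z * b).
Proof.
move=> Hf Hg; have Cg := is_C_derive_continuous _ _ _ Hg.
move/is_C_derive_slope: Hf => [p [<- [Hp Lp]]].
move/is_C_derive_slope: Hg => [q [<- [Hq Lq]]].
apply/is_C_derive_slope; exists (fun y => p y * g y + f z * q y); split=> //; split.
  apply: C_continuous_plus; apply: C_continuous_mult => //; exact: C_continuous_const.
apply: filter_imp (filter_and _ _ Lp Lq) => y [Ep Eq].
replace (f y * g y - f z * g z) with ((f y - f z) * g y + f z * (g y - g z)) by ring.
rewrite Ep Eq; ring.
Qed.

Lemma is_C_derive_inv (f : C -> C) (z a : C) :
  is_C_derive f z a -> f z <> 0 -> is_C_derive (fun y => / f y) z (- a / f z ^ 2).
Proof.
move=> Hf n; have Cf := is_C_derive_continuous _ _ _ Hf.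
move/is_C_derive_slope: Hf => [p [<- [Hp Lp]]].
apply/is_C_derive_slope; exists (fun y => - p y * / f y * / f z); split.
  field; exact: n.
split.
  apply: C_continuous_mult; last exact: C_continuous_const.
  apply: C_continuous_mult; first exact: C_continuous_opp.
  exact: C_continuous_inv.
apply: filter_imp (filter_and _ _ Lp (C_continuous_locally_neq _ _ _ Cf n)) => y [Ep n2].
replace (/ f y - / f z) with (- (f y - f z) * / f y * / f z) by (field; split; auto).
rewrite Ep; ring.
Qed.

Lemma is_C_derive_comp (f g : C -> C) (z a b : C) :
  is_C_derive f (g z) a -> is_C_derive g z b -> is_C_derive (fun y => f (g y)) z (b * a).
Proof.
move=> Hf Hg; have Cg := is_C_derive_continuous _ _ _ Hg.
move/is_C_derive_slope: Hf => [p [<- [Hp Lp]]].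
move/is_C_derive_slope: Hg => [q [<- [Hq Lq]]].
apply/is_C_derive_slope; exists (fun y => q y * p (g y)); split=> //; split.
  apply: C_continuous_mult => //; exact: (C_continuous_comp g p).
have Lp' : locally (T := C_UniformSpace) z (fun y => f (g y) - f (g z) = (g y - g z) * p (g y)).
  exact: (Cg _ Lp).
apply: filter_imp (filter_and _ _ Lp' Lq) => y [Ep Eq].
rewrite Ep Eq; ring.
Qed.

Lemma is_C_derive_eq (f : C -> C) (z a b : C) :
  is_C_derive f z a -> a = b -> is_C_derive f z b.
Proof. by move=> H <-. Qed.

Lemma is_C_derive_pow2 (f : C -> C) (z a : C) :
  is_C_derive f z a -> is_C_derive (fun y => f y ^ 2) z (2 * a * f z).
Proof.
move=> H; apply: (is_C_derive_ext_loc (fun y => f y * f y)).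
  by apply: filter_forall => y /=; ring.
apply: is_C_derive_eq (is_C_derive_mult _ _ _ _ _ H H) _; ring.
Qed.

Lemma is_C_derive_div (f g : C -> C) (z a b : C) :
  is_C_derive f z a -> is_C_derive g z b -> g z <> 0 ->
  is_C_derive (fun y => f y / g y) z ((a * g z - f z * b) / g z ^ 2).
Proof.
move=> Hf Hg n.
apply: is_C_derive_eq (is_C_derive_mult _ _ _ _ _ Hf (is_C_derive_inv _ _ _ Hg n)) _.
field; exact: n.
Qed.

Lemma is_C_derive_inj (f : C -> C) (z a b : C) :
  is_C_derive f z a -> is_C_derive f z b -> a = b.
Proof. by move=> /is_C_derive_unique <- /is_C_derive_unique. Qed.

Lemma C_limit_unique (f : C -> C) (z l : C) :
  continuous f z ->
  (forall d : R, (0 < d)%R -> exists y, (Cmod (y - z) < d)%R /\ f y = l) -> f z = l.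
Proof.
move=> /C_continuous_iff Hf H; apply: NNPP => n.
have n' : (0 < Cmod (f z - l))%R by apply/Cmod_gt_0/Cminus_neq_0.
have [d [d0 Hd]] := Hf _ n'.
have [y [Hy E]] := H d d0.
have := Hd y Hy; rewrite E Cmod_minus_sym; lra.
Qed.

(** A continuous branch of a square root is differentiable where it is non-zero: f y - f z is g y -
    g z divided by f y + f z, and continuity keeps this denominator away from 0. *)
Lemma is_C_derive_sqrt (f g : C -> C) (z a : C) :
  continuous f z -> f z <> 0 ->
  locally (T := C_UniformSpace) z (fun y => f y ^ 2 = g y) ->
  is_C_derive g z a -> is_C_derive f z (a / (2 * f z)).
Proof.
move=> Cf n E /is_C_derive_slope [p [<- [Cp Lp]]].
have Ez : f z ^ 2 = g z by apply: (locally_singleton z _ E).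
have n2 : f z + f z <> 0.
  have -> : f z + f z = 2 * f z by ring.
  apply: Cmult_neq_0 => //; apply: RtoC_neq; lra.
have Cs : continuous (fun y => f y + f z) z.
  apply: C_continuous_plus => //; exact: C_continuous_const.
apply/is_C_derive_slope; exists (fun y => p y * / (f y + f z)); split.
  field; by split.
split.
  apply: C_continuous_mult => //; exact: C_continuous_inv.
have L := C_continuous_locally_neq _ _ _ Cs n2.
apply: filter_imp (filter_and _ _ (filter_and _ _ E Lp) L) => y [[Ey Ep] m].
rewrite Cmult_assoc -Ep -Ey -Ez; field; exact: m.
Qed.

(** * Second-order expansions and a Liouville theorem *)

Lemma Re_plus (x y : C) : Re (x + y) = (Re x + Re y)%R.
Proof. by []. Qed.

Lemma Re_minus (x y : C) : Re (x - y) = (Re x - Re y)%R.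
Proof. by []. Qed.

Lemma Im_minus (x y : C) : Im (x - y) = (Im x - Im y)%R.
Proof. by []. Qed.

Lemma im_le_Cmod (x : C) : (Rabs (Im x) <= Cmod x)%R.
Proof. apply: Rle_trans (Rmax_Cmod x); exact: Rmax_r. Qed.

Lemma Re_RtoC_mult (r : R) (y : C) : Re (r * y) = (r * Re y)%R.
Proof. by rewrite /= /Re; ring. Qed.

Lemma Re_le_Cmod (x : C) : (Re x <= Cmod x)%R.
Proof. apply: Rle_trans (Rle_abs _) (re_le_Cmod x). Qed.

Lemma Re_conj_mult (x : C) : Re (Cconj x * x) = (Cmod x ^ 2)%R.
Proof. rewrite Cmod2_alt /= /Re /Im; ring. Qed.

Lemma derivable_pt_lim_Re (G : C -> C) (t : R) (l : C) :
  is_C_derive G (RtoC t) l -> derivable_pt_lim (fun t : R => Re (G t)) t (Re l).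
Proof.
move=> /is_C_derive_iff H eps e0.
have [d [d0 Hd]] := H (eps / 2)%R ltac:(lra).
exists (mkposreal d d0) => h h0 /= Hh.
have := Hd (RtoC h); rewrite Cmod_R => /(_ Hh).
rewrite -RtoC_plus => H1.
have := Rle_trans _ _ _ (re_le_Cmod _) H1.
rewrite !Re_minus Re_RtoC_mult => H2.
have p : (0 < Rabs h)%R by exact: Rabs_pos_lt.
replace ((Re (G (t + h)%R) - Re (G t)) / h - Re l)%R
  with ((Re (G (t + h)%R) - Re (G t) - h * Re l) / h)%R by (field; auto).
rewrite /Rdiv Rabs_mult Rabs_inv.
apply: (Rmult_lt_reg_r (Rabs h)) => //.
have p2 := Rmult_lt_0_compat _ _ e0 p.
rewrite Rmult_assoc Rinv_l; lra.
Qed.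

(** The real mean value theorem fails for complex values, so it is applied to the projection of F (r
    t) on the direction F t - F 0; [c] is the conjugate of that direction. *)
Lemma C_mean_value (F F1 : C -> C) (t : C) (M : R) :
  (forall r : R, (0 <= r <= 1)%R ->
     is_C_derive F (r * t) (F1 (r * t)) /\ (Cmod (F1 (r * t)%C) <= M)%R) ->
  (Cmod (F t - F 0%R) <= M * Cmod t)%R.
Proof.
move=> H.
pose c := Cconj (F t - F 0).
have D r : (0 <= r <= 1)%R ->
  derivable_pt_lim (fun r : R => Re (c * F (r * t))) r (Re (c * (t * F1 (r * t)))).
  move=> Hr; apply: (derivable_pt_lim_Re (fun s => c * F (s * t))).
  have [H1 _] := H r Hr.
  have Ht : is_C_derive (fun s => s * t) (RtoC r) t.
    apply: is_C_derive_eq (is_C_derive_mult _ _ _ _ _ (is_C_derive_id _) (is_C_derive_const t _)) _.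
    ring.
  apply: is_C_derive_eq (is_C_derive_mult _ _ _ _ _ (is_C_derive_const c _)
    (is_C_derive_comp F (fun s => s * t) _ _ _ H1 Ht)) _.
  ring.
have [r [E Hr]] := MVT_cor2 _ _ 0%R 1%R Rlt_0_1 D.
have {}Hr : (0 <= r <= 1)%R by lra.
have [_ HM] := H r Hr.
move: E; rewrite -Re_minus Cmult_1_l.
have -> : 0%R * t = 0%R by ring.
replace (c * F t - c * F 0%R) with (c * (F t - F 0%R)) by ring.
rewrite Re_conj_mult => E.
have c1 : Cmod c = Cmod (F t - F 0%R) by exact: Cmod_conj.
have E2 : (Cmod (F t - F 0%R) ^ 2 <= Cmod (F t - F 0%R) * (Cmod t * M))%R.
  rewrite E Rminus_0_r Rmult_1_r.
  apply: Rle_trans (Re_le_Cmod _) _.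
  rewrite !Cmod_mult c1.
  apply: Rmult_le_compat_l; first exact: Cmod_ge_0.
  apply: Rmult_le_compat_l => //; exact: Cmod_ge_0.
have p1 := Cmod_ge_0 (F t - F 0%R).
have p2 := Cmod_ge_0 t.
have p3 := Rle_trans _ _ _ (Cmod_ge_0 _) HM.
have p4 := Rmult_le_pos _ _ p2 p3.
case: (Rle_lt_or_eq_dec _ _ p1) => [q|<-]; last lra.
apply: (Rmult_le_reg_l (Cmod (F t - F 0%R))) => //; nra.
Qed.

(** The remainder has derivative f1 (z + s) - f1 z - s l, which is o(s) because f1 is differentiable
    at z; the mean value inequality integrates this to o(t^2). *)
Lemma C_taylor2 (f f1 : C -> C) (z l : C) :
  locally (T := C_UniformSpace) z (fun y => is_C_derive f y (f1 y)) ->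
  is_C_derive f1 z l ->
  forall eps : R, (0 < eps)%R -> exists d : R, (0 < d)%R /\ forall t, (Cmod t < d)%R ->
    (Cmod (f (z + t)%C - f z - t * f1 z - t ^ 2 * (l / 2)) <= eps * Cmod t ^ 2)%R.
Proof.
move=> /C_locally_iff [d1 [d10 H1]] /is_C_derive_iff H eps e0.
have [d [d0 Hd]] := H eps e0.
exists (Rmin d d1); split; first exact: Rmin_pos.
move=> t Ht.
pose F s := f (z + s) - f z - s * f1 z - s ^ 2 * (l / 2).
pose F1 s := f1 (z + s) - f1 z - s * l.
have two : RtoC 2 <> 0 by apply: RtoC_neq; lra.
have := C_mean_value F F1 t (eps * Cmod t)%R.
have -> : F t - F 0%R = f (z + t) - f z - t * f1 z - t ^ 2 * (l / 2).
  rewrite /F Cplus_0_r; field; exact: two.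
rewrite Rmult_assoc => G; have -> : (Cmod t ^ 2 = Cmod t * Cmod t)%R by ring.
apply: G => r Hr.
have m : (Cmod (r * t) <= Cmod t)%R.
  rewrite Cmod_mult Cmod_R Rabs_pos_eq; [have := Cmod_ge_0 t; nra|lra].
have m1 : (Cmod (r * t) < d)%R.
  apply: Rle_lt_trans m _; apply: Rlt_le_trans Ht _; exact: Rmin_l.
have m2 : (Cmod (r * t) < d1)%R.
  apply: Rle_lt_trans m _; apply: Rlt_le_trans Ht _; exact: Rmin_r.
split; last first.
  apply: Rle_trans (Hd _ m1) _; apply: Rmult_le_compat_l => //; lra.
have Dz : is_C_derive f (z + r * t) (f1 (z + r * t)).
  apply: H1. by have -> : z + r * t - z = r * t by ring.
have Ds : is_C_derive (fun s => z + s) (r * t) (RtoC 1).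
  apply: is_C_derive_eq (is_C_derive_plus _ _ _ _ _ (is_C_derive_const z _) (is_C_derive_id _)) _.
  ring.
have Dc : is_C_derive (fun s => f (z + s)) (r * t) (1 * f1 (z + r * t)).
  exact: (is_C_derive_comp f (fun s => z + s) _ _ _ Dz Ds).
have D1 := is_C_derive_mult _ _ _ _ _ (is_C_derive_id (r * t)) (is_C_derive_const (f1 z) (r * t)).
have D2 := is_C_derive_mult _ _ _ _ _ (is_C_derive_pow2 _ _ _ (is_C_derive_id (r * t)))
   (is_C_derive_const (l / 2) (r * t)).
have D3 := is_C_derive_minus _ _ _ _ _ Dc (is_C_derive_const (f z) (r * t)).
apply: is_C_derive_eq (is_C_derive_minus _ _ _ _ _ (is_C_derive_minus _ _ _ _ _ D3 D1) D2) _.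
rewrite /F1; field; exact: two.
Qed.

(** The four increments are r times the fourth roots of unity. These sum to 0, and so do their
    squares, so the linear and quadratic Taylor terms cancel. It plays the role of the mean value
    property of harmonic functions. *)
Lemma four_point_mean (f f1 : C -> C) (z l : C) :
  locally (T := C_UniformSpace) z (fun y => is_C_derive f y (f1 y)) ->
  is_C_derive f1 z l ->
  forall eps : R, (0 < eps)%R -> exists d : R, (0 < d)%R /\
    forall r : R, (0 < r < d)%R ->
    (Cmod (f (z + r)%C + f (z + Ci * r)%C + f (z + - r)%C + f (z + - (Ci * r))%C - 4%R * f z)
       <= eps * r ^ 2)%R.
Proof.
move=> H1 H2 eps e0.
have [d [d0 Hd]] := C_taylor2 f f1 z l H1 H2 (eps / 4)%R ltac:(lra).
exists d; split=> // r Hr.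
have ar : Rabs r = r by apply: Rabs_pos_eq; lra.
have T (t : C) : Cmod t = r ->
  (Cmod (f (z + t)%C - f z - t * f1 z - t ^ 2 * (l / 2)) <= eps / 4 * r ^ 2)%R.
  move=> E; rewrite -E; apply: Hd; rewrite E; lra.
have m1 : Cmod r = r by rewrite Cmod_R.
have m2 : Cmod (Ci * r) = r by rewrite Cmod_mult Cmod_Ci m1; ring.
have m3 : Cmod (- r) = r by rewrite Cmod_opp.
have m4 : Cmod (- (Ci * r)) = r by rewrite Cmod_opp.
have T1 := T _ m1. have T2 := T _ m2. have T3 := T _ m3. have T4 := T _ m4.
set a1 := (f (z + r) - f z - r * f1 z - r ^ 2 * (l / 2)) in T1.
set a2 := (f (z + Ci * r) - f z - Ci * r * f1 z - (Ci * r) ^ 2 * (l / 2)) in T2.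
set a3 := (f (z + - r) - f z - - r * f1 z - (- r) ^ 2 * (l / 2)) in T3.
set a4 := (f (z + - (Ci * r)) - f z - - (Ci * r) * f1 z - (- (Ci * r)) ^ 2 * (l / 2)) in T4.
have Ci2 : Ci * Ci = - (1) by rewrite /Ci /Cmult /Copp /RtoC /=; congr pair; ring.
have -> : f (z + r) + f (z + Ci * r) + f (z + - r) + f (z + - (Ci * r)) - 4%R * f z
  = a1 + a2 + (a3 + a4).
  rewrite /a1 /a2 /a3 /a4.
  have -> : (Ci * r) ^ 2 = - (r * r) by ring [Ci2].
  have -> : (- (Ci * r)) ^ 2 = - (r * r) by ring [Ci2].
  have -> : RtoC 4 = 1 + 1 + 1 + 1 by rewrite -!RtoC_plus; congr RtoC; ring.
  ring.
have := Cmod_triangle (a1 + a2) (a3 + a4).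
have := Cmod_triangle a1 a2. have := Cmod_triangle a3 a4.
lra.
Qed.

(** * Extrema of continuous functions on squares *)

Definition C_real_continuous (phi : C -> R) : Prop :=
  forall (s : C) (eps : R), (0 < eps)%R -> exists d : R, (0 < d)%R /\
    forall y, (Cmod (y - s) < d)%R -> (Rabs (phi y - phi s) < eps)%R.

Lemma C_real_continuous_Re (G : C -> C) :
  (forall z, continuous G z) -> C_real_continuous (fun z => Re (G z)).
Proof.
move=> H s eps e0; have [d [d0 Hd]] := proj1 (C_continuous_iff G s) (H s) eps e0.
exists d; split=> // y Hy; rewrite -Re_minus.
apply: Rle_lt_trans (re_le_Cmod _) _; exact: Hd.
Qed.

Definition in_square (r : R) (s : C) : Prop :=
  (- r <= Re s <= r)%R /\ (- r <= Im s <= r)%R.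

Lemma Cmod_lt_components (x : C) (d : R) :
  (Rabs (Re x) < d / 2)%R -> (Rabs (Im x) < d / 2)%R -> (Cmod x < d)%R.
Proof.
move=> H1 H2.
have -> : x = Re x + Ci * Im x.
  case: x {H1 H2} => a b; rewrite /Cplus /Cmult /Ci /RtoC /Re /Im /=; congr pair; ring.
apply: Rle_lt_trans (Cmod_triangle _ _) _.
rewrite Cmod_mult Cmod_Ci !Cmod_R; lra.
Qed.

(** The gauge at s is capped by 1 / (1 + |phi s|), so the uniform lower bound d on the gauge that
    compactness yields is at the same time the bound 1 / d on phi at the centres. *)
Lemma bounded_on_square (phi : C -> R) (r : R) :
  C_real_continuous phi -> exists M : R, forall s, in_square r s -> (phi s <= M)%R.
Proof.
move=> H.
have P (s : C) : exists d : posreal, (d <= / (1 + Rabs (phi s)))%R /\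
   forall y, (Cmod (y - s) < 2 * d)%R -> (Rabs (phi y - phi s) < 1)%R.
  have [d [d0 Hd]] := H s 1%R Rlt_0_1.
  have p : (0 < / (1 + Rabs (phi s)))%R.
    apply: Rinv_0_lt_compat; have := Rabs_pos (phi s); lra.
  have q : (0 < Rmin (d / 2) (/ (1 + Rabs (phi s))))%R by apply: Rmin_pos; lra.
  exists (mkposreal _ q) => /=; split; first exact: Rmin_r.
  move=> y Hy; apply: Hd.
  have := Rmin_l (d / 2) (/ (1 + Rabs (phi s))); lra.
pose delta (u v : R) := proj1_sig (constructive_indefinite_description _ (P (u, v))).
have Hdelta u v : (delta u v <= / (1 + Rabs (phi (u, v))))%R /\
   forall y, (Cmod (y - (u, v)) < 2 * delta u v)%R -> (Rabs (phi y - phi (u, v)) < 1)%R.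
  exact: (proj2_sig (constructive_indefinite_description _ (P (u, v)))).
have [d Hd] := compactness_value_2d (- r) r (- r) r delta.
exists (/ d + 1)%R => -[x y] [Hx Hy].
have [u [v [_ [_ [Hu [Hv Hduv]]]]]] := NNPP _ (Hd x y Hx Hy).
have [D1 D2] := Hdelta u v.
have c : (Cmod ((x, y) - (u, v)) < 2 * delta u v)%R.
  apply: Cmod_lt_components; rewrite /Re /Im /=.
    have -> : (2 * delta u v / 2 = delta u v)%R by field. exact: Hu.
  have -> : (2 * delta u v / 2 = delta u v)%R by field. exact: Hv.
have := D2 _ c.
have d0 := cond_pos d.
have b : (Rabs (phi (u, v)) <= / d)%R.
  have p := Rabs_pos (phi (u, v)).
  have : (d <= / (1 + Rabs (phi (u, v))))%R by lra.
  move=> /(Rinv_le_contravar _ _ d0); rewrite Rinv_inv; lra.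
move: b => /Rabs_le_between b /Rabs_lt_between; lra.
Qed.

(** If the supremum m were not attained, 1 / (m - phi) would be continuous on the square, hence
    bounded by some N, and m - 1 / N would be a smaller upper bound. *)
Lemma max_on_square (phi : C -> R) (r : R) :
  (0 <= r)%R -> C_real_continuous phi ->
  exists s, in_square r s /\ forall y, in_square r y -> (phi y <= phi s)%R.
Proof.
move=> r0 H.
have [M HM] := bounded_on_square phi r H.
pose E x := exists s, in_square r s /\ x = phi s.
have bE : bound E by exists M => x [s [Hs ->]]; exact: HM.
have nE : exists x, E x.
  exists (phi 0), 0; split=> //; rewrite /in_square /Re /Im /=; lra.
have [m [ub lub]] := completeness E bE nE.
apply: NNPP => no.
have lt s : in_square r s -> (phi s < m)%R.
  move=> Hs; case: (Rle_lt_or_eq_dec (phi s) m) => //; first by apply: ub; exists s.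
  move=> e; case: no; exists s; split=> // y Hy; rewrite e; apply: ub; by exists y.
(* Outside the square [1 / (m - phi)] may fail to be continuous: clamp. *)
pose cl (x : R) := Rmax (- r) (Rmin x r).
have clP x : (- r <= cl x <= r)%R.
  rewrite /cl /Rmax /Rmin; do 2 case: Rle_dec; lra.
have cl1 x y : (Rabs (cl x - cl y) <= Rabs (x - y))%R.
  rewrite /cl /Rmax /Rmin /Rabs; repeat case: Rle_dec; repeat case: Rcase_abs; lra.
have clid x : (- r <= x <= r)%R -> cl x = x.
  rewrite /cl /Rmax /Rmin; repeat case: Rle_dec; lra.
pose k (s : C) : C := (cl (Re s), cl (Im s)).
have kP s : in_square r (k s) by split; exact: clP.
have kid s : in_square r s -> k s = s.
  by case: s => a b [Ha Hb]; rewrite /k /Re /Im /= !clid.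
pose psi s := (/ (m - phi (k s)))%R.
have cpsi : C_real_continuous psi.
  move=> s eps e0.
  have p := lt _ (kP s).
  set a := (m - phi (k s))%R.
  have a0 : (0 < a)%R by rewrite /a; lra.
  have q : (0 < Rmin (a / 2) (eps * a * a / 2))%R.
    apply: Rmin_pos; first lra.
    have : (0 < eps * a * a)%R by repeat apply: Rmult_lt_0_compat. lra.
  have [d [d0 Hd]] := H (k s) _ q.
  exists (d / 2)%R; split; first lra.
  move=> y Hy.
  have c : (Cmod (k y - k s) < d)%R.
    have h1 : (Rabs (Re (y - s)) < d / 2)%R by apply: Rle_lt_trans (re_le_Cmod _) Hy.
    have h2 : (Rabs (Im (y - s)) < d / 2)%R.
      by apply: Rle_lt_trans (im_le_Cmod _) Hy.
    apply: Cmod_lt_components.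
      apply: Rle_lt_trans h1; exact: cl1.
    apply: Rle_lt_trans h2; exact: cl1.
  have := Hd _ c => /Rabs_lt_between Hb.
  have L1 := Rmin_l (a / 2) (eps * a * a / 2).
  have L2 := Rmin_r (a / 2) (eps * a * a / 2).
  have p' := lt _ (kP y).
  rewrite /psi -/a.
  set b := (m - phi (k y))%R.
  have b0 : (a / 2 < b)%R by rewrite /b; move: Hb; rewrite /a in L1 L2 * => Hb; lra.
  have ab : (Rabs (a - b) < eps * a * a / 2)%R.
    apply/Rabs_lt_between; rewrite /b /a in L1 L2 Hb *; lra.
  have -> : (/ b - / a = (a - b) / (b * a))%R by field; lra.
  have ba : (0 < b * a)%R by apply: Rmult_lt_0_compat; lra.
  rewrite Rabs_div; last lra.
  rewrite (Rabs_pos_eq (b * a)); last lra.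
  apply: (Rmult_lt_reg_r (b * a)) => //.
  replace (Rabs (a - b) / (b * a) * (b * a))%R with (Rabs (a - b)) by (field; lra).
  have : (0 < eps * a)%R by apply: Rmult_lt_0_compat.
  nra.
have [N HN] := bounded_on_square psi r cpsi.
have N0 : (0 < N)%R.
  apply: Rlt_le_trans (HN _ (kP 0)); apply: Rinv_0_lt_compat.
  have := lt _ (kP (k 0)); lra.
have : (m <= m - / N)%R.
  apply: lub => x [s [Hs ->]].
  have := HN s Hs; rewrite /psi kid // => h.
  have p := lt _ Hs.
  have : (/ N <= m - phi s)%R.
    rewrite -(Rinv_inv (m - phi s)); apply: Rinv_le_contravar => //.
    apply: Rinv_0_lt_compat; lra.
  lra.
have := Rinv_0_lt_compat _ N0; lra.
Qed.

(** Half-angle formulas; the sign of the imaginary part follows that of y. *)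
Lemma C_square_root (z : C) : exists s, s ^ 2 = z.
Proof.
case: z => x y.
set m := Cmod (x, y).
have m2 : (m * m = x * x + y * y)%R.
  have := Cmod2_alt (x, y); rewrite -/m /Re /Im /=; lra.
have m0 : (0 <= m)%R by exact: Cmod_ge_0.
have m1 : (Rabs x <= m)%R by exact: (re_le_Cmod (x, y)).
move/Rabs_le_between: m1 => m1.
set a := sqrt ((m + x) / 2). set b := sqrt ((m - x) / 2).
have a2 : (a * a = (m + x) / 2)%R by apply: sqrt_sqrt; lra.
have b2 : (b * b = (m - x) / 2)%R by apply: sqrt_sqrt; lra.
have a0 : (0 <= a)%R by exact: sqrt_pos.
have b0 : (0 <= b)%R by exact: sqrt_pos.
have ab : (2 * (a * b) = Rabs y)%R.
  have p : (0 <= a * b)%R by apply: Rmult_le_pos.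
  have e : ((2 * (a * b)) * (2 * (a * b)) = Rabs y * Rabs y)%R.
    replace (2 * (a * b) * (2 * (a * b)))%R with (4 * (a * a) * (b * b))%R by ring.
    rewrite a2 b2 -Rabs_mult Rabs_pos_eq; nra.
  apply: Rsqr_inj; [lra|exact: Rabs_pos|exact: e].
have [y0|y0] := Rle_dec 0 y.
  exists (a, b); rewrite /Cpow /Cmult /RtoC /=; rewrite Rabs_pos_eq // in ab.
  congr pair; lra.
exists (a, - b)%R; rewrite /Cpow /Cmult /RtoC /=; rewrite Rabs_left in ab; last lra.
congr pair; lra.
Qed.

Lemma C_continuous_conj (z : C) : continuous Cconj z.
Proof.
apply/C_continuous_iff => eps e0; exists eps; split=> // y.
by rewrite -Cminus_conj Cmod_conj.
Qed.

(* A Liouville theorem that does not use Cauchy's formula.  The function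
   h(s) = f(u + s^2)/s tends to 0 both at 0 and at infinity; if h(s1) <> 0 then
   Re(conj(h(s1)) h(s)) + eta |s|^2 would have an interior maximum, against the
   second-order mean value property on the four points s + i^k r. *)
Lemma liouville_vanishing (f : C -> C) (u : C) (M c0 : R) :
  (forall z, continuous f z) ->
  (forall z, Cmod (f z) <= M)%R ->
  (forall t, Cmod (f (u + t)%C) <= c0 * Cmod t)%R ->
  (forall z, f z <> 0 -> exists (f1 : C -> C) (l : C),
     locally (T := C_UniformSpace) z (fun y => is_C_derive f y (f1 y)) /\
     is_C_derive f1 z l) ->
  forall z, f z = 0.
Proof.
move=> Hc HM H0 Hd z1; apply: NNPP => nz.
have fu : f u = 0.
  apply: Cmod_eq_0; have := H0 0; rewrite Cplus_0_r Cmod_0.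
  have := Cmod_ge_0 (f u); lra.
(* Squaring the argument leaves room for the division: f (u + s^2) is O(s^2) at 0, so the quotient
   is still O(s). *)
pose h s := f (u + s ^ 2) / s.
have h0 : h 0 = 0.
  have -> : h 0 = f (u + 0 * 0) / 0 by rewrite /h; do 2 f_equal; ring.
  by rewrite Cmult_0_l Cplus_0_r fu; rewrite /Cdiv Cmult_0_l.
have hb s : (Cmod (h s) <= c0 * Cmod s)%R.
  case: (Ceq_dec s 0) => [->|n]; first by rewrite h0 Cmod_0; lra.
  have p : (0 < Cmod s)%R by apply/Cmod_gt_0.
  rewrite Cmod_div //; apply: (Rmult_le_reg_r (Cmod s)) => //.
  have := H0 (s ^ 2); rewrite Cmod_pow => H.
  replace (Cmod (f (u + s ^ 2)%C) / Cmod s * Cmod s)%R with (Cmod (f (u + s ^ 2)%C))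
    by (field; lra).
  lra.
have c00 : (0 <= c0)%R.
  have := Rle_trans _ _ _ (Cmod_ge_0 _) (hb 1); rewrite Cmod_1; lra.
have hM s : (Cmod (h s) * Cmod s <= M)%R.
  case: (Ceq_dec s 0) => [->|n].
    by rewrite Cmod_0 Rmult_0_r; apply: Rle_trans (HM 0); exact: Cmod_ge_0.
  have p : (0 < Cmod s)%R by apply/Cmod_gt_0.
  rewrite Cmod_div //.
  replace (Cmod (f (u + s ^ 2)%C) / Cmod s * Cmod s)%R with (Cmod (f (u + s ^ 2)%C))
    by (field; lra).
  exact: HM.
have cq s : continuous (fun y => u + y ^ 2) s.
  apply: is_C_derive_continuous.
  exact: is_C_derive_plus (is_C_derive_const _ _) (is_C_derive_pow2 _ _ _ (is_C_derive_id _)).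
have ch s : continuous h s.
  case: (Ceq_dec s 0) => [->|n].
    apply/C_continuous_iff => eps e0.
    exists (eps / (c0 + 1))%R; split; first by apply: Rdiv_lt_0_compat; lra.
    move=> y; have -> : y - 0 = y by ring. move=> Hy.
    rewrite h0; have -> : h y - 0 = h y by ring.
    have p := Cmod_ge_0 y.
    apply: Rle_lt_trans (hb y) _.
    apply: (Rle_lt_trans _ ((c0 + 1) * Cmod y)); first nra.
    have : ((c0 + 1) * Cmod y < (c0 + 1) * (eps / (c0 + 1)))%R by apply: Rmult_lt_compat_l; lra.
    by replace ((c0 + 1) * (eps / (c0 + 1)))%R with eps by (field; lra).
  apply: C_continuous_mult.
    apply: (C_continuous_comp (fun y => u + y ^ 2) f); [exact: cq|exact: Hc].
  apply: C_continuous_inv => //; exact: C_continuous_id.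
have dh s : h s <> 0 -> exists (h1 : C -> C) (l : C),
     locally (T := C_UniformSpace) s (fun y => is_C_derive h y (h1 y)) /\
     is_C_derive h1 s l.
  move=> hs.
  have s0 : s <> 0 by move=> E; apply: hs; rewrite E.
  have fs : f (u + s ^ 2) <> 0.
    by move=> E; apply: hs; rewrite /h E /Cdiv Cmult_0_l.
  have [f1 [l [L1 L2]]] := Hd _ fs.
  have Dq y : is_C_derive (fun y => u + y ^ 2) y (2 * y).
    apply: is_C_derive_eq (is_C_derive_plus _ _ _ _ _ (is_C_derive_const _ _)
      (is_C_derive_pow2 _ _ _ (is_C_derive_id y))) _; ring.
  exists (fun y => (2 * y * f1 (u + y ^ 2) * y - f (u + y ^ 2)) * / y ^ 2).
  eexists; split.
    have L0 := C_continuous_locally_neq _ _ _ (C_continuous_id s) s0.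
    have L1' : locally (T := C_UniformSpace) s
       (fun y => is_C_derive f (u + y ^ 2) (f1 (u + y ^ 2))) by exact: (cq s _ L1).
    apply: filter_imp (filter_and _ _ L0 L1') => y [y0 Hy].
    apply: is_C_derive_eq (is_C_derive_div _ _ _ _ _
      (is_C_derive_comp f (fun y => u + y ^ 2) _ _ _ Hy (Dq y)) (is_C_derive_id y) y0) _.
    field; exact: y0.
  have Df := is_C_derive_comp f (fun y => u + y ^ 2) _ _ _ (locally_singleton _ _ L1) (Dq s).
  have Df1 := is_C_derive_comp f1 (fun y => u + y ^ 2) _ _ _ L2 (Dq s).
  have D2y := is_C_derive_mult _ _ _ _ _ (is_C_derive_const 2 s) (is_C_derive_id s).
  have Da := is_C_derive_mult _ _ _ _ _ (is_C_derive_mult _ _ _ _ _ D2y Df1) (is_C_derive_id s).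
  have Db := is_C_derive_inv _ _ _ (is_C_derive_pow2 _ _ _ (is_C_derive_id s)).
  apply: (is_C_derive_mult _ _ _ _ _ (is_C_derive_minus _ _ _ _ _ Da Df) (Db _)).
  have -> : s ^ 2 = s * s by ring.
  exact: Cmult_neq_0.
have [s1 Es1] := C_square_root (z1 - u).
have hs1 : h s1 <> 0.
  have s10 : s1 <> 0.
    move=> E; apply: nz; have : z1 - u = 0 by rewrite -Es1 E; ring.
    by move=> /Cminus_eq_0 ->.
  rewrite /h Es1; have -> : u + (z1 - u) = z1 by ring.
  apply: Cmult_neq_0 => //; exact: Cinv_neq_0.
set e := Cmod (h s1).
have e0 : (0 < e)%R by apply/Cmod_gt_0.
have M0 : (0 <= M)%R by apply: Rle_trans (HM 0); exact: Cmod_ge_0.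
(* Since |h s| |s| <= M, a point with |h s| >= 3/4 e satisfies |s| <= 4 M / (3 e) < r, hence lies
   inside the square of half-side r. *)
set r := (Cmod s1 + 4 * M / e + 1)%R.
have q0 : (0 <= 4 * M / e)%R by apply: Rdiv_le_0_compat; lra.
have p1 := Cmod_ge_0 s1.
have r0 : (0 < r)%R by rewrite /r; lra.
have rM : (4 * M <= e * r)%R.
  have : (e * (4 * M / e) <= e * r)%R by apply: Rmult_le_compat_l; rewrite /r; lra.
  by replace (e * (4 * M / e))%R with (4 * M)%R by (field; lra).
(* Small enough that eta |s|^2 is at most 2 eta r^2 = e^2 / 4 on the whole square, corners included:
   at the maximum, Re (c h) is still at least 3/4 e^2. *)
set eta := (e ^ 2 / (8 * r ^ 2))%R.
have eta0 : (0 < eta)%R by apply: Rdiv_lt_0_compat; nra.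
have etar : (eta * r ^ 2 = e ^ 2 / 8)%R by rewrite /eta; field; lra.
pose c := Cconj (h s1).
have mc : Cmod c = e by exact: Cmod_conj.
pose phi s := Re (c * h s + eta * (Cconj s * s)).
have phiE s : phi s = (Re (c * h s) + eta * (Re s ^ 2 + Im s ^ 2))%R.
  by rewrite /phi Re_plus Re_RtoC_mult Re_conj_mult Cmod2_alt.
have cphi : C_real_continuous phi.
  apply: C_real_continuous_Re => s.
  apply: C_continuous_plus; apply: C_continuous_mult.
  - exact: C_continuous_const.
  - exact: ch.
  - exact: C_continuous_const.
  - apply: C_continuous_mult; [exact: C_continuous_conj|exact: C_continuous_id].
have [s [[Hs1 Hs2] Hmax]] := max_on_square phi r (Rlt_le _ _ r0) cphi.
have big : (e ^ 2 <= phi s)%R.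
  have i1 : in_square r s1.
    have := re_le_Cmod s1. have := im_le_Cmod s1 => /Rabs_le_between ? /Rabs_le_between ?.
    rewrite /in_square /r; lra.
  apply: Rle_trans (Hmax _ i1); rewrite phiE /c Re_conj_mult -/e.
  have := pow2_ge_0 (Re s1). have := pow2_ge_0 (Im s1). nra.
have sq1 : (Re s ^ 2 <= r ^ 2)%R by nra.
have sq2 : (Im s ^ 2 <= r ^ 2)%R by nra.
have small : (3 / 4 * e ^ 2 <= Re (c * h s))%R by rewrite phiE in big; nra.
have small' : (3 / 4 * e <= Cmod (h s))%R.
  have := Re_le_Cmod (c * h s); rewrite Cmod_mult mc; nra.
have mS : (Cmod s < r)%R.
  have := hM s; have := Cmod_ge_0 s. nra.
have hs : h s <> 0 by move=> E; rewrite E Cmod_0 in small'; lra.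
have [h1 [l [L1 L2]]] := dh s hs.
(* With this tolerance the four-point sum of Re (c h) drops by at most 2 eta t^2, whereas that of
   eta |s|^2 grows by exactly 4 eta t^2. *)
have [d [d0 Hd4]] := four_point_mean h h1 s l L1 L2 (2 * eta / e)%R
  ltac:(apply: Rdiv_lt_0_compat; lra).
set t := (Rmin d (r - Cmod s) / 2)%R.
have t0 : (0 < Rmin d (r - Cmod s))%R by apply: Rmin_pos; lra.
have t1 := Rmin_l d (r - Cmod s). have t2 := Rmin_r d (r - Cmod s).
have := Hd4 t ltac:(rewrite /t; lra).
have ins (x : C) : Cmod x = t -> in_square r (s + x).
  move=> E; have T := Cmod_triangle s x.
  have := re_le_Cmod (s + x). have := im_le_Cmod (s + x) => /Rabs_le_between ? /Rabs_le_between ?.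
  rewrite E /t in T; rewrite /in_square; lra.
have mt : Cmod t = t by rewrite Cmod_R Rabs_pos_eq // /t; lra.
have i1 := Hmax _ (ins _ mt).
have i2 := Hmax (s + Ci * t) (ins (Ci * t) ltac:(by rewrite Cmod_mult Cmod_Ci mt; ring)).
have i3 := Hmax (s + - t) (ins (- t) ltac:(by rewrite Cmod_opp)).
have i4 := Hmax (s + - (Ci * t)) (ins (- (Ci * t)) ltac:(by rewrite Cmod_opp Cmod_mult Cmod_Ci mt; ring)).
set S := (h (s + t) + h (s + Ci * t) + h (s + - t) + h (s + - (Ci * t)) - 4%R * h s).
move=> HS.
have RS : (- (2 * eta * t ^ 2) <= Re (c * S))%R.
  have : (Rabs (Re (c * S)) <= 2 * eta * t ^ 2)%R.
    apply: Rle_trans (re_le_Cmod _) _; rewrite Cmod_mult mc.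
    have -> : (2 * eta * t ^ 2 = e * (2 * eta / e * t ^ 2))%R by field; lra.
    apply: Rmult_le_compat_l; lra.
  move=> /Rabs_le_between; lra.
have SE : Re (c * S) = (Re (c * h (s + t)%C) + Re (c * h (s + Ci * t)%C) + Re (c * h (s + - t)%C)
   + Re (c * h (s + - (Ci * t))%C) - 4 * Re (c * h s))%R.
  rewrite -Re_RtoC_mult -!Re_plus -Re_minus; congr Re; rewrite /S; ring.
move: i1 i2 i3 i4; rewrite !phiE !Re_plus.
have -> : Im (s + t) = Im s by rewrite /Im /=; ring.
have -> : Im (s + - t) = Im s by rewrite /Im /=; ring.
have -> : Im (s + Ci * t) = (Im s + t)%R by rewrite /Im /=; ring.
have -> : Im (s + - (Ci * t)) = (Im s - t)%R by rewrite /Im /=; ring.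
have -> : Re (Ci * t) = 0%R by rewrite /Re /=; ring.
have -> : Re (- (Ci * t)) = 0%R by rewrite /Re /=; ring.
have -> : Re (- t) = (- t)%R by [].
have -> : Re t = t by [].
move=> i1 i2 i3 i4.
have : (0 < eta * t ^ 2)%R by apply: Rmult_lt_0_compat => //; rewrite /t; nra.
nra.
Qed.

(** * Sums over squares of the lattice *)

Lemma sum_n_first (a : nat -> C) (n : nat) :
  sum_n a (S n) = a 0%nat + sum_n (fun k => a (S k)) n.
Proof.
elim: n => [|n IH].
  by rewrite sum_Sn !sum_O.
rewrite sum_Sn IH (sum_Sn _ n) /plus /=; ring.
Qed.

Lemma sum_sym_0 (f : Z -> C) : sum_sym 0 f = f 0%Z.
Proof. by rewrite /sum_sym sum_O. Qed.

Lemma sum_sym_S (N : nat) (f : Z -> C) :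
  sum_sym (S N) f = sum_sym N f + f (Z.of_nat (S N)) + f (- Z.of_nat (S N))%Z.
Proof.
rewrite /sum_sym.
have -> : (2 * S N = S (S (2 * N)))%nat by lia.
rewrite sum_n_first sum_Sn.
have -> : (Z.of_nat 0 - Z.of_nat (S N) = - Z.of_nat (S N))%Z by lia.
have -> : (Z.of_nat (S (S (2 * N))) - Z.of_nat (S N) = Z.of_nat (S N))%Z by lia.
rewrite (sum_n_ext _ (fun k => f (Z.of_nat k - Z.of_nat N)%Z)); last by move=> k; f_equal; lia.
rewrite /plus /=; ring.
Qed.

Lemma sum_sym_ext (N : nat) (f g : Z -> C) :
  (forall k, f k = g k) -> sum_sym N f = sum_sym N g.
Proof. by move=> H; apply: sum_n_ext. Qed.

Lemma sum_sym_plus (N : nat) (f g : Z -> C) :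
  sum_sym N (fun k => f k + g k) = sum_sym N f + sum_sym N g.
Proof. elim: N => [|N IH]; rewrite ?sum_sym_0 // !sum_sym_S IH; ring. Qed.

Lemma sum_sym_scal (N : nat) (a : C) (f : Z -> C) :
  sum_sym N (fun k => a * f k) = a * sum_sym N f.
Proof. elim: N => [|N IH]; rewrite ?sum_sym_0 // !sum_sym_S IH; ring. Qed.

Lemma sum_sym_minus (N : nat) (f g : Z -> C) :
  sum_sym N (fun k => f k - g k) = sum_sym N f - sum_sym N g.
Proof. elim: N => [|N IH]; rewrite ?sum_sym_0 // !sum_sym_S IH; ring. Qed.

Lemma sum_sym_reflect (N : nat) (f : Z -> C) :
  sum_sym N (fun k => f (- k)%Z) = sum_sym N f.
Proof.
elim: N => [|N IH]; rewrite ?sum_sym_0 // !sum_sym_S IH Z.opp_involutive; ring.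
Qed.

Lemma sum_sym_telescope (N : nat) (f : Z -> C) :
  sum_sym N (fun k => f (k + 1)%Z - f k) = f (Z.of_nat N + 1)%Z - f (- Z.of_nat N)%Z.
Proof.
elim: N => [|N IH]; first by rewrite sum_sym_0.
rewrite sum_sym_S IH.
have -> : (Z.of_nat (S N) = Z.of_nat N + 1)%Z by lia.
have -> : (- (Z.of_nat N + 1) + 1 = - Z.of_nat N)%Z by lia.
ring.
Qed.

Lemma sum_sym_bound (N : nat) (f : Z -> C) (K : R) :
  (forall k, (Z.abs k <= Z.of_nat N)%Z -> Cmod (f k) <= K)%R ->
  (Cmod (sum_sym N f) <= (2 * INR N + 1) * K)%R.
Proof.
elim: N => [|N IH] H.
  rewrite sum_sym_0 /=; have := H 0%Z ltac:(lia); lra.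
rewrite sum_sym_S.
have H1 := H (Z.of_nat (S N)) ltac:(lia).
have H2 := H (- Z.of_nat (S N))%Z ltac:(lia).
have H3 := IH (fun k Hk => H k ltac:(lia)).
rewrite S_INR.
have := Cmod_triangle (sum_sym N f + f (Z.of_nat (S N))) (f (- Z.of_nat (S N))%Z).
have := Cmod_triangle (sum_sym N f) (f (Z.of_nat (S N))).
lra.
Qed.

Definition square_sum (N : nat) (F : Z -> Z -> C) : C :=
  sum_sym N (fun m => sum_sym N (F m)).

Lemma square_sum_ext (N : nat) (F G : Z -> Z -> C) :
  (forall m n, F m n = G m n) -> square_sum N F = square_sum N G.
Proof. by move=> H; apply: sum_sym_ext => m; apply: sum_sym_ext. Qed.

Lemma square_sum_plus (N : nat) (F G : Z -> Z -> C) :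
  square_sum N (fun m n => F m n + G m n) = square_sum N F + square_sum N G.
Proof.
rewrite /square_sum -sum_sym_plus; apply: sum_sym_ext => m; exact: sum_sym_plus.
Qed.

Lemma square_sum_scal (N : nat) (a : C) (F : Z -> Z -> C) :
  square_sum N (fun m n => a * F m n) = a * square_sum N F.
Proof.
rewrite /square_sum -sum_sym_scal; apply: sum_sym_ext => m; exact: sum_sym_scal.
Qed.

Lemma square_sum_reflect (N : nat) (F : Z -> Z -> C) :
  square_sum N (fun m n => F (- m)%Z (- n)%Z) = square_sum N F.
Proof.
rewrite /square_sum -(sum_sym_reflect N (fun m => sum_sym N (F m))).
apply: sum_sym_ext => m; exact: sum_sym_reflect.
Qed.

Definition max_norm (m n : Z) : Z := Z.max (Z.abs m) (Z.abs n).

(** The boundary of the square of index N + 1 has two sides of 2 N + 1 points and two of 2 N + 3, in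
    all 8 (N + 1). *)
Lemma square_sum_shell (N : nat) (F : Z -> Z -> C) (K : R) :
  (forall m n, max_norm m n = Z.of_nat (S N) -> Cmod (F m n) <= K)%R ->
  (Cmod (square_sum (S N) F - square_sum N F) <= 8 * INR (S N) * K)%R.
Proof.
move=> H; set k := Z.of_nat (S N).
have -> : square_sum (S N) F - square_sum N F =
  sum_sym N (fun m => F m k) + sum_sym N (fun m => F m (- k)%Z) +
  (sum_sym (S N) (F k) + sum_sym (S N) (F (- k)%Z)).
  rewrite /square_sum sum_sym_S -/k.
  rewrite (sum_sym_ext N (fun m => sum_sym (S N) (F m))
    (fun m => sum_sym N (F m) + F m k + F m (- k)%Z)); last by move=> m; rewrite sum_sym_S.
  rewrite !sum_sym_plus; ring.
have B1 : (Cmod (sum_sym N (fun m => F m k)) <= (2 * INR N + 1) * K)%R.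
  apply: sum_sym_bound => m Hm; apply: H; rewrite /max_norm /k; lia.
have B2 : (Cmod (sum_sym N (fun m => F m (- k)%Z)) <= (2 * INR N + 1) * K)%R.
  apply: sum_sym_bound => m Hm; apply: H; rewrite /max_norm /k; lia.
have B3 : (Cmod (sum_sym (S N) (F k)) <= (2 * INR (S N) + 1) * K)%R.
  apply: sum_sym_bound => m Hm; apply: H; rewrite /max_norm /k; lia.
have B4 : (Cmod (sum_sym (S N) (F (- k)%Z)) <= (2 * INR (S N) + 1) * K)%R.
  apply: sum_sym_bound => m Hm; apply: H; rewrite /max_norm /k; lia.
rewrite S_INR in B3 B4 *.
have := Cmod_triangle (sum_sym N (fun m => F m k) + sum_sym N (fun m => F m (- k)%Z))
  (sum_sym (S N) (F k) + sum_sym (S N) (F (- k)%Z)).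
have := Cmod_triangle (sum_sym N (fun m => F m k)) (sum_sym N (fun m => F m (- k)%Z)).
have := Cmod_triangle (sum_sym (S N) (F k)) (sum_sym (S N) (F (- k)%Z)).
lra.
Qed.

(** * Convergence of square sums and their behaviour under shifts *)

Definition C_converges (u : nat -> C) (l : C) : Prop :=
  forall eps : R, (0 < eps)%R ->
    exists N : nat, forall n, (N <= n)%nat -> (Cmod (u n - l) <= eps)%R.

Lemma C_lim_seq_unique (u : nat -> C) (l : C) : C_converges u l -> C_lim_seq u = l.
Proof.
move=> H.
have H1 : is_lim_seq (fun n => Re (u n)) (Re l).
  apply/is_lim_seq_spec => eps.
  have [N HN] := H (eps / 2)%R ltac:(have := cond_pos eps; lra).
  exists N => n Hn; have := HN n Hn; have := re_le_Cmod (u n - l).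
  rewrite Re_minus; have := cond_pos eps; lra.
have H2 : is_lim_seq (fun n => Im (u n)) (Im l).
  apply/is_lim_seq_spec => eps.
  have [N HN] := H (eps / 2)%R ltac:(have := cond_pos eps; lra).
  exists N => n Hn; have := HN n Hn.
  have := im_le_Cmod (u n - l).
  rewrite Im_minus; have := cond_pos eps; lra.
rewrite /C_lim_seq (is_lim_seq_unique _ _ H1) (is_lim_seq_unique _ _ H2) /=.
by case: l {H H1 H2}.
Qed.

Lemma C_converges_unique (u : nat -> C) (l l' : C) :
  C_converges u l -> C_converges u l' -> l = l'.
Proof. by move=> /C_lim_seq_unique <- /C_lim_seq_unique. Qed.

Lemma C_converges_ext (u v : nat -> C) (l : C) :
  (forall n, u n = v n) -> C_converges u l -> C_converges v l.
Proof.
move=> E H eps e0; have [N HN] := H eps e0; exists N => n Hn; rewrite -E; exact: HN.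
Qed.

Lemma C_converges_plus (u v : nat -> C) (l l' : C) :
  C_converges u l -> C_converges v l' -> C_converges (fun n => u n + v n) (l + l').
Proof.
move=> H1 H2 eps e0.
have [N1 HN1] := H1 (eps / 2)%R ltac:(lra).
have [N2 HN2] := H2 (eps / 2)%R ltac:(lra).
exists (N1 + N2)%nat => n Hn.
have := HN1 n ltac:(lia). have := HN2 n ltac:(lia).
have -> : u n + v n - (l + l') = (u n - l) + (v n - l') by ring.
have := Cmod_triangle (u n - l) (v n - l'); lra.
Qed.

Lemma C_converges_scal (a : C) (u : nat -> C) (l : C) :
  C_converges u l -> C_converges (fun n => a * u n) (a * l).
Proof.
move=> H eps e0.
have p := Cmod_ge_0 a.
have [N HN] := H (eps / (Cmod a + 1))%R ltac:(apply: Rdiv_lt_0_compat; lra).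
exists N => n Hn.
have -> : a * u n - a * l = a * (u n - l) by ring.
rewrite Cmod_mult.
apply: Rle_trans (Rmult_le_compat_l _ _ _ p (HN n Hn)) _.
apply: (Rle_trans _ ((Cmod a + 1) * (eps / (Cmod a + 1)))).
  apply: Rmult_le_compat_r; last lra.
  apply: Rlt_le; apply: Rdiv_lt_0_compat; lra.
apply: Req_le; field; lra.
Qed.

Lemma C_converges_const (a : C) : C_converges (fun _ => a) a.
Proof.
move=> eps e0; exists 0%nat => n _.
have -> : a - a = 0 by ring. rewrite Cmod_0; lra.
Qed.

Lemma C_converges_bound (u : nat -> C) (l a : C) (K : R) :
  C_converges u l -> (forall n, Cmod (u n - a) <= K)%R -> (Cmod (l - a) <= K)%R.
Proof.
move=> H HK; apply: Rnot_lt_le => lt.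
have [N HN] := H ((Cmod (l - a) - K) / 2)%R ltac:(lra).
have := HN N (le_n N). have := HK N.
have := Cmod_triangle_rev (l - a) (l - u N).
have -> : l - a - (l - u N) = u N - a by ring.
rewrite (Cmod_minus_sym l (u N)); lra.
Qed.

(** 1 / (n + 1)^2 <= 1 / n - 1 / (n + 1) makes the increments from index 1 on telescope to at most
    K; the first increment contributes the other K. *)
Lemma C_converges_of_increments (u : nat -> C) (K : R) :
  (forall n, Cmod (u (S n) - u n) <= K / INR (S n) ^ 2)%R ->
  (exists l, C_converges u l) /\ forall n, (Cmod (u n - u 0%nat) <= 2 * K)%R.
Proof.
move=> H.
have K0 : (0 <= K)%R.
  have := Rle_trans _ _ _ (Cmod_ge_0 _) (H 0%nat); rewrite /=; lra.
have step n : (1 <= n)%nat -> (/ INR (S n) ^ 2 <= / INR n - / INR (S n))%R.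
  move=> Hn; have p : (1 <= INR n)%R by apply: (le_INR 1).
  rewrite S_INR.
  have -> : (/ INR n - / (INR n + 1) = / (INR n * (INR n + 1)))%R by field; lra.
  apply: Rinv_le_contravar; nra.
have tail n k : (1 <= n)%nat -> (Cmod (u (n + k)%nat - u n) <= K * (/ INR n - / INR (n + k)%nat))%R.
  move=> Hn; elim: k => [|k IH].
    rewrite Nat.add_0_r; have -> : u n - u n = 0 by ring. rewrite Cmod_0; lra.
  have -> : (n + S k = S (n + k))%nat by lia.
  have -> : u (S (n + k)) - u n = (u (S (n + k)) - u (n + k)%nat) + (u (n + k)%nat - u n) by ring.
  have := Cmod_triangle (u (S (n + k)) - u (n + k)%nat) (u (n + k)%nat - u n).
  have := H (n + k)%nat. have := step (n + k)%nat ltac:(lia).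
  move=> /(Rmult_le_compat_l K _ _ K0); rewrite /Rdiv; lra.
have small n k : (1 <= n)%nat -> (Cmod (u (n + k)%nat - u n) <= K * / INR n)%R.
  move=> Hn; apply: Rle_trans (tail n k Hn) _.
  apply: Rmult_le_compat_l => //.
  have : (0 < / INR (n + k)%nat)%R by apply: Rinv_0_lt_compat; apply: lt_0_INR; lia.
  lra.
split; last first.
  case=> [|n]; first by (have -> : u 0%nat - u 0%nat = 0 by ring); rewrite Cmod_0; lra.
  have := small 1%nat n (le_n _); have := H 0%nat; rewrite /= => H1 H2.
  have -> : u (S n) - u 0%nat = (u (S n) - u 1%nat) + (u 1%nat - u 0%nat) by ring.
  have := Cmod_triangle (u (S n) - u 1%nat) (u 1%nat - u 0%nat); lra.
have cauchy (p : C -> R) : (forall x y, Rabs (p x - p y) <= Cmod (x - y))%R ->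
   ex_finite_lim_seq (fun n => p (u n)).
  move=> Hp; apply/ex_lim_seq_cauchy_corr => eps.
  have e0 := cond_pos eps.
  have [N HN] := nfloor_ex (2 * K / eps)%R ltac:(apply: Rdiv_le_0_compat; lra).
  exists (S N) => n m Hn Hm.
  have q (j : nat) : (S N <= j)%nat -> (Cmod (u j - u (S N)) < eps / 2)%R.
    move=> Hj; have -> : j = (S N + (j - S N))%nat by lia.
    apply: Rle_lt_trans (small _ _ _) _; first lia.
    have s0 : (0 < INR (S N))%R by apply: lt_0_INR; lia.
    apply: (Rmult_lt_reg_r (INR (S N))) => //.
    rewrite Rmult_assoc Rinv_l; last lra.
    have := HN; rewrite S_INR => -[_ h].
    have : (2 * K / eps * eps < (INR N + 1) * eps)%R by apply: Rmult_lt_compat_r.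
    replace (2 * K / eps * eps)%R with (2 * K)%R by (field; lra). lra.
  apply: Rle_lt_trans (Hp _ _) _.
  have -> : u n - u m = (u n - u (S N)) - (u m - u (S N)) by ring.
  have := Cmod_triangle_minus (u n - u (S N)) (u m - u (S N)).
  have := q n Hn. have := q m Hm. lra.
have [a Ha] := cauchy Re (fun x y => re_le_Cmod (x - y)).
have [b Hb] := cauchy Im (fun x y => im_le_Cmod (x - y)).
exists (a, b) => eps e0.
have e2 : (0 < eps / 2)%R by lra.
move/is_lim_seq_spec: Ha => /(_ (mkposreal _ e2)) [N1 HN1].
move/is_lim_seq_spec: Hb => /(_ (mkposreal _ e2)) [N2 HN2].
exists (N1 + N2)%nat => n Hn; apply: Rlt_le; apply: Cmod_lt_components.
  exact: (HN1 n ltac:(lia)).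
exact: (HN2 n ltac:(lia)).
Qed.

(** A shell of 8 n terms of size K / n^3 is an increment of size 8 K / n^2; hence cubic decay as the
    condition on lattice sums, and the constant 16 = 2 * 8. *)
Lemma square_sum_converges (F : Z -> Z -> C) (K : R) :
  (forall m n, (0 < max_norm m n)%Z -> Cmod (F m n) <= K / IZR (max_norm m n) ^ 3)%R ->
  exists l, C_converges (fun N => square_sum N F) l /\ (Cmod (l - F 0%Z 0%Z) <= 16 * K)%R.
Proof.
move=> H.
have [[l Hl] Hb] : (exists l, C_converges (fun N => square_sum N F) l) /\
  forall n, (Cmod (square_sum n F - square_sum 0 F) <= 2 * (8 * K))%R.
  apply: C_converges_of_increments => N.
  have p : (0 < INR (S N))%R by apply: lt_0_INR; lia.
  have -> : (8 * K / INR (S N) ^ 2 = 8 * INR (S N) * (K / INR (S N) ^ 3))%R by field; lra.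
  apply: square_sum_shell => m n E.
  have := H m n ltac:(lia); by rewrite E -INR_IZR_INZ.
exists l; split=> //.
apply: (C_converges_bound _ _ _ _ Hl) => n.
have := Hb n; rewrite {2}/square_sum !sum_sym_0; lra.
Qed.

Lemma square_sum_shift_bound (K : R) (N : nat) (f g : Z -> C) :
  (1 <= N)%nat ->
  (forall k, (Z.abs k <= Z.of_nat N)%Z -> Cmod (f k) <= K / INR N ^ 2)%R ->
  (forall k, (Z.abs k <= Z.of_nat N)%Z -> Cmod (g k) <= K / INR N ^ 2)%R ->
  (Cmod (sum_sym N f - sum_sym N g) <= 6 * K / INR N)%R.
Proof.
move=> HN Hf Hg.
have p : (1 <= INR N)%R by apply: (le_INR 1).
have K0 : (0 <= K / INR N ^ 2)%R.
  apply: Rle_trans (Hf 0%Z ltac:(lia)); exact: Cmod_ge_0.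
have -> : (6 * K / INR N = 2 * (3 * INR N * (K / INR N ^ 2)))%R by field; lra.
have := Cmod_triangle_minus (sum_sym N f) (sum_sym N g).
have := sum_sym_bound _ _ _ Hf. have := sum_sym_bound _ _ _ Hg.
nra.
Qed.

Lemma C_converges_inv_nat (u : nat -> C) (K : R) :
  (forall N, (1 <= N)%nat -> Cmod (u N) <= K / INR N)%R -> C_converges u 0.
Proof.
move=> H eps e0.
have K0 : (0 <= K)%R.
  have := Rle_trans _ _ _ (Cmod_ge_0 _) (H 1%nat (le_n _)); rewrite /=; lra.
have [N HN] := nfloor_ex (K / eps)%R ltac:(apply: Rdiv_le_0_compat; lra).
exists (S N) => n Hn.
have -> : u n - 0 = u n by ring.
apply: Rle_trans (H n ltac:(lia)) _.
have p : (INR (S N) <= INR n)%R by exact: le_INR.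
rewrite S_INR in p.
have p2 := pos_INR N.
apply: (Rmult_le_reg_r (INR n)); first lra.
replace (K / INR n * INR n)%R with K by (field; lra).
have : (K / eps * eps <= (INR N + 1) * eps)%R by apply: Rmult_le_compat_r; lra.
replace (K / eps * eps)%R with K by (field; lra).
nra.
Qed.

(** Quadratic decay does not make a lattice sum absolutely convergent, so a shift of the index is
    justified by telescoping: what survives is O(N) boundary terms of size K / N^2. *)
Lemma square_sum_shift (A : Z -> Z -> C) (K : R) :
  (forall m n, (0 < max_norm m n)%Z -> Cmod (A m n) <= K / IZR (max_norm m n) ^ 2)%R ->
  C_converges (fun N => square_sum N (fun m n => A (m + 1)%Z n - A m n)) 0 /\
  C_converges (fun N => square_sum N (fun m n => A m (n + 1)%Z - A m n)) 0.
Proof.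
move=> H.
have K0 : (0 <= K)%R.
  have := Rle_trans _ _ _ (Cmod_ge_0 _) (H 1%Z 0%Z ltac:(rewrite /max_norm; lia)).
  have -> : max_norm 1 0 = 1%Z by [].
  lra.
have B (N : nat) m n : (1 <= N)%nat -> (Z.of_nat N <= max_norm m n)%Z ->
   (Cmod (A m n) <= K / INR N ^ 2)%R.
  move=> HN E; apply: Rle_trans (H m n ltac:(lia)) _.
  have p : (1 <= INR N)%R by apply: (le_INR 1).
  have q : (INR N <= IZR (max_norm m n))%R by rewrite INR_IZR_INZ; exact: IZR_le.
  apply: Rmult_le_compat_l => //.
  apply: Rinv_le_contravar; nra.
split; apply: (C_converges_inv_nat _ (6 * K)) => N HN.
  have -> : square_sum N (fun m n => A (m + 1)%Z n - A m n) =
     sum_sym N (A (Z.of_nat N + 1)%Z) - sum_sym N (A (- Z.of_nat N)%Z).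
    rewrite -(sum_sym_telescope N (fun m => sum_sym N (A m))).
    apply: sum_sym_ext => m; exact: sum_sym_minus.
  apply: square_sum_shift_bound => // k Hk; apply: B => //; rewrite /max_norm; lia.
have -> : square_sum N (fun m n => A m (n + 1)%Z - A m n) =
   sum_sym N (fun m => A m (Z.of_nat N + 1)%Z) - sum_sym N (fun m => A m (- Z.of_nat N)%Z).
  rewrite -sum_sym_minus; apply: sum_sym_ext => m; exact: (sum_sym_telescope N (A m)).
apply: square_sum_shift_bound => // k Hk; apply: B => //; rewrite /max_norm; lia.
Qed.

(** * Termwise differentiation of the Weierstrass series *)

(** Quantitative form of the linear independence of the half-periods over the reals: it makes |l|
    comparable to [max_norm], which indexes the shells. *)
Definition nondegenerate (w w' : C) : Prop :=
  exists c : R, (0 < c)%R /\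
    forall m n, (c * IZR (max_norm m n) <= Cmod (period w w' m n))%R.

(** The point 0 is allowed, because the series without the term l = 0 are also needed there. *)
Definition avoids (w w' z : C) : Prop :=
  forall m n, (0 < max_norm m n)%Z -> z <> period w w' m n.

Lemma period_plus (w w' : C) (m n m' n' : Z) :
  period w w' (m + m') (n + n') = period w w' m n + period w w' m' n'.
Proof. rewrite /period !plus_IZR !RtoC_plus; ring. Qed.

Lemma period_opp (w w' : C) (m n : Z) :
  period w w' (- m) (- n) = - period w w' m n.
Proof. rewrite /period !opp_IZR !RtoC_opp; ring. Qed.

Lemma period_0 (w w' : C) : period w w' 0 0 = 0.
Proof. rewrite /period; ring. Qed.

Lemma lattice_period (w w' : C) (m n : Z) : lattice w w' (period w w' m n).
Proof. by exists m, n. Qed.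

Lemma lattice_0 (w w' : C) : lattice w w' 0.
Proof. by exists 0%Z, 0%Z; rewrite period_0. Qed.

Lemma lattice_plus (w w' x y : C) :
  lattice w w' x -> lattice w w' y -> lattice w w' (x + y).
Proof.
by move=> [m [n ->]] [m' [n' ->]]; exists (m + m')%Z, (n + n')%Z; rewrite period_plus.
Qed.

Lemma lattice_opp (w w' x : C) : lattice w w' x -> lattice w w' (- x).
Proof. by move=> [m [n ->]]; exists (- m)%Z, (- n)%Z; rewrite period_opp. Qed.

Lemma lattice_minus (w w' x y : C) :
  lattice w w' x -> lattice w w' y -> lattice w w' (x - y).
Proof. by move=> Hx /lattice_opp Hy; apply: lattice_plus. Qed.

Lemma not_lattice_plus (w w' z p : C) :
  ~ lattice w w' z -> lattice w w' p -> ~ lattice w w' (z + p).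
Proof.
move=> H Hp Hz; apply: H; have -> : z = z + p - p by ring.
exact: lattice_minus.
Qed.

Lemma not_lattice_opp (w w' z : C) : ~ lattice w w' z -> ~ lattice w w' (- z).
Proof. by move=> H /lattice_opp Hz; apply: H; have <- : - - z = z by ring. Qed.

Lemma not_lattice_avoids (w w' z : C) : ~ lattice w w' z -> avoids w w' z.
Proof. by move=> H m n _ E; apply: H; exists m, n. Qed.

Lemma max_norm_0 (m n : Z) : ~ (0 < max_norm m n)%Z -> m = 0%Z /\ n = 0%Z.
Proof. rewrite /max_norm; lia. Qed.

Lemma avoids_not_lattice (w w' z : C) : avoids w w' z -> z <> 0 -> ~ lattice w w' z.
Proof.
move=> H n0 [m [n E]].
case: (Z_lt_dec 0 (max_norm m n)) => [p|/max_norm_0 [em en]].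
  exact: (H m n p).
by apply: n0; rewrite E em en period_0.
Qed.

Lemma uniform_positive (P : Z -> R -> Prop) (N : nat) :
  (forall k d d', P k d -> (d' <= d)%R -> P k d') ->
  (forall k, (Z.abs k <= Z.of_nat N)%Z -> exists d, (0 < d)%R /\ P k d) ->
  exists d, (0 < d)%R /\ forall k, (Z.abs k <= Z.of_nat N)%Z -> P k d.
Proof.
move=> mono; elim: N => [|N IH] H.
  have [d [d0 Hd]] := H 0%Z ltac:(lia).
  exists d; split=> // k Hk; by have -> : k = 0%Z by lia.
have [d [d0 Hd]] := IH (fun k Hk => H k ltac:(lia)).
have [d1 [d10 H1]] := H (Z.of_nat (S N)) ltac:(lia).
have [d2 [d20 H2]] := H (- Z.of_nat (S N))%Z ltac:(lia).
exists (Rmin d (Rmin d1 d2)); split; first by repeat apply: Rmin_pos.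
have i1 := Rmin_l d (Rmin d1 d2). have i2 := Rmin_r d (Rmin d1 d2).
have i3 := Rmin_l d1 d2. have i4 := Rmin_r d1 d2.
move=> k Hk.
case: (Z.eq_dec k (Z.of_nat (S N))) => [->|n1]; first by apply: mono H1 _; lra.
case: (Z.eq_dec k (- Z.of_nat (S N))) => [->|n2]; first by apply: mono H2 _; lra.
by apply: mono (Hd k ltac:(lia)) _.
Qed.

(** Far lattice points satisfy |z - l| >= |l| / 2; the finitely many near ones are at positive
    distance from z0. A single constant c, uniform for z near z0, covers both cases. *)
Lemma lattice_separation (w w' z0 : C) :
  nondegenerate w w' -> avoids w w' z0 ->
  exists c d : R, (0 < c)%R /\ (0 < d)%R /\
    forall z, (Cmod (z - z0) < d)%R -> forall m n, (0 < max_norm m n)%Z ->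
      (c * IZR (max_norm m n) <= Cmod (z - period w w' m n))%R /\
      (c * IZR (max_norm m n) <= Cmod (period w w' m n))%R.
Proof.
move=> [c0 [c00 H0]] Hz.
have pz := Cmod_ge_0 z0.
(* Beyond N, |l| > 2 (|z0| + 1), and z stays within distance 1 of z0. *)
have [N HN] := nfloor_ex (2 * (Cmod z0 + 1) / c0)%R ltac:(apply: Rdiv_le_0_compat; lra).
have [d [d0 Hd]] : exists d, (0 < d)%R /\ forall m, (Z.abs m <= Z.of_nat N)%Z ->
   forall n, (Z.abs n <= Z.of_nat N)%Z -> (0 < max_norm m n)%Z ->
   (d <= Cmod (z0 - period w w' m n))%R.
  apply: (uniform_positive (fun m d => forall n, (Z.abs n <= Z.of_nat N)%Z ->
     (0 < max_norm m n)%Z -> (d <= Cmod (z0 - period w w' m n))%R)).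
    move=> m d d' H1 H2 n Hn Hm; apply: Rle_trans H2 _; exact: H1.
  move=> m Hm.
  apply: (uniform_positive (fun n d =>
     (0 < max_norm m n)%Z -> (d <= Cmod (z0 - period w w' m n))%R)).
    move=> n e e' H1 H2 Hn; apply: Rle_trans H2 _; exact: H1.
  move=> n Hn; case: (Z_lt_dec 0 (max_norm m n)) => [p|np]; last by exists 1%R; split=> //; lra.
  exists (Cmod (z0 - period w w' m n)); split; last by move=> _; lra.
  apply/Cmod_gt_0/Cminus_neq_0; exact: Hz.
have N0 := pos_INR N.
(* c0 / 2 serves the far points; the second bound makes c [max_norm] at most d / 2 on the near ones,
   and moving from z0 to z costs another d / 2 of their distance d. *)
set c := Rmin (c0 / 2) (d / 2 / (INR N + 1)).
have q : (0 < d / 2 / (INR N + 1))%R by apply: Rdiv_lt_0_compat; lra.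
have c1 := Rmin_l (c0 / 2) (d / 2 / (INR N + 1)).
have c2 := Rmin_r (c0 / 2) (d / 2 / (INR N + 1)).
have cp : (0 < c)%R by apply: Rmin_pos; lra.
rewrite -/c in c1 c2.
exists c, (Rmin 1 (d / 2)); split=> //; split; first by apply: Rmin_pos; lra.
move=> z Hzd m n Hmn.
have i1 := Rmin_l 1 (d / 2). have i2 := Rmin_r 1 (d / 2).
have mu1 : (1 <= IZR (max_norm m n))%R by apply: IZR_le; lia.
have Hl := H0 m n.
have cl : (c * IZR (max_norm m n) <= c0 / 2 * IZR (max_norm m n))%R.
  by apply: Rmult_le_compat_r => //; lra.
split; last nra.
case: (Z_le_dec (max_norm m n) (Z.of_nat N)) => [le|gt].
  have A : (d <= Cmod (z0 - period w w' m n))%R.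
    apply: Hd => //; move: le; rewrite /max_norm; lia.
  have B : (IZR (max_norm m n) <= INR N + 1)%R.
    rewrite INR_IZR_INZ; have := IZR_le _ _ le; lra.
  have T := Cmod_triangle_rev (z0 - period w w' m n) (z0 - z).
  have e : z0 - period w w' m n - (z0 - z) = z - period w w' m n by ring.
  rewrite e (Cmod_minus_sym z0 z) in T.
  have : (c * IZR (max_norm m n) <= d / 2 / (INR N + 1) * (INR N + 1))%R.
    apply: Rmult_le_compat; lra.
  replace (d / 2 / (INR N + 1) * (INR N + 1))%R with (d / 2)%R by (field; lra).
  lra.
have B : (INR N + 1 <= IZR (max_norm m n))%R.
  rewrite INR_IZR_INZ -plus_IZR; apply: IZR_le; lia.
have T := Cmod_triangle_rev (period w w' m n) z.
rewrite (Cmod_minus_sym _ z) in T.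
have T2 := Cmod_triangle z0 (z - z0).
have e : z0 + (z - z0) = z by ring.
rewrite e in T2.
have : (2 * (Cmod z0 + 1) / c0 * c0 < IZR (max_norm m n) * c0)%R.
  apply: Rmult_lt_compat_r => //; lra.
replace (2 * (Cmod z0 + 1) / c0 * c0)%R with (2 * (Cmod z0 + 1))%R by (field; lra).
nra.
Qed.

Lemma avoids_open (w w' z : C) : nondegenerate w w' -> avoids w w' z ->
  locally (T := C_UniformSpace) z (fun y => avoids w w' y).
Proof.
move=> nd /(lattice_separation _ _ _ nd) [c [d [c0 [d0 H]]]].
apply/C_locally_iff; exists d; split=> // y Hy m n Hmn E.
have [] := H y Hy m n Hmn.
have -> : y - period w w' m n = 0 by rewrite E; ring.
rewrite Cmod_0.
have : (1 <= IZR (max_norm m n))%R by apply: IZR_le; lia.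
nra.
Qed.

Lemma not_lattice_open (w w' z : C) : nondegenerate w w' -> ~ lattice w w' z ->
  locally (T := C_UniformSpace) z (fun y => ~ lattice w w' y).
Proof.
move=> nd H.
have z0 : z <> 0 by move=> E; apply: H; rewrite E; exact: lattice_0.
have L1 := avoids_open _ _ _ nd (not_lattice_avoids _ _ _ H).
have L2 := C_continuous_locally_neq _ _ _ (C_continuous_id z) z0.
apply: filter_imp (filter_and _ _ L1 L2) => y [h1 h2]; exact: avoids_not_lattice.
Qed.

(** The summand inside [sum_lattice'], named so that its partial sums are convertible to a
    [square_sum]. *)
Definition lattice_term (w w' : C) (f : C -> C) (m n : Z) : C :=
  if ((m =? 0)%Z && (n =? 0)%Z)%bool then RtoC 0 else f (period w w' m n).

Lemma lattice_term_neq (w w' : C) (f : C -> C) (m n : Z) :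
  (0 < max_norm m n)%Z -> lattice_term w w' f m n = f (period w w' m n).
Proof.
rewrite /lattice_term /max_norm => H.
by case: Z.eqb_spec => //= ?; case: Z.eqb_spec => //= ?; lia.
Qed.

Lemma lattice_term_0 (w w' : C) (f : C -> C) : lattice_term w w' f 0 0 = 0.
Proof. by []. Qed.

Definition cubic_bound (w w' : C) (f : C -> C) (K : R) : Prop :=
  forall m n, (0 < max_norm m n)%Z ->
    (Cmod (f (period w w' m n)) <= K / IZR (max_norm m n) ^ 3)%R.

Lemma sum_lattice_converges (w w' : C) (f : C -> C) (K : R) :
  cubic_bound w w' f K ->
  C_converges (fun N => square_sum N (lattice_term w w' f)) (sum_lattice' w w' f) /\
  (Cmod (sum_lattice' w w' f) <= 16 * K)%R.
Proof.
move=> H.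
have [l [Hl Hb]] := square_sum_converges (lattice_term w w' f) K
  (fun m n Hmn => eq_ind_r (fun x => Cmod x <= _)%R (H m n Hmn) (lattice_term_neq _ _ _ _ _ Hmn)).
have -> : sum_lattice' w w' f = l by exact: (C_lim_seq_unique _ _ Hl).
split=> //; move: Hb; rewrite lattice_term_0.
by have -> : l - 0 = l by ring.
Qed.

(** The first-order remainder is itself a lattice sum with a cubic bound proportional to |t|^2, so a
    single estimate by 16 K |t|^2 replaces an exchange of limits. The factor [a] carries the -1, -2,
    -3 of the successive derivatives. *)
Lemma sum_lattice_derive (w w' : C) (G H : C -> C -> C) (a z0 : C) (K d : R) :
  (0 < d)%R ->
  (forall t, (Cmod t < d)%R -> cubic_bound w w' (G (z0 + t)) K) ->
  cubic_bound w w' (H z0) K ->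
  (forall t, (Cmod t < d)%R ->
     cubic_bound w w' (fun l => G (z0 + t) l - G z0 l - t * (a * H z0 l)) (K * Cmod t ^ 2)) ->
  is_C_derive (fun z => sum_lattice' w w' (G z)) z0 (a * sum_lattice' w w' (H z0)).
Proof.
move=> d0 HG HH HR; apply/is_C_derive_iff => eps e0.
have [cH bH] := sum_lattice_converges _ _ _ _ HH.
have K0 : (0 <= K)%R by have := Rle_trans _ _ _ (Cmod_ge_0 _) bH; lra.
have q : (0 < eps / (16 * K + 1))%R by apply: Rdiv_lt_0_compat; lra.
exists (Rmin d (eps / (16 * K + 1))); split; first exact: Rmin_pos.
move=> t Ht.
have td := Rlt_le_trans _ _ _ Ht (Rmin_l _ _).
have te := Rlt_le_trans _ _ _ Ht (Rmin_r _ _).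
have [c1 _] := sum_lattice_converges _ _ _ _ (HG t td).
have [c2 _] := sum_lattice_converges _ _ _ _ (HG 0 ltac:(rewrite Cmod_0; lra)).
rewrite Cplus_0_r in c2.
have [c3 b3] := sum_lattice_converges _ _ _ _ (HR t td).
have c4 := C_converges_plus _ _ _ _ (C_converges_plus _ _ _ _ c1 (C_converges_scal (- (1)) _ _ c2))
  (C_converges_scal (- (t * a)) _ _ cH).
set S1 := sum_lattice' w w' (G (z0 + t)) in c4 *.
set S2 := sum_lattice' w w' (G z0) in c4 *.
set S3 := sum_lattice' w w' (H z0) in c4 *.
have E : S1 - S2 - t * (a * S3) =
  sum_lattice' w w' (fun l => G (z0 + t) l - G z0 l - t * (a * H z0 l)).
  have -> : S1 - S2 - t * (a * S3) = S1 + - (1) * S2 + - (t * a) * S3 by ring.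
  apply: C_converges_unique c4 _; apply: C_converges_ext c3 => N.
  rewrite -!square_sum_scal -!square_sum_plus; apply: square_sum_ext => m n.
  rewrite /lattice_term; case: (_ && _)%bool; ring.
rewrite E; apply: Rle_trans b3 _.
have tp := Cmod_ge_0 t.
have : (16 * K * Cmod t <= eps)%R.
  apply: (Rle_trans _ ((16 * K + 1) * (eps / (16 * K + 1)))); first by apply: Rmult_le_compat; lra.
  apply: Req_le; field; lra.
nra.
Qed.

Lemma Cmod_plus_le (x y : C) (a b : R) :
  (Cmod x <= a)%R -> (Cmod y <= b)%R -> (Cmod (x + y) <= a + b)%R.
Proof. have := Cmod_triangle x y; lra. Qed.

Lemma Cmod_minus_le (x y : C) (a b : R) :
  (Cmod x <= a)%R -> (Cmod y <= b)%R -> (Cmod (x - y) <= a + b)%R.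
Proof. have := Cmod_triangle_minus x y; lra. Qed.

Lemma Cmod_mult_le (x y : C) (a b : R) :
  (Cmod x <= a)%R -> (Cmod y <= b)%R -> (Cmod (x * y) <= a * b)%R.
Proof.
by move=> H1 H2; rewrite Cmod_mult; apply: Rmult_le_compat => //; exact: Cmod_ge_0.
Qed.

Lemma Cmod_pow_le (x : C) (a : R) (n : nat) :
  (Cmod x <= a)%R -> (Cmod (x ^ n) <= a ^ n)%R.
Proof.
move=> H; rewrite Cmod_pow; apply: pow_incr; split=> //; exact: Cmod_ge_0.
Qed.

Lemma Cmod_RtoC_le (r : R) : (0 <= r)%R -> (Cmod r <= r)%R.
Proof. by move=> H; rewrite Cmod_R Rabs_pos_eq //; lra. Qed.

Ltac Cmod_estimate :=
  repeat first
    [ assumption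
    | apply: Cmod_minus_le | apply: Cmod_plus_le | apply: Cmod_mult_le
    | apply: Cmod_pow_le | (apply: Cmod_RtoC_le; lra) | apply: Rle_refl ].

Lemma inv_bound (x : C) (c mu : R) :
  (0 < c)%R -> (1 <= mu)%R -> (c * mu <= Cmod x)%R -> x <> 0 /\ (Cmod (/ x) <= / c / mu)%R.
Proof.
move=> c0 m1 H.
have p : (0 < c * mu)%R by apply: Rmult_lt_0_compat; lra.
have n : x <> 0 by move=> E; rewrite E Cmod_0 in H; lra.
split=> //; rewrite Cmod_inv //.
have -> : (/ c / mu = / (c * mu))%R by field; lra.
exact: Rinv_le_contravar.
Qed.

Lemma inv_power_bound (c mu : R) (k : nat) :
  (0 < c)%R -> (1 <= mu)%R -> ((/ c / mu) ^ (3 + k) <= (/ c) ^ (3 + k) / mu ^ 3)%R.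
Proof.
move=> c0 m1.
have c1 : (0 < / c)%R by exact: Rinv_0_lt_compat.
rewrite {1}/Rdiv Rpow_mult_distr; apply: Rmult_le_compat_l.
  apply: pow_le; lra.
rewrite pow_inv; apply: Rinv_le_contravar; first by apply: pow_lt; lra.
apply: Rle_pow => //; lia.
Qed.

(** * Estimates for the terms of the series *)

Definition zeta_term (z l : C) : C := 1 / (z - l) + 1 / l + z / l ^ 2.
Definition wp_term (z l : C) : C := 1 / (z - l) ^ 2 - 1 / l ^ 2.
Definition inv3_term (z l : C) : C := / (z - l) ^ 3.
Definition inv4_term (z l : C) : C := / (z - l) ^ 4.

Lemma zeta_term_bound (z l : C) (q r : R) :
  z - l <> 0 -> l <> 0 -> (Cmod (/ (z - l)) <= q)%R -> (Cmod (/ l) <= q)%R ->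
  (Cmod z <= r)%R -> (Cmod (zeta_term z l) <= r ^ 2 * q ^ 3)%R.
Proof.
move=> n1 n2 H1 H2 H3.
have -> : zeta_term z l = z ^ 2 * (/ (z - l) * (/ l) ^ 2) by rewrite /zeta_term; field.
have -> : (r ^ 2 * q ^ 3 = r ^ 2 * (q * q ^ 2))%R by ring.
Cmod_estimate.
Qed.

Lemma wp_term_bound (z l : C) (q r : R) :
  z - l <> 0 -> l <> 0 -> (Cmod (/ (z - l)) <= q)%R -> (Cmod (/ l) <= q)%R ->
  (Cmod z <= r)%R -> (Cmod (wp_term z l) <= 2 * r * q ^ 3)%R.
Proof.
move=> n1 n2 H1 H2 H3.
have -> : wp_term z l = z * (/ (z - l) * / l * (/ (z - l) - / l)) by rewrite /wp_term; field.
have -> : (2 * r * q ^ 3 = r * (q * q * (q + q)))%R by ring.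
Cmod_estimate.
Qed.

(** Over a common denominator the remainder is an explicit multiple of t^2, so the bound is read off
    an identity; the same holds for the next two lemmas. *)
Lemma zeta_term_remainder (z l t : C) (q : R) :
  z - l <> 0 -> z + t - l <> 0 -> l <> 0 ->
  (Cmod (/ (z - l)) <= q)%R -> (Cmod (/ (z + t - l)) <= q)%R ->
  (Cmod (zeta_term (z + t) l - zeta_term z l - t * (- (1) * wp_term z l)) <= q ^ 3 * Cmod t ^ 2)%R.
Proof.
move=> n1 n2 n3 H1 H2.
have -> : zeta_term (z + t) l - zeta_term z l - t * (- (1) * wp_term z l) =
  / (z - l) ^ 2 * / (z + t - l) * t ^ 2.
  rewrite /zeta_term /wp_term; field; by repeat split.
rewrite -Cpow_inv //.
have -> : (q ^ 3 = q ^ 2 * q)%R by ring.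
Cmod_estimate.
Qed.

Lemma wp_term_remainder (z l t : C) (q : R) :
  z - l <> 0 -> z + t - l <> 0 -> l <> 0 ->
  (Cmod (/ (z - l)) <= q)%R -> (Cmod (/ (z + t - l)) <= q)%R ->
  (Cmod (wp_term (z + t) l - wp_term z l - t * (- (2) * inv3_term z l))
     <= 3 * q ^ 4 * Cmod t ^ 2)%R.
Proof.
move=> n1 n2 n3 H1 H2.
have -> : wp_term (z + t) l - wp_term z l - t * (- (2) * inv3_term z l) =
  ((/ (z - l)) ^ 2 * (/ (z + t - l)) ^ 2 + 2 * ((/ (z - l)) ^ 3 * / (z + t - l))) * t ^ 2.
  rewrite /wp_term /inv3_term; field; by repeat split.
have -> : (3 * q ^ 4 = q ^ 2 * q ^ 2 + 2 * (q ^ 3 * q))%R by ring.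
Cmod_estimate.
Qed.

Lemma inv3_term_remainder (z l t : C) (q : R) :
  z - l <> 0 -> z + t - l <> 0 ->
  (Cmod (/ (z - l)) <= q)%R -> (Cmod (/ (z + t - l)) <= q)%R ->
  (Cmod (inv3_term (z + t) l - inv3_term z l - t * (- (3) * inv4_term z l))
     <= 6 * q ^ 5 * Cmod t ^ 2)%R.
Proof.
move=> n1 n2 H1 H2.
have -> : inv3_term (z + t) l - inv3_term z l - t * (- (3) * inv4_term z l) =
  ((/ (z - l)) ^ 2 * (/ (z + t - l)) ^ 3 + 2 * ((/ (z - l)) ^ 3 * (/ (z + t - l)) ^ 2)
   + 3 * ((/ (z - l)) ^ 4 * / (z + t - l))) * t ^ 2.
  rewrite /inv3_term /inv4_term.
  set u := z - l in n1 *. have -> : z + t - l = u + t by rewrite /u; ring.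
  have n3 : u + t <> 0 by have <- : z + t - l = u + t; [rewrite /u; ring|].
  have -> : t = (u + t) - u by ring. set v := u + t in n3 *.
  have -> : u + (v - u) = v by ring.
  field; by split.
have -> : (6 * q ^ 5 = q ^ 2 * q ^ 3 + 2 * (q ^ 3 * q ^ 2) + 3 * (q ^ 4 * q))%R by ring.
Cmod_estimate.
Qed.

(** Sums over the non-zero lattice points only: the pole at the origin is split off, and these
    series converge at 0 too. *)
Definition zeta_reg (w w' z : C) : C := sum_lattice' w w' (zeta_term z).
Definition wp_reg (w w' z : C) : C := sum_lattice' w w' (wp_term z).
Definition eisenstein3 (w w' z : C) : C := sum_lattice' w w' (inv3_term z).
Definition eisenstein4 (w w' z : C) : C := sum_lattice' w w' (inv4_term z).

Lemma term_bounds (w w' z0 : C) :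
  nondegenerate w w' -> avoids w w' z0 ->
  exists K d : R, (0 < d)%R /\ forall t, (Cmod t < d)%R ->
    cubic_bound w w' (zeta_term (z0 + t)) K /\
    cubic_bound w w' (wp_term (z0 + t)) K /\
    cubic_bound w w' (inv3_term (z0 + t)) K /\
    cubic_bound w w' (inv4_term (z0 + t)) K /\
    cubic_bound w w' (fun l => zeta_term (z0 + t) l - zeta_term z0 l
       - t * (- (1) * wp_term z0 l)) (K * Cmod t ^ 2) /\
    cubic_bound w w' (fun l => wp_term (z0 + t) l - wp_term z0 l
       - t * (- (2) * inv3_term z0 l)) (K * Cmod t ^ 2) /\
    cubic_bound w w' (fun l => inv3_term (z0 + t) l - inv3_term z0 l
       - t * (- (3) * inv4_term z0 l)) (K * Cmod t ^ 2).
Proof.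
move=> nd av.
have [c [d [c0 [d0 H]]]] := lattice_separation _ _ _ nd av.
have pz := Cmod_ge_0 z0.
set r := (Cmod z0 + d)%R.
set b := (/ c)%R.
have b0 : (0 < b)%R by exact: Rinv_0_lt_compat.
have r0 : (0 < r)%R by rewrite /r; lra.
have p2 := pow2_ge_0 r.
have p3 := pow_lt b 3 b0. have p4 := pow_lt b 4 b0. have p5 := pow_lt b 5 b0.
(* The sum of the constants of the individual bounds, so that one K serves all seven estimates. *)
set K := (r ^ 2 * b ^ 3 + 2 * r * b ^ 3 + b ^ 3 + 3 * b ^ 4 + 6 * b ^ 5)%R.
have s1 : (0 <= r ^ 2 * b ^ 3)%R by apply: Rmult_le_pos; lra.
have s2 : (0 <= 2 * r * b ^ 3)%R by apply: Rmult_le_pos; lra.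
have base (m n : Z) (t : C) (Hmn : (0 < max_norm m n)%Z) (Ht : (Cmod t < d)%R) :
  let mu := IZR (max_norm m n) in let l := period w w' m n in let q := (b / mu)%R in
  (1 <= mu)%R /\ l <> 0 /\ z0 - l <> 0 /\ z0 + t - l <> 0 /\
  (Cmod (/ l) <= q)%R /\ (Cmod (/ (z0 - l)) <= q)%R /\ (Cmod (/ (z0 + t - l)) <= q)%R /\
  (Cmod (z0 + t) <= r)%R /\ (q ^ 3 <= b ^ 3 / mu ^ 3)%R /\ (q ^ 4 <= b ^ 4 / mu ^ 3)%R /\
  (q ^ 5 <= b ^ 5 / mu ^ 3)%R.
  move=> mu l q.
  have m1 : (1 <= mu)%R by apply: IZR_le; lia.
  have T1 : (Cmod (z0 + t - z0) < d)%R by have -> : z0 + t - z0 = t by ring.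
  have T0 : (Cmod (z0 - z0) < d)%R.
    have -> : z0 - z0 = 0 by ring. by rewrite Cmod_0.
  have [h1 h2] := H _ T1 m n Hmn.
  have [h3 _] := H _ T0 m n Hmn.
  have [n1 i1] := inv_bound _ _ _ c0 m1 h1.
  have [n2 i2] := inv_bound _ _ _ c0 m1 h2.
  have [n3 i3] := inv_bound _ _ _ c0 m1 h3.
  repeat (split; first done).
  split; first by have := Cmod_triangle z0 t; rewrite /r; lra.
  split; first exact: (inv_power_bound c mu 0 c0 m1).
  split; first exact: (inv_power_bound c mu 1 c0 m1).
  exact: (inv_power_bound c mu 2 c0 m1).
have weak (x a A mu : R) : (1 <= mu)%R -> (0 <= a)%R -> (A <= x / mu ^ 3)%R -> (a * x <= K)%R ->
   (a * A <= K / mu ^ 3)%R.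
  move=> m1 a0 HA HK.
  have p : (0 < / mu ^ 3)%R by apply: Rinv_0_lt_compat; apply: pow_lt; lra.
  apply: (Rle_trans _ (a * (x / mu ^ 3))); first exact: Rmult_le_compat_l.
  have -> : (a * (x / mu ^ 3) = a * x * / mu ^ 3)%R by rewrite /Rdiv; ring.
  apply: Rmult_le_compat_r => //; lra.
have weakt (x a A mu t : R) : (1 <= mu)%R -> (0 <= a)%R -> (A <= x / mu ^ 3)%R -> (a * x <= K)%R ->
   (a * A * t ^ 2 <= K * t ^ 2 / mu ^ 3)%R.
  move=> m1 a0 HA HK.
  have -> : (K * t ^ 2 / mu ^ 3 = K / mu ^ 3 * t ^ 2)%R by rewrite /Rdiv; ring.
  apply: Rmult_le_compat_r; [exact: pow2_ge_0|exact: weak HA HK].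
exists K, d; split=> // t Ht.
(repeat split) => m n Hmn;
  have [m1 [n1 [n2 [n3 [i1 [i2 [i3 [i4 [k3 [k4 k5]]]]]]]]]] := base m n t Hmn Ht.
- apply: Rle_trans (zeta_term_bound _ _ _ _ n3 n1 i3 i1 i4) _.
  apply: weak k3 _ => //; rewrite /K; lra.
- apply: Rle_trans (wp_term_bound _ _ _ _ n3 n1 i3 i1 i4) _.
  apply: weak k3 _ => //; rewrite /K; lra.
- rewrite /inv3_term -Cpow_inv //.
  apply: Rle_trans (Cmod_pow_le _ _ _ i3) _.
  rewrite -(Rmult_1_l (_ ^ 3)); apply: weak k3 _ => //; rewrite /K; lra.
- rewrite /inv4_term -Cpow_inv //.
  apply: Rle_trans (Cmod_pow_le _ _ _ i3) _.
  rewrite -(Rmult_1_l (_ ^ 4)); apply: weak k4 _ => //; rewrite /K; lra.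
- apply: Rle_trans (zeta_term_remainder _ _ _ _ n2 n3 n1 i2 i3) _.
  rewrite -(Rmult_1_l (_ ^ 3)); apply: weakt k3 _ => //; rewrite /K; lra.
- apply: Rle_trans (wp_term_remainder _ _ _ _ n2 n3 n1 i2 i3) _.
  apply: weakt k4 _ => //; rewrite /K; lra.
- apply: Rle_trans (inv3_term_remainder _ _ _ _ n2 n3 i2 i3) _.
  apply: weakt k5 _ => //; rewrite /K; lra.
Qed.

Lemma zeta_reg_derive (w w' z : C) : nondegenerate w w' -> avoids w w' z ->
  is_C_derive (zeta_reg w w') z (- (1) * wp_reg w w' z).
Proof.
move=> nd av; have [K [d [d0 H]]] := term_bounds _ _ _ nd av.
apply: (sum_lattice_derive w w' zeta_term wp_term _ _ K d) => //.
- by move=> t /H [].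
- have := H 0; rewrite Cmod_0 Cplus_0_r => /(_ d0); tauto.
- move=> t /H; tauto.
Qed.

Lemma wp_reg_derive (w w' z : C) : nondegenerate w w' -> avoids w w' z ->
  is_C_derive (wp_reg w w') z (- (2) * eisenstein3 w w' z).
Proof.
move=> nd av; have [K [d [d0 H]]] := term_bounds _ _ _ nd av.
apply: (sum_lattice_derive w w' wp_term inv3_term _ _ K d) => //.
- by move=> t /H [_ []].
- have := H 0; rewrite Cmod_0 Cplus_0_r => /(_ d0); tauto.
- move=> t /H; tauto.
Qed.

Lemma eisenstein3_derive (w w' z : C) : nondegenerate w w' -> avoids w w' z ->
  is_C_derive (eisenstein3 w w') z (- (3) * eisenstein4 w w' z).
Proof.
move=> nd av; have [K [d [d0 H]]] := term_bounds _ _ _ nd av.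
apply: (sum_lattice_derive w w' inv3_term inv4_term _ _ K d) => //.
- by move=> t /H [_ [_ []]].
- have := H 0; rewrite Cmod_0 Cplus_0_r => /(_ d0); tauto.
- move=> t /H; tauto.
Qed.

(** * Parity and periodicity *)

Lemma weierstrass_p_reg (w w' z : C) :
  weierstrass_p w w' z = 1 / z ^ 2 + wp_reg w w' z.
Proof. by []. Qed.

Lemma weierstrass_zeta_reg (w w' z : C) :
  weierstrass_zeta w w' z = 1 / z + zeta_reg w w' z.
Proof. by []. Qed.

(** The first and second derivatives of wp as explicit series, with the pole at 0 written
    separately. *)
Definition wp_d1 (w w' z : C) : C := - (2) / z ^ 3 - 2 * eisenstein3 w w' z.
Definition wp_d2 (w w' z : C) : C := 6 / z ^ 4 + 6 * eisenstein4 w w' z.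

Lemma not_lattice_neq_0 (w w' z : C) : ~ lattice w w' z -> z <> 0.
Proof. by move=> H E; apply: H; rewrite E; exact: lattice_0. Qed.

Lemma is_C_derive_inv_pow2 (z : C) : z <> 0 ->
  is_C_derive (fun y => 1 / y ^ 2) z (- (2) / z ^ 3).
Proof.
move=> n.
have n2 : z ^ 2 <> 0 by exact: Cpow_nz.
apply: is_C_derive_eq (is_C_derive_div _ _ _ _ _ (is_C_derive_const _ _)
  (is_C_derive_pow2 _ _ _ (is_C_derive_id z)) n2) _.
field; exact: n.
Qed.

Lemma is_C_derive_inv_pow3 (z : C) : z <> 0 ->
  is_C_derive (fun y => - (2) / y ^ 3) z (6 / z ^ 4).
Proof.
move=> n.
have n3 : z ^ 3 <> 0 by exact: Cpow_nz.
have D3 : is_C_derive (fun y => y ^ 3) z (3 * z ^ 2).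
  apply: (is_C_derive_ext_loc (fun y => y * y ^ 2)).
    by apply: filter_forall => y /=; ring.
  apply: is_C_derive_eq (is_C_derive_mult _ _ _ _ _ (is_C_derive_id z)
    (is_C_derive_pow2 _ _ _ (is_C_derive_id z))) _.
  have -> : RtoC 3 = 1 + 1 + 1 by rewrite -!RtoC_plus; congr RtoC; ring.
  have -> : RtoC 2 = 1 + 1 by rewrite -!RtoC_plus; congr RtoC; ring.
  ring.
apply: is_C_derive_eq (is_C_derive_div _ _ _ _ _ (is_C_derive_const _ _) D3 n3) _.
field; exact: n.
Qed.

Lemma wp_derive (w w' z : C) : nondegenerate w w' -> ~ lattice w w' z ->
  is_C_derive (weierstrass_p w w') z (wp_d1 w w' z).
Proof.
move=> nd H.
have D := wp_reg_derive _ _ _ nd (not_lattice_avoids _ _ _ H).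
apply: is_C_derive_eq (is_C_derive_plus _ _ _ _ _
  (is_C_derive_inv_pow2 _ (not_lattice_neq_0 _ _ _ H)) D) _.
rewrite /wp_d1; ring.
Qed.

Lemma wp_d1_derive (w w' z : C) : nondegenerate w w' -> ~ lattice w w' z ->
  is_C_derive (wp_d1 w w') z (wp_d2 w w' z).
Proof.
move=> nd H.
have D := eisenstein3_derive _ _ _ nd (not_lattice_avoids _ _ _ H).
apply: is_C_derive_eq (is_C_derive_minus _ _ _ _ _
  (is_C_derive_inv_pow3 _ (not_lattice_neq_0 _ _ _ H))
  (is_C_derive_mult _ _ _ _ _ (is_C_derive_const 2 _) D)) _.
rewrite /wp_d2.
have -> : RtoC 6 = 2 * 3 by rewrite -RtoC_mult; congr RtoC; ring.
ring.
Qed.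

Lemma zeta_derive (w w' z : C) : nondegenerate w w' -> ~ lattice w w' z ->
  is_C_derive (weierstrass_zeta w w') z (- weierstrass_p w w' z).
Proof.
move=> nd H.
have n := not_lattice_neq_0 _ _ _ H.
have D := zeta_reg_derive _ _ _ nd (not_lattice_avoids _ _ _ H).
apply: is_C_derive_eq (is_C_derive_plus _ _ _ _ _
  (is_C_derive_div _ _ _ _ _ (is_C_derive_const 1 _) (is_C_derive_id z) n) D) _.
rewrite weierstrass_p_reg; field; exact: n.
Qed.

Lemma Cdiv_opp_pow2 (x : C) : 1 / (- x) ^ 2 = 1 / x ^ 2.
Proof. by have -> : (- x) ^ 2 = x ^ 2 by ring. Qed.

(** The partial sums agree for every N, by reflecting the square, so evenness holds even at points
    where the series has no meaning. *)
Lemma wp_reg_even (w w' z : C) : wp_reg w w' (- z) = wp_reg w w' z.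
Proof.
rewrite /wp_reg /sum_lattice'; congr C_lim_seq.
apply: FunctionalExtensionality.functional_extensionality => N.
change (square_sum N (lattice_term w w' (wp_term (- z))) =
  square_sum N (lattice_term w w' (wp_term z))).
rewrite -square_sum_reflect.
apply: square_sum_ext => m n.
rewrite /lattice_term.
have -> : ((- m =? 0)%Z = (m =? 0)%Z) by apply/Bool.eq_true_iff_eq; rewrite !Z.eqb_eq; lia.
have -> : ((- n =? 0)%Z = (n =? 0)%Z) by apply/Bool.eq_true_iff_eq; rewrite !Z.eqb_eq; lia.
case: (_ && _)%bool => //.
rewrite period_opp /wp_term.
have -> : - z - - period w w' m n = - (z - period w w' m n) by ring.
by rewrite !Cdiv_opp_pow2.
Qed.

Lemma wp_even (w w' z : C) : weierstrass_p w w' (- z) = weierstrass_p w w' z.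
Proof. by rewrite !weierstrass_p_reg wp_reg_even Cdiv_opp_pow2. Qed.

Lemma zeta_term_cubic (w w' z : C) : nondegenerate w w' -> avoids w w' z ->
  exists K, cubic_bound w w' (zeta_term z) K /\ cubic_bound w w' (wp_term z) K.
Proof.
move=> nd av; have [K [d [d0 H]]] := term_bounds _ _ _ nd av.
exists K; have := H 0; rewrite Cmod_0 Cplus_0_r => /(_ d0); tauto.
Qed.

Lemma avoids_opp (w w' z : C) : avoids w w' z -> avoids w w' (- z).
Proof.
move=> H m n Hmn E; apply: (H (- m)%Z (- n)%Z); first by rewrite /max_norm !Z.abs_opp.
rewrite period_opp -E; ring.
Qed.

Lemma zeta_reg_odd (w w' z : C) : nondegenerate w w' -> avoids w w' z ->
  zeta_reg w w' (- z) = - zeta_reg w w' z.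
Proof.
move=> nd av.
have [K [HK _]] := zeta_term_cubic _ _ _ nd av.
have [K' [HK' _]] := zeta_term_cubic _ _ _ nd (avoids_opp _ _ _ av).
have [c1 _] := sum_lattice_converges _ _ _ _ HK.
have [c2 _] := sum_lattice_converges _ _ _ _ HK'.
have -> : - zeta_reg w w' z = - (1) * zeta_reg w w' z by ring.
apply: C_converges_unique c2 _.
apply: C_converges_ext (C_converges_scal (- (1)) _ _ c1) => N.
rewrite -square_sum_scal -(square_sum_reflect N (lattice_term w w' (zeta_term (- z)))).
apply: square_sum_ext => m n.
case: (Z_lt_dec 0 (max_norm m n)) => [p|/max_norm_0 [-> ->]]; last first.
  rewrite !lattice_term_0; ring.
rewrite !lattice_term_neq //; last by move: p; rewrite /max_norm !Z.abs_opp.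
rewrite period_opp /zeta_term.
set l := period w w' m n.
have n1 : z - l <> 0 by apply: Cminus_neq_0; exact: av.
have n2 : l <> 0.
  move=> E; have : avoids w w' z := av.
  have [c [c0 Hc]] := nd.
  have := Hc m n; rewrite -/l E Cmod_0.
  have : (1 <= IZR (max_norm m n))%R by apply: IZR_le; lia.
  nra.
have -> : - z - - l = - (z - l) by ring.
field; by split.
Qed.

Lemma zeta_odd (w w' z : C) : nondegenerate w w' -> ~ lattice w w' z ->
  weierstrass_zeta w w' (- z) = - weierstrass_zeta w w' z.
Proof.
move=> nd H; rewrite !weierstrass_zeta_reg zeta_reg_odd //; last exact: not_lattice_avoids.
field; exact: (not_lattice_neq_0 _ _ _ H).
Qed.

Lemma wp_d1_odd (w w' z : C) : nondegenerate w w' -> ~ lattice w w' z ->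
  wp_d1 w w' (- z) = - wp_d1 w w' z.
Proof.
move=> nd H.
have D : is_C_derive (fun y => - y) z (- (1)).
  exact: is_C_derive_opp (is_C_derive_id z).
have D1 := is_C_derive_comp (weierstrass_p w w') (fun y => - y) z _ _
  (wp_derive _ _ _ nd (not_lattice_opp _ _ _ H)) D.
have D2 : is_C_derive (weierstrass_p w w') z (- (1) * wp_d1 w w' (- z)).
  apply: is_C_derive_ext_loc D1; apply: filter_forall => y; exact: wp_even.
have := is_C_derive_inj _ _ _ _ D2 (wp_derive _ _ _ nd H).
move=> <-; ring.
Qed.

(** * Translation by periods *)

Lemma square_sum_at_0 (c : C) (N : nat) :
  square_sum N (fun m n => if ((m =? 0)%Z && (n =? 0)%Z)%bool then c else RtoC 0) = c.
Proof.
have aux (f : Z -> C) : (forall k, k <> 0%Z -> f k = 0) -> sum_sym N f = f 0%Z.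
  move=> Hf; elim: N => [|M IH]; first exact: sum_sym_0.
  have -> : sum_sym (S M) f = f 0%Z + 0 + 0; last ring.
  rewrite sum_sym_S IH (Hf (Z.of_nat (S M))); last lia.
  by rewrite (Hf (- Z.of_nat (S M))%Z) //; lia.
rewrite /square_sum aux; first by rewrite aux // => k /Z.eqb_neq /= ->.
move=> k /Z.eqb_neq -> /=; rewrite aux //.
Qed.

(** Puts the polar term l = 0 back into the sum: translation by a period permutes the full lattice,
    not the punctured one. *)
Lemma lattice_sum_converges_at_0 (w w' c : C) (f : C -> C) (K : R) :
  cubic_bound w w' f K ->
  C_converges (fun N => square_sum N (fun m n =>
    if ((m =? 0)%Z && (n =? 0)%Z)%bool then c else f (period w w' m n)))
    (c + sum_lattice' w w' f).
Proof.
move=> H; have [h _] := sum_lattice_converges _ _ _ _ H.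
apply: C_converges_ext (C_converges_plus _ _ _ _ (C_converges_const c) h) => N.
rewrite -{1}(square_sum_at_0 c N) -square_sum_plus.
apply: square_sum_ext => m n; rewrite /lattice_term; case: (_ && _)%bool; ring.
Qed.

Definition unit_step (i j : Z) : Prop := (i = 1%Z /\ j = 0%Z) \/ (i = 0%Z /\ j = 1%Z).

Lemma square_sum_unit_shift (A : Z -> Z -> C) (K : R) (i j : Z) :
  unit_step i j ->
  (forall m n, (0 < max_norm m n)%Z -> Cmod (A m n) <= K / IZR (max_norm m n) ^ 2)%R ->
  C_converges (fun N => square_sum N (fun m n => A (m + i)%Z (n + j)%Z - A m n)) 0.
Proof.
move=> [[-> ->]|[-> ->]] /square_sum_shift [H1 H2].
  apply: C_converges_ext H1 => N; apply: square_sum_ext => m n; by rewrite Z.add_0_r.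
apply: C_converges_ext H2 => N; apply: square_sum_ext => m n; by rewrite Z.add_0_r.
Qed.

Lemma inverse_bound (w w' z : C) : nondegenerate w w' -> avoids w w' z ->
  exists b : R, (0 < b)%R /\ forall m n, (0 < max_norm m n)%Z ->
    (Cmod (/ (z - period w w' m n)) <= b / IZR (max_norm m n))%R.
Proof.
move=> nd av; have [c [d [c0 [d0 H]]]] := lattice_separation _ _ _ nd av.
exists (/ c)%R; split; first exact: Rinv_0_lt_compat.
move=> m n Hmn.
have m1 : (1 <= IZR (max_norm m n))%R by apply: IZR_le; lia.
have T : (Cmod (z - z) < d)%R.
  have -> : z - z = 0 by ring.
  by rewrite Cmod_0.
have [h _] := H z T m n Hmn.
exact: (proj2 (inv_bound _ _ _ c0 m1 h)).
Qed.

(** Passing from z to z - p shifts the indices of 1 / (z - l)^2, while the constants 1 / l^2 are the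
    same on both sides; the telescoping lemma applies to the quadratic terms. *)
Lemma wp_unit_step (w w' z : C) (i j : Z) :
  nondegenerate w w' -> unit_step i j -> ~ lattice w w' z ->
  weierstrass_p w w' (z - period w w' i j) = weierstrass_p w w' z.
Proof.
move=> nd ij Hz.
have Hz' : ~ lattice w w' (z - period w w' i j).
  by apply: not_lattice_plus => //; apply: lattice_opp; exact: lattice_period.
set z' := z - period w w' i j in Hz' *.
have [K [_ HK]] := zeta_term_cubic _ _ _ nd (not_lattice_avoids _ _ _ Hz).
have [K' [_ HK']] := zeta_term_cubic _ _ _ nd (not_lattice_avoids _ _ _ Hz').
have c1 := lattice_sum_converges_at_0 _ _ (1 / z ^ 2) _ _ HK.
have c2 := lattice_sum_converges_at_0 _ _ (1 / z' ^ 2) _ _ HK'.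
have [b [b0 Hb]] := inverse_bound _ _ _ nd (not_lattice_avoids _ _ _ Hz).
have c3 := square_sum_unit_shift (fun m n => (/ (z - period w w' m n)) ^ 2) (b ^ 2) i j ij.
apply: C_converges_unique c2 _.
have -> : weierstrass_p w w' z = 1 / z ^ 2 + sum_lattice' w w' (wp_term z) + 0.
  by rewrite Cplus_0_r.
apply: C_converges_ext (C_converges_plus _ _ _ _ c1 (c3 _)) => [N|m n Hmn].
  rewrite -square_sum_plus; apply: square_sum_ext => m n.
  rewrite period_plus.
  have -> : z - (period w w' m n + period w w' i j) = z' - period w w' m n by rewrite /z'; ring.
  have n1 : z - period w w' m n <> 0.
    by move=> /Cminus_eq_0 E; apply: Hz; exists m, n.
  have n2 : z' - period w w' m n <> 0.
    by move=> /Cminus_eq_0 E; apply: Hz'; exists m, n.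
  rewrite !Cpow_inv //.
  case E : (_ && _)%bool; rewrite /wp_term /Cdiv; last ring.
  have [-> ->] : m = 0%Z /\ n = 0%Z.
    by move/Bool.andb_true_iff: E => [/Z.eqb_eq ? /Z.eqb_eq ?].
  have e (x : C) : x - period w w' 0 0 = x by rewrite period_0; ring.
  rewrite !e; ring.
apply: Rle_trans (Cmod_pow_le _ _ 2 (Hb m n Hmn)) _.
by rewrite /Rdiv Rpow_mult_distr pow_inv; right.
Qed.

(** For one point, 1 / (z - l) decays too slowly for the boundary terms to vanish. The difference
    between two points is (z' - z) / ((z - l) (z' - l)), of quadratic decay; and the change -p / l^2
    of the linear terms is the same at z and z', so it cancels. *)
Lemma zeta_unit_step (w w' z z' : C) (i j : Z) :
  nondegenerate w w' -> unit_step i j -> ~ lattice w w' z -> ~ lattice w w' z' ->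
  weierstrass_zeta w w' (z - period w w' i j) - weierstrass_zeta w w' z =
  weierstrass_zeta w w' (z' - period w w' i j) - weierstrass_zeta w w' z'.
Proof.
move=> nd ij Hz Hz'.
set p := period w w' i j.
have Hs x : ~ lattice w w' x -> ~ lattice w w' (x - p).
  by move=> Hx; apply: not_lattice_plus => //; apply: lattice_opp; exact: lattice_period.
have cv x : ~ lattice w w' x -> C_converges (fun N => square_sum N (fun m n =>
    if ((m =? 0)%Z && (n =? 0)%Z)%bool then 1 / x else zeta_term x (period w w' m n)))
    (weierstrass_zeta w w' x).
  move=> Hx; have [K [HK _]] := zeta_term_cubic _ _ _ nd (not_lattice_avoids _ _ _ Hx).
  exact: lattice_sum_converges_at_0 HK.
have [b [b0 Hb]] := inverse_bound _ _ _ nd (not_lattice_avoids _ _ _ Hz).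
have [b' [b0' Hb']] := inverse_bound _ _ _ nd (not_lattice_avoids _ _ _ Hz').
have c := square_sum_unit_shift
  (fun m n => (z' - z) * (/ (z - period w w' m n) * / (z' - period w w' m n)))
  (Cmod (z' - z) * (b * b')) i j ij.
have c1 := C_converges_plus _ _ _ _ (cv _ (Hs _ Hz)) (C_converges_scal (- (1)) _ _ (cv _ Hz)).
have c2 := C_converges_plus _ _ _ _ (cv _ (Hs _ Hz')) (C_converges_scal (- (1)) _ _ (cv _ Hz')).
have c3 := C_converges_plus _ _ _ _ c1 (C_converges_scal (- (1)) _ _ c2).
apply: Cminus_eq_0.
have E := C_converges_unique _ _ 0 c3.
match type of E with _ -> ?x = _ => transitivity x; [ring|apply: E] end.
apply: C_converges_ext (c _) => [N|m n Hmn].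
  rewrite -!square_sum_scal -!square_sum_plus -!square_sum_scal -!square_sum_plus.
  apply: square_sum_ext => m n.
  rewrite period_plus -/p.
  have n1 x : ~ lattice w w' x -> x - period w w' m n <> 0.
    by move=> Hx /Cminus_eq_0 E; apply: Hx; exists m, n.
  have m1 := n1 _ Hz. have m2 := n1 _ Hz'.
  have m3 := n1 _ (Hs _ Hz). have m4 := n1 _ (Hs _ Hz').
  have e (x l : C) : x - (l + p) = x - p - l by ring.
  rewrite !e.
  have f1 : (z' - z) * (/ (z - period w w' m n) * / (z' - period w w' m n)) =
    / (z - period w w' m n) - / (z' - period w w' m n) by field.
  have f2 : (z' - z) * (/ (z - p - period w w' m n) * / (z' - p - period w w' m n)) =
    / (z - p - period w w' m n) - / (z' - p - period w w' m n) by field.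
  rewrite f1 f2.
  case E : (_ && _)%bool; rewrite /zeta_term /Cdiv; last ring.
  have [-> ->] : m = 0%Z /\ n = 0%Z.
    by move/Bool.andb_true_iff: E => [/Z.eqb_eq ? /Z.eqb_eq ?].
  have e0 (x : C) : x - period w w' 0 0 = x by rewrite period_0; ring.
  rewrite !e0; ring.
rewrite !Cmod_mult.
have -> : (Cmod (z' - z) * (b * b') / IZR (max_norm m n) ^ 2 =
  Cmod (z' - z) * (b / IZR (max_norm m n) * (b' / IZR (max_norm m n))))%R.
  field; apply: not_0_IZR; lia.
apply: Rmult_le_compat_l; first exact: Cmod_ge_0.
apply: Rmult_le_compat; try exact: Cmod_ge_0; [exact: Hb|exact: Hb'].
Qed.

Lemma lattice_induction (w w' : C) (Q : C -> Prop) :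
  Q (period w w' 1 0) -> Q (period w w' 0 1) ->
  (forall p q, lattice w w' p -> lattice w w' q -> Q p -> Q q -> Q (p + q)) ->
  (forall p, lattice w w' p -> Q p -> Q (- p)) ->
  forall p, lattice w w' p -> Q p.
Proof.
move=> H1 H2 Hp Ho p [m [n ->]].
have H0 : Q 0.
  have -> : RtoC 0 = period w w' 1 0 + - period w w' 1 0 by ring.
  apply: Hp => //; [exact: lattice_period|apply: lattice_opp; exact: lattice_period|].
  apply: Ho => //; exact: lattice_period.
have A (i j : Z) : Q (period w w' i j) -> forall k : nat,
    Q (period w w' (Z.of_nat k * i) (Z.of_nat k * j)).
  move=> Hi; elim=> [|k IH]; first by rewrite !Z.mul_0_l period_0.
  have -> : (Z.of_nat (S k) * i = Z.of_nat k * i + i)%Z by lia.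
  have -> : (Z.of_nat (S k) * j = Z.of_nat k * j + j)%Z by lia.
  rewrite period_plus; apply: Hp => //; exact: lattice_period.
have B (i j : Z) : Q (period w w' i j) -> forall k : Z, Q (period w w' (k * i) (k * j)).
  move=> Hi k; case: (Z_le_dec 0 k) => h.
    rewrite -(Z2Nat.id k h); exact: A.
  have -> : (k * i = - (Z.of_nat (Z.to_nat (- k)) * i))%Z by lia.
  have -> : (k * j = - (Z.of_nat (Z.to_nat (- k)) * j))%Z by lia.
  rewrite period_opp; apply: Ho; [exact: lattice_period|exact: A].
(* Writes (m, n) as m (1, 0) + n (0, 1); the last two equations tidy up the occurrences of n that
   the second rewrite also hits. *)
have -> : (m = m * 1 + n * 0)%Z by lia.
have -> : (n = (m * 1 + n * 0) * 0 + n * 1)%Z by lia.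
have -> : ((m * 1 + n * 0) * 0 + n * 1 = m * 0 + n * 1)%Z by lia.
have -> : (m * 1 + (m * 0 + n * 1) * 0 = m * 1 + n * 0)%Z by lia.
rewrite period_plus; apply: Hp; try exact: lattice_period; exact: B.
Qed.

Lemma wp_periodic (w w' z p : C) :
  nondegenerate w w' -> ~ lattice w w' z -> lattice w w' p ->
  weierstrass_p w w' (z + p) = weierstrass_p w w' z.
Proof.
move=> nd Hz Hp; move: p Hp z Hz.
have step i j : unit_step i j -> forall z, ~ lattice w w' z ->
   weierstrass_p w w' (z + period w w' i j) = weierstrass_p w w' z.
  move=> ij z Hz.
  have Hz' := not_lattice_plus _ _ _ _ Hz (lattice_period w w' i j).
  rewrite -(wp_unit_step _ _ _ _ _ nd ij Hz'); f_equal; ring.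
apply: lattice_induction.
- by apply: step; left.
- by apply: step; right.
- move=> p q Lp Lq Hp Hq z Hz; rewrite Cplus_assoc Hq; first exact: Hp.
  exact: not_lattice_plus.
- move=> p Lp Hp z Hz.
  rewrite -(Hp (z + - p)); last by apply: not_lattice_plus => //; exact: lattice_opp.
  f_equal; ring.
Qed.

Lemma zeta_quasi_periodic (w w' z z' p : C) :
  nondegenerate w w' -> ~ lattice w w' z -> ~ lattice w w' z' -> lattice w w' p ->
  weierstrass_zeta w w' (z + p) - weierstrass_zeta w w' z =
  weierstrass_zeta w w' (z' + p) - weierstrass_zeta w w' z'.
Proof.
move=> nd Hz Hz' Hp; move: p Hp z z' Hz Hz'.
have step i j : unit_step i j -> forall z z', ~ lattice w w' z -> ~ lattice w w' z' ->
   weierstrass_zeta w w' (z + period w w' i j) - weierstrass_zeta w w' z =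
   weierstrass_zeta w w' (z' + period w w' i j) - weierstrass_zeta w w' z'.
  move=> ij z z' Hz Hz'.
  have h1 := not_lattice_plus _ _ _ _ Hz (lattice_period w w' i j).
  have h2 := not_lattice_plus _ _ _ _ Hz' (lattice_period w w' i j).
  have := zeta_unit_step _ _ _ _ _ _ nd ij h1 h2.
  have e x : x + period w w' i j - period w w' i j = x by ring.
  rewrite !e => E.
  have -> : weierstrass_zeta w w' (z + period w w' i j) - weierstrass_zeta w w' z =
    - (weierstrass_zeta w w' z - weierstrass_zeta w w' (z + period w w' i j)) by ring.
  rewrite E; ring.
apply: lattice_induction.
- by apply: step; left.
- by apply: step; right.
- move=> p q Lp Lq Hp Hq z z' Hz Hz'.
  have E1 := Hp _ _ Hz Hz'.
  have E2 := Hq _ _ (not_lattice_plus _ _ _ _ Hz Lp) (not_lattice_plus _ _ _ _ Hz' Lp).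
  rewrite !Cplus_assoc.
  set a := weierstrass_zeta w w' (z + p + q) in E2 *.
  set b := weierstrass_zeta w w' (z + p) in E1 E2 *.
  have -> : a - weierstrass_zeta w w' z = (a - b) + (b - weierstrass_zeta w w' z) by ring.
  rewrite E1 E2; ring.
- move=> p Lp Hp z z' Hz Hz'.
  have L := lattice_opp _ _ _ Lp.
  have := Hp _ _ (not_lattice_plus _ _ _ _ Hz L) (not_lattice_plus _ _ _ _ Hz' L).
  have e x : x + - p + p = x by ring.
  rewrite !e => E.
  have -> : weierstrass_zeta w w' (z + - p) - weierstrass_zeta w w' z =
    - (weierstrass_zeta w w' z - weierstrass_zeta w w' (z + - p)) by ring.
  rewrite E; ring.
Qed.

Lemma wp_d1_periodic (w w' z p : C) :
  nondegenerate w w' -> ~ lattice w w' z -> lattice w w' p ->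
  wp_d1 w w' (z + p) = wp_d1 w w' z.
Proof.
move=> nd Hz Hp.
have D : is_C_derive (fun y => y + p) z (RtoC 1).
  apply: is_C_derive_eq (is_C_derive_plus _ _ _ _ _ (is_C_derive_id z) (is_C_derive_const p z)) _.
  ring.
have D1 := is_C_derive_comp (weierstrass_p w w') (fun y => y + p) z _ _
  (wp_derive _ _ _ nd (not_lattice_plus _ _ _ _ Hz Hp)) D.
have D2 : is_C_derive (weierstrass_p w w') z (1 * wp_d1 w w' (z + p)).
  apply: is_C_derive_ext_loc D1.
  apply: filter_imp (not_lattice_open _ _ _ nd Hz) => y Hy; exact: wp_periodic.
rewrite -(is_C_derive_inj _ _ _ _ D2 (wp_derive _ _ _ nd Hz)); ring.
Qed.

(** z and -z are congruent, so the odd function P' takes opposite and equal values at them. *)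
Lemma wp_d1_half_period (w w' z : C) :
  nondegenerate w w' -> ~ lattice w w' z -> lattice w w' (z + z) -> wp_d1 w w' z = 0.
Proof.
move=> nd Hz H.
have E := wp_d1_odd _ _ _ nd Hz.
rewrite -(wp_d1_periodic _ _ _ _ nd (not_lattice_opp _ _ _ Hz) H) in E.
have e : - z + (z + z) = z by ring.
rewrite e in E.
have two : RtoC 2 <> 0 by apply: RtoC_neq; lra.
have -> : wp_d1 w w' z = (wp_d1 w w' z - - wp_d1 w w' z) / 2 by field.
rewrite {1}E; field; exact: two.
Qed.

(** * The addition theorem for zeta *)

Definition cocompact (w w' : C) : Prop :=
  exists r : R, forall z, exists p, lattice w w' p /\ in_square r (z + p).

Lemma periodic_bounded (w w' : C) (f : C -> C) :
  cocompact w w' -> (forall z, continuous f z) ->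
  (forall z p, lattice w w' p -> f (z + p) = f z) ->
  exists M : R, forall z, (Cmod (f z) <= M)%R.
Proof.
move=> [r Hr] Hc Hp.
have [M HM] : exists M : R, forall s, in_square r s -> (Cmod (f s) <= M)%R.
  apply: (bounded_on_square (fun s => Cmod (f s))) => s eps e0.
  have [d [d0 Hd]] := proj1 (C_continuous_iff f s) (Hc s) eps e0.
  exists d; split=> // y Hy; apply: Rle_lt_trans (Hd y Hy).
  apply: Rabs_le; split.
    have := Cmod_triangle_rev (f s) (f y); rewrite Cmod_minus_sym; lra.
  exact: Cmod_triangle_rev.
exists M => z; have [p [Lp Hz]] := Hr z.
rewrite -(Hp z p Lp); exact: HM.
Qed.

Lemma is_C_derive_shift (f : C -> C) (a z l : C) :
  is_C_derive f (a + z) l -> is_C_derive (fun y => f (a + y)) z l.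
Proof.
move=> H.
have D : is_C_derive (fun y => a + y) z (RtoC 1).
  apply: is_C_derive_eq (is_C_derive_plus _ _ _ _ _ (is_C_derive_const a z) (is_C_derive_id z)) _.
  ring.
apply: is_C_derive_eq (is_C_derive_comp f (fun y => a + y) z _ _ H D) _; ring.
Qed.

Lemma is_C_derive_reflect (f : C -> C) (a z l : C) :
  is_C_derive f (a - z) l -> is_C_derive (fun y => f (a - y)) z (- l).
Proof.
move=> H.
have D : is_C_derive (fun y => a - y) z (- (1)).
  apply: is_C_derive_eq (is_C_derive_minus _ _ _ _ _ (is_C_derive_const a z) (is_C_derive_id z)) _.
  ring.
apply: is_C_derive_eq (is_C_derive_comp f (fun y => a - y) z _ _ H D) _; ring.
Qed.

Lemma C_continuous_at_iff (f : C -> C) (z : C) :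
  continuous f z <->
  forall eps : R, (0 < eps)%R -> exists d : R, (0 < d)%R /\
    forall t, (Cmod t < d)%R -> (Cmod (f (z + t)%C - f z) < eps)%R.
Proof.
rewrite C_continuous_iff; split=> H eps e0; have [d [d0 Hd]] := H eps e0;
  exists d; split=> // y Hy.
  apply: Hd; by have -> : z + y - z = y by ring.
have := Hd (y - z) Hy; by have -> : z + (y - z) = y by ring.
Qed.

Lemma nondegenerate_avoids_0 (w w' : C) : nondegenerate w w' -> avoids w w' 0.
Proof.
move=> [c [c0 H]] m n Hmn E; have := H m n; rewrite -E Cmod_0.
have : (1 <= IZR (max_norm m n))%R by apply: IZR_le; lia.
nra.
Qed.

Definition zeta_second_difference (w w' u v : C) : C :=
  weierstrass_zeta w w' (u + v) + weierstrass_zeta w w' (u - v)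
  - 2 * weierstrass_zeta w w' u.

(** To be read as a function of v for fixed u: it is even and doubly periodic, and the aim is to
    show that it vanishes. *)
Definition zeta_addition_defect (w w' u v : C) : C :=
  (weierstrass_p w w' u - weierstrass_p w w' v) * zeta_second_difference w w' u v
  - wp_d1 w w' u.

(** The double pole of P(v) at 0 meets the double zero of the second difference, which is zeta''(u)
    v^2 = -P'(u) v^2 to leading order; the product tends to P'(u). *)
Lemma zeta_addition_defect_near_0 (w w' u : C) :
  nondegenerate w w' -> ~ lattice w w' u ->
  forall eps : R, (0 < eps)%R -> exists d : R, (0 < d)%R /\
    forall t : C, t <> 0 -> (Cmod t < d)%R -> (Cmod (zeta_addition_defect w w' u t) < eps)%R.
Proof.
move=> nd Hu.
set D := wp_d1 w w' u.
pose q t := if Ceq_dec t 0 is left _ then - D else zeta_second_difference w w' u t / t ^ 2.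
have cq : continuous q (RtoC 0).
  apply/C_continuous_at_iff => eps e0.
  have L : locally (T := C_UniformSpace) u (fun y =>
      is_C_derive (weierstrass_zeta w w') y (- weierstrass_p w w' y)).
    apply: filter_imp (not_lattice_open _ _ _ nd Hu) => y; exact: zeta_derive.
  have L2 : is_C_derive (fun y => - weierstrass_p w w' y) u (- D).
    apply: is_C_derive_opp; exact: wp_derive.
  have [d [d0 Hd]] := C_taylor2 _ _ _ _ L L2 (eps / 3)%R ltac:(lra).
  exists d; split=> // t Ht; rewrite Cplus_0_l.
  rewrite /q; case: (Ceq_dec 0 0) => // _; case: Ceq_dec => [_|n].
    have -> : - D - - D = 0 by ring. by rewrite Cmod_0.
  have T1 := Hd t Ht.
  have T2 := Hd (- t) ltac:(by rewrite Cmod_opp).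
  rewrite Cmod_opp in T2.
  have := Cmod_plus_le _ _ _ _ T1 T2.
  match goal with |- (Cmod ?x <= _)%R -> _ => have -> : x =
    (zeta_second_difference w w' u t / t ^ 2 - - D) * t ^ 2 end.
    rewrite /zeta_second_difference /Cminus; field; exact: n.
  rewrite Cmod_mult Cmod_pow => T.
  have p : (0 < Cmod t ^ 2)%R by apply: pow_lt; apply/Cmod_gt_0.
  apply: (Rmult_lt_reg_r (Cmod t ^ 2)) => //; nra.
(* For t <> 0 this is the defect, with 1 / t^2 split off from P(t) so that every factor is
   continuous at 0. *)
pose g t := (weierstrass_p w w' u - wp_reg w w' t) * t ^ 2 * q t - q t - D.
have cg : continuous g (RtoC 0).
  apply: C_continuous_minus; last exact: C_continuous_const.
  apply: C_continuous_minus => //.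
  apply: C_continuous_mult => //.
  apply: C_continuous_mult.
    apply: C_continuous_minus; first exact: C_continuous_const.
    apply: is_C_derive_continuous (wp_reg_derive _ _ _ nd _); exact: nondegenerate_avoids_0.
  exact: is_C_derive_continuous (is_C_derive_pow2 _ _ _ (is_C_derive_id 0)).
have g0 : g 0 = 0.
  have q0 : q 0 = - D by rewrite /q; case: Ceq_dec.
  rewrite /g q0; ring.
move=> eps e0; have [d [d0 Hd]] := proj1 (C_continuous_at_iff g 0) cg eps e0.
exists d; split=> // t n Ht.
have := Hd t Ht; rewrite Cplus_0_l g0.
have -> : g t - 0 = zeta_addition_defect w w' u t; last done.
rewrite /g /q; case: Ceq_dec => [e|_]; first by case: (n e).
rewrite /zeta_addition_defect -/D (weierstrass_p_reg w w' t); field; exact: n.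
Qed.

(** The simple pole of zeta (u - v) at v = u is cancelled by the zero of P(u) - P(v), and the
    product again tends to P'(u). As 2 u is off the lattice, zeta (u + v) is regular there. The
    bound is linear because u becomes the base point of the Liouville argument. *)
Lemma zeta_addition_defect_near_self (w w' u : C) :
  nondegenerate w w' -> ~ lattice w w' u -> ~ lattice w w' (u + u) ->
  exists c d : R, (0 < d)%R /\
    forall t : C, t <> 0 -> (Cmod t < d)%R ->
      (Cmod (zeta_addition_defect w w' u (u + t)) <= c * Cmod t)%R.
Proof.
move=> nd Hu Huu.
set D := wp_d1 w w' u. set D2 := wp_d2 w w' u.
pose P := weierstrass_p w w'.
have L : locally (T := C_UniformSpace) u (fun y => is_C_derive P y (wp_d1 w w' y)).
  apply: filter_imp (not_lattice_open _ _ _ nd Hu) => y; exact: wp_derive.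
have [d1 [d10 H1]] := C_taylor2 _ _ _ _ L (wp_d1_derive _ _ _ nd Hu) 1%R Rlt_0_1.
(* The second difference at v = u + t without the polar part -1 / t of zeta (-t). *)
pose r t := weierstrass_zeta w w' (u + u + t) + zeta_reg w w' (0 - t)
  - 2 * weierstrass_zeta w w' u.
have cr : continuous r (RtoC 0).
  apply: C_continuous_minus; last exact: C_continuous_const.
  apply: C_continuous_plus.
    apply: (is_C_derive_continuous _ _ _ (is_C_derive_shift _ _ _ _ _)).
    apply: zeta_derive => //; by rewrite Cplus_0_r.
  apply: (is_C_derive_continuous _ _ _ (is_C_derive_reflect _ _ _ _ _)).
  apply: zeta_reg_derive => //.
  have -> : 0 - 0 = 0 by ring. exact: nondegenerate_avoids_0.
have [d2 [d20 H2]] := proj1 (C_continuous_at_iff r 0) cr 1%R Rlt_0_1.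
set B := (Cmod (r 0) + 1)%R.
have B0 : (0 < B)%R by rewrite /B; have := Cmod_ge_0 (r 0); lra.
set A := (Cmod (D2 / 2) + 1)%R.
have A0 : (0 < A)%R by rewrite /A; have := Cmod_ge_0 (D2 / 2); lra.
have pD := Cmod_ge_0 D.
exists ((Cmod D + A) * B + A)%R, (Rmin 1 (Rmin d1 d2)); split.
  repeat apply: Rmin_pos => //; lra.
move=> t n Ht.
have pt : (0 < Cmod t)%R by apply/Cmod_gt_0.
have m1 := Rmin_l 1 (Rmin d1 d2). have m2 := Rmin_r 1 (Rmin d1 d2).
have m3 := Rmin_l d1 d2. have m4 := Rmin_r d1 d2.
have T1 := H1 t ltac:(lra).
have T2 := H2 t ltac:(lra).
rewrite Cplus_0_l in T2.
have rt : (Cmod (r t) <= B)%R.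
  have -> : r t = (r t - r 0) + r 0 by ring.
  have := Cmod_triangle (r t - r 0) (r 0); rewrite /B; lra.
set s := (P (u + t) - P u) / t.
have sD : (Cmod (s - D) <= A * Cmod t)%R.
  have e : P (u + t) - P u - t * wp_d1 w w' u = t * (s - D) by rewrite /s /D; field.
  rewrite e in T1.
  have T3 : (Cmod (t ^ 2 * (D2 / 2)) = Cmod (D2 / 2) * Cmod t ^ 2)%R.
    rewrite Cmod_mult Cmod_pow; ring.
  have := Cmod_triangle (t * (s - D) - t ^ 2 * (D2 / 2)) (t ^ 2 * (D2 / 2)).
  have -> : t * (s - D) - t ^ 2 * (D2 / 2) + t ^ 2 * (D2 / 2) = t * (s - D) by ring.
  rewrite T3 Cmod_mult => T4.
  apply: (Rmult_le_reg_l (Cmod t)) => //; rewrite /A; rewrite -/D2 in T1; nra.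
have sb : (Cmod s <= Cmod D + A)%R.
  have -> : s = (s - D) + D by ring.
  have := Cmod_triangle (s - D) D; nra.
have -> : zeta_addition_defect w w' u (u + t) = - (t * (s * r t)) + (s - D).
  rewrite /zeta_addition_defect /zeta_second_difference.
  have -> : u - (u + t) = 0 - t by ring.
  have -> : u + (u + t) = u + u + t by ring.
  rewrite (weierstrass_zeta_reg w w' (0 - t)) /r -/D -/(P u) -/(P (u + t)) /s.
  field; exact: n.
have b1 : (Cmod (s * r t) <= (Cmod D + A) * B)%R by apply: Cmod_mult_le.
have := Cmod_triangle (- (t * (s * r t))) (s - D).
rewrite Cmod_opp Cmod_mult; nra.
Qed.

Definition addition_singular (w w' u v : C) : Prop :=
  lattice w w' v \/ lattice w w' (u + v) \/ lattice w w' (u - v).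

Lemma addition_singular_plus (w w' u v p : C) : lattice w w' p ->
  addition_singular w w' u v -> addition_singular w w' u (v + p).
Proof.
move=> Lp [H|[H|H]]; [left|right; left|right; right].
- exact: lattice_plus.
- rewrite Cplus_assoc; exact: lattice_plus.
- have -> : u - (v + p) = u - v - p by ring. exact: lattice_minus.
Qed.

Lemma addition_singular_opp (w w' u v : C) :
  addition_singular w w' u v -> addition_singular w w' u (- v).
Proof.
move=> [H|[H|H]]; [left|right; right|right; left].
- exact: lattice_opp.
- by have -> : u - - v = u + v by ring.
- exact: H.
Qed.

Lemma addition_regular_open (w w' u v : C) : nondegenerate w w' ->
  ~ addition_singular w w' u v ->
  locally (T := C_UniformSpace) v (fun y => ~ addition_singular w w' u y).
Proof.
move=> nd H.
have H1 : ~ lattice w w' v by move=> h; apply: H; left.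
have H2 : ~ lattice w w' (u + v) by move=> h; apply: H; right; left.
have H3 : ~ lattice w w' (u - v) by move=> h; apply: H; right; right.
have c2 : continuous (fun y => u + y) v.
  apply: C_continuous_plus; [exact: C_continuous_const|exact: C_continuous_id].
have c3 : continuous (fun y => u - y) v.
  apply: C_continuous_minus; [exact: C_continuous_const|exact: C_continuous_id].
have L1 := not_lattice_open _ _ _ nd H1.
have L2 : locally (T := C_UniformSpace) v (fun y => ~ lattice w w' (u + y)).
  exact: (c2 _ (not_lattice_open _ _ _ nd H2)).
have L3 : locally (T := C_UniformSpace) v (fun y => ~ lattice w w' (u - y)).
  exact: (c3 _ (not_lattice_open _ _ _ nd H3)).
apply: filter_imp (filter_and _ _ L1 (filter_and _ _ L2 L3)) => y [h1 [h2 h3]].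
by move=> [|[|]].
Qed.

Lemma zeta_second_difference_derive (w w' u v : C) : nondegenerate w w' ->
  ~ addition_singular w w' u v ->
  is_C_derive (zeta_second_difference w w' u) v
    (weierstrass_p w w' (u - v) - weierstrass_p w w' (u + v)).
Proof.
move=> nd H.
have H2 : ~ lattice w w' (u + v) by move=> h; apply: H; right; left.
have H3 : ~ lattice w w' (u - v) by move=> h; apply: H; right; right.
have D1 := is_C_derive_shift _ _ _ _ (zeta_derive _ _ _ nd H2).
have D2 := is_C_derive_reflect _ _ _ _ (zeta_derive _ _ _ nd H3).
apply: is_C_derive_eq (is_C_derive_minus _ _ _ _ _ (is_C_derive_plus _ _ _ _ _ D1 D2)
  (is_C_derive_const _ _)) _; ring.
Qed.

Lemma zeta_addition_defect_derive2 (w w' u v : C) : nondegenerate w w' ->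
  ~ addition_singular w w' u v ->
  exists (f1 : C -> C) (l : C),
    locally (T := C_UniformSpace) v (fun y =>
      is_C_derive (zeta_addition_defect w w' u) y (f1 y)) /\
    is_C_derive f1 v l.
Proof.
move=> nd H.
pose P := weierstrass_p w w'.
pose f1 y := - wp_d1 w w' y * zeta_second_difference w w' u y
  + (P u - P y) * (P (u - y) - P (u + y)).
exists f1; eexists; split.
  apply: filter_imp (addition_regular_open _ _ _ _ nd H) => y Hy.
  have H1 : ~ lattice w w' y by move=> h; apply: Hy; left.
  have D1 := is_C_derive_minus _ _ _ _ _ (is_C_derive_const (P u) y) (wp_derive _ _ _ nd H1).
  apply: is_C_derive_eq (is_C_derive_minus _ _ _ _ _
    (is_C_derive_mult _ _ _ _ _ D1 (zeta_second_difference_derive _ _ _ _ nd Hy))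
    (is_C_derive_const (wp_d1 w w' u) y)) _.
  rewrite /f1 /P; ring.
have H1 : ~ lattice w w' v by move=> h; apply: H; left.
have H2 : ~ lattice w w' (u + v) by move=> h; apply: H; right; left.
have H3 : ~ lattice w w' (u - v) by move=> h; apply: H; right; right.
apply: is_C_derive_plus; apply: is_C_derive_mult.
- apply: is_C_derive_opp; exact: wp_d1_derive.
- exact: zeta_second_difference_derive.
- apply: is_C_derive_minus; [exact: is_C_derive_const|exact: wp_derive].
- apply: is_C_derive_minus.
    apply: is_C_derive_reflect; exact: wp_derive.
  apply: is_C_derive_shift; exact: wp_derive.
Qed.

(** Moving v by p adds a quasi-period to zeta (u + v) and removes the same one from zeta (u - v). *)
Lemma zeta_addition_defect_periodic (w w' u v p : C) : nondegenerate w w' ->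
  ~ addition_singular w w' u v -> lattice w w' p ->
  zeta_addition_defect w w' u (v + p) = zeta_addition_defect w w' u v.
Proof.
move=> nd H Lp.
have H1 : ~ lattice w w' v by move=> h; apply: H; left.
have H2 : ~ lattice w w' (u + v) by move=> h; apply: H; right; left.
have H3 : ~ lattice w w' (u - v) by move=> h; apply: H; right; right.
rewrite /zeta_addition_defect wp_periodic //; do 2 f_equal.
rewrite /zeta_second_difference.
have H4 := not_lattice_plus _ _ _ _ H3 (lattice_opp _ _ _ Lp).
have := zeta_quasi_periodic _ _ _ _ _ nd H2 H4 Lp.
have -> : u - v + - p + p = u - v by ring.
have -> : u - (v + p) = u - v + - p by ring.
rewrite (Cplus_assoc u v p).
set a := weierstrass_zeta w w' (u + v + p).
set b := weierstrass_zeta w w' (u + v) => E.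
have -> : a = (a - b) + b by ring.
rewrite E; ring.
Qed.

Lemma zeta_addition_defect_even (w w' u v : C) :
  zeta_addition_defect w w' u (- v) = zeta_addition_defect w w' u v.
Proof.
rewrite /zeta_addition_defect wp_even; do 2 f_equal.
rewrite /zeta_second_difference.
have -> : u - - v = u + v by ring.
have -> : u + - v = u - v by ring.
ring.
Qed.

(** The defect, set to 0 at its singular points, is continuous and periodic, hence bounded. A point
    where it is non-zero is not singular, so the differentiability condition of
    [liouville_vanishing] concerns regular points only. *)
Lemma zeta_addition (w w' u v : C) : nondegenerate w w' -> cocompact w w' ->
  ~ lattice w w' u -> ~ lattice w w' (u + u) -> ~ addition_singular w w' u v ->
  (weierstrass_p w w' u - weierstrass_p w w' v) * zeta_second_difference w w' u v
  = wp_d1 w w' u.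
Proof.
move=> nd cc Hu Huu Hv; apply: Cminus_eq_0.
pose f v := if excluded_middle_informative (addition_singular w w' u v) is left _
  then RtoC 0 else zeta_addition_defect w w' u v.
have f_sing x : addition_singular w w' u x -> f x = 0.
  by rewrite /f; case: excluded_middle_informative.
have f_reg x : ~ addition_singular w w' u x -> f x = zeta_addition_defect w w' u x.
  by rewrite /f; case: excluded_middle_informative.
have f_per x p : lattice w w' p -> f (x + p) = f x.
  move=> Lp; case: (classic (addition_singular w w' u x)) => Hx.
    rewrite !f_sing //; exact: addition_singular_plus.
  have Hx' : ~ addition_singular w w' u (x + p).
    move=> h; apply: Hx; have -> : x = x + p + - p by ring.
    apply: addition_singular_plus => //; exact: lattice_opp.
  rewrite !f_reg //; exact: zeta_addition_defect_periodic.
have f_even x : f (- x) = f x.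
  case: (classic (addition_singular w w' u x)) => Hx.
    rewrite !f_sing //; exact: addition_singular_opp.
  have Hx' : ~ addition_singular w w' u (- x).
    by move=> /addition_singular_opp h; apply: Hx; have <- : - - x = x by ring.
  rewrite !f_reg //; exact: zeta_addition_defect_even.
have sing_0 : addition_singular w w' u 0 by left; exact: lattice_0.
have sing_u : addition_singular w w' u u.
  right; right; have -> : u - u = 0 by ring. exact: lattice_0.
have c_0 : continuous f (RtoC 0).
  apply/C_continuous_at_iff => eps e0.
  have [d [d0 Hd]] := zeta_addition_defect_near_0 _ _ _ nd Hu eps e0.
  exists d; split=> // t Ht; rewrite Cplus_0_l (f_sing 0) //.
  have -> : f t - 0 = f t by ring.
  rewrite /f; case: excluded_middle_informative => [_|h]; first by rewrite Cmod_0.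
  apply: Hd => // E; apply: h; by rewrite E.
have [c [d [d0 Hself]]] := zeta_addition_defect_near_self _ _ _ nd Hu Huu.
have near_u (t : C) : (Cmod t < d)%R -> (Cmod (f (u + t)%C) <= Rabs c * Cmod t)%R.
  move=> Ht; have p := Rmult_le_pos _ _ (Rabs_pos c) (Cmod_ge_0 t).
  rewrite /f; case: excluded_middle_informative => [_|h]; first by rewrite Cmod_0.
  apply: Rle_trans (Hself t _ Ht) _.
    by move=> E; apply: h; rewrite E Cplus_0_r.
  apply: Rmult_le_compat_r; [exact: Cmod_ge_0|exact: Rle_abs].
have c_u : continuous f u.
  apply/C_continuous_at_iff => eps e0.
  have ca := Rabs_pos c.
  have q : (0 < eps / (Rabs c + 1))%R by apply: Rdiv_lt_0_compat; lra.
  exists (Rmin d (eps / (Rabs c + 1))); split; first exact: Rmin_pos.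
  move=> t Ht; rewrite (f_sing u) //.
  have -> : f (u + t) - 0 = f (u + t) by ring.
  apply: Rle_lt_trans (near_u t (Rlt_le_trans _ _ _ Ht (Rmin_l _ _))) _.
  have t2 := Rlt_le_trans _ _ _ Ht (Rmin_r _ _).
  have p := Cmod_ge_0 t.
  have : ((Rabs c + 1) * Cmod t < (Rabs c + 1) * (eps / (Rabs c + 1)))%R.
    apply: Rmult_lt_compat_l; lra.
  replace ((Rabs c + 1) * (eps / (Rabs c + 1)))%R with eps by (field; lra).
  lra.
have c_shift (x p : C) : lattice w w' p -> continuous f x -> continuous f (x + p).
  move=> Lp Hx.
  apply: (C_continuous_ext_loc (fun y => f (y - p))).
    apply: filter_forall => y; rewrite -(f_per (y - p) p Lp); f_equal; ring.
  apply: (C_continuous_comp (fun y => y - p) f).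
    apply: C_continuous_minus; [exact: C_continuous_id|exact: C_continuous_const].
  by have -> : x + p - p = x by ring.
have c_opp (x : C) : continuous f x -> continuous f (- x).
  move=> Hx.
  apply: (C_continuous_ext_loc (fun y => f (- y))).
    apply: filter_forall => y; exact: f_even.
  apply: (C_continuous_comp (fun y => - y) f).
    apply: C_continuous_opp; exact: C_continuous_id.
  by have -> : - - x = x by ring.
(* Every singular point is congruent to 0, u or -u, so periodicity and evenness carry continuity
   over from 0 and u. *)
have cf (x : C) : continuous f x.
  case: (classic (addition_singular w w' u x)) => [[H|[H|H]]|H].
  - have -> : x = 0 + x by ring. exact: c_shift.
  - have -> : x = - u + (u + x) by ring. apply: c_shift => //; exact: c_opp.
  - have -> : x = u + - (u - x) by ring. apply: c_shift => //; exact: lattice_opp.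
  have [f1 [l [L _]]] := zeta_addition_defect_derive2 _ _ _ _ nd H.
  apply: (C_continuous_ext_loc (zeta_addition_defect w w' u)).
    apply: filter_imp (addition_regular_open _ _ _ _ nd H) => y Hy; by rewrite f_reg.
  exact: is_C_derive_continuous (locally_singleton _ _ L).
have [M HM] := periodic_bounded _ _ _ cc cf f_per.
rewrite -/(zeta_addition_defect w w' u v) -f_reg //.
have M0 : (0 <= M)%R by apply: Rle_trans (HM 0); exact: Cmod_ge_0.
(* |c| bounds the slope at distance less than d from u; farther away M <= (M / d) |t|. *)
apply: (liouville_vanishing f u M (Rabs c + M / d) cf HM) => [t|x Hx].
  have pt := Cmod_ge_0 t.
  have q : (0 <= M / d)%R by apply: Rdiv_le_0_compat.
  have ca := Rabs_pos c.
  case: (Rlt_dec (Cmod t) d) => Ht; first by have := near_u t Ht; nra.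
  apply: Rle_trans (HM _) _.
  have : (M / d * d <= M / d * Cmod t)%R by apply: Rmult_le_compat_l; lra.
  replace (M / d * d)%R with M by (field; lra).
  nra.
have Hr : ~ addition_singular w w' u x by move=> /f_sing.
have [f1 [l [L1 L2]]] := zeta_addition_defect_derive2 _ _ _ _ nd Hr.
exists f1, l; split=> //.
have L3 := locally_locally _ _ (addition_regular_open _ _ _ _ nd Hr).
apply: filter_imp (filter_and _ _ L1 L3) => y [h1 h2].
apply: is_C_derive_ext_loc h1.
apply: filter_imp h2 => y' Hy'; by rewrite f_reg.
Qed.

(** Differentiation in u leaves a term P'(u) times the second difference of zeta; one more factor
    P(u) - P(v) lets [zeta_addition] turn it into P'(u)^2. *)
Lemma wp_addition_sum (w w' u v : C) : nondegenerate w w' -> cocompact w w' ->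
  ~ lattice w w' u -> ~ lattice w w' (u + u) -> ~ addition_singular w w' u v ->
  let P := weierstrass_p w w' in
  (P u - P v) ^ 2 * (2 * P u - P (u + v) - P (u - v)) =
  wp_d2 w w' u * (P u - P v) - wp_d1 w w' u ^ 2.
Proof.
move=> nd cc Hu Huu Hv P.
have H1 : ~ lattice w w' v by move=> h; apply: Hv; left.
have H2 : ~ lattice w w' (v + u).
  by move=> h; apply: Hv; right; left; rewrite Cplus_comm.
have H3 : ~ lattice w w' (- v + u).
  by move=> h; apply: Hv; right; right; have -> : u - v = - v + u by ring.
have L : locally (T := C_UniformSpace) u (fun y =>
   (P y - P v) * (weierstrass_zeta w w' (v + y) + weierstrass_zeta w w' (- v + y)
      - 2 * weierstrass_zeta w w' y) = wp_d1 w w' y).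
  have c2 (a : C) : continuous (fun y => a + y) u.
    apply: C_continuous_plus; [exact: C_continuous_const|exact: C_continuous_id].
  have cuu : continuous (fun y => y + y) u by apply: C_continuous_plus; exact: C_continuous_id.
  have L1 := not_lattice_open _ _ _ nd Hu.
  have L2 : locally (T := C_UniformSpace) u (fun y => ~ lattice w w' (v + y)).
    exact: (c2 v _ (not_lattice_open _ _ _ nd H2)).
  have L3 : locally (T := C_UniformSpace) u (fun y => ~ lattice w w' (- v + y)).
    exact: (c2 (- v) _ (not_lattice_open _ _ _ nd H3)).
  have L4 : locally (T := C_UniformSpace) u (fun y => ~ lattice w w' (y + y)).
    exact: (cuu _ (not_lattice_open _ _ _ nd Huu)).
  apply: filter_imp (filter_and _ _ (filter_and _ _ L1 L2) (filter_and _ _ L3 L4)) =>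
    y [[h1 h2] [h3 h4]].
  have Hs : ~ addition_singular w w' y v.
    move=> [//|[h|h]]; [apply: h2|apply: h3]; first by rewrite Cplus_comm.
    by have -> : - v + y = y - v by ring.
  rewrite -(zeta_addition _ _ _ _ nd cc h1 h4 Hs) /zeta_second_difference.
  have -> : v + y = y + v by ring. by have -> : - v + y = y - v by ring.
have D1 := is_C_derive_minus _ _ _ _ _ (wp_derive _ _ _ nd Hu) (is_C_derive_const (P v) u).
have D2 := is_C_derive_shift _ _ _ _ (zeta_derive _ _ _ nd H2).
have D3 := is_C_derive_shift _ _ _ _ (zeta_derive _ _ _ nd H3).
have D4 := is_C_derive_mult _ _ _ _ _ (is_C_derive_const 2 u) (zeta_derive _ _ _ nd Hu).
have D5 := is_C_derive_mult _ _ _ _ _ D1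
  (is_C_derive_minus _ _ _ _ _ (is_C_derive_plus _ _ _ _ _ D2 D3) D4).
have D6 := is_C_derive_ext_loc _ _ _ _ L D5.
have E := is_C_derive_inj _ _ _ _ D6 (wp_d1_derive _ _ _ nd Hu).
have E0 := locally_singleton _ _ L.
have -> : u + v = v + u by ring.
have -> : u - v = - v + u by ring.
have -> : wp_d1 w w' u ^ 2 = wp_d1 w w' u * wp_d1 w w' u by ring.
rewrite -{2}E0 -E /P; ring.
Qed.

(** * Rectangular lattices and the Liouville transformation *)

Lemma Re_period_rectangular (w h : R) (m n : Z) :
  Re (period w (Ci * h) m n) = (2 * IZR m * w)%R.
Proof. rewrite /period /Re /=; ring. Qed.

Lemma Im_period_rectangular (w h : R) (m n : Z) :
  Im (period w (Ci * h) m n) = (2 * IZR n * h)%R.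
Proof. rewrite /period /Im /=; ring. Qed.

Lemma rectangular_nondegenerate (w h : R) : (0 < w)%R -> (0 < h)%R ->
  nondegenerate w (Ci * h).
Proof.
move=> w0 h0; exists (Rmin (2 * w) (2 * h)); split; first by apply: Rmin_pos; lra.
move=> m n.
have c1 := Rmin_l (2 * w) (2 * h). have c2 := Rmin_r (2 * w) (2 * h).
have c0 : (0 < Rmin (2 * w) (2 * h))%R by apply: Rmin_pos; lra.
have a1 := re_le_Cmod (period w (Ci * h) m n).
have a2 := im_le_Cmod (period w (Ci * h) m n).
rewrite Re_period_rectangular in a1; rewrite Im_period_rectangular in a2.
rewrite /max_norm; case: (Z.max_spec (Z.abs m) (Z.abs n)) => -[_ ->]; rewrite abs_IZR.
  move: a2; have -> : (2 * IZR n * h = 2 * h * IZR n)%R by ring.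
  rewrite Rabs_mult (Rabs_pos_eq (2 * h)); last lra.
  have := Rabs_pos (IZR n); nra.
move: a1; have -> : (2 * IZR m * w = 2 * w * IZR m)%R by ring.
rewrite Rabs_mult (Rabs_pos_eq (2 * w)); last lra.
have := Rabs_pos (IZR m); nra.
Qed.

Lemma reduce_modulo (p x : R) : (0 < p)%R ->
  exists m : Z, (- p <= x + IZR m * p <= p)%R.
Proof.
move=> p0; exists (- up (x / p))%Z.
have [u1 u2] := archimed (x / p).
have e : x = (x / p * p)%R by field; lra.
rewrite opp_IZR; move: u1 u2 e; set q := (x / p)%R; set u := IZR (up q).
move=> u1 u2 e; have := Rmult_lt_compat_r _ _ _ p0 u1.
have : ((u - q) * p <= 1 * p)%R by apply: Rmult_le_compat_r; lra.
lra.
Qed.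

Lemma rectangular_cocompact (w h : R) : (0 < w)%R -> (0 < h)%R -> cocompact w (Ci * h).
Proof.
move=> w0 h0; exists (2 * w + 2 * h)%R => z.
have [m Hm] := reduce_modulo (2 * w) (Re z) ltac:(lra).
have [n Hn] := reduce_modulo (2 * h) (Im z) ltac:(lra).
exists (period w (Ci * h) m n); split; first exact: lattice_period.
have e1 : Re (z + period w (Ci * h) m n) = (Re z + IZR m * (2 * w))%R.
  rewrite Re_plus Re_period_rectangular; ring.
have e2 : Im (z + period w (Ci * h) m n) = (Im z + IZR n * (2 * h))%R.
  have -> : Im (z + period w (Ci * h) m n) = (Im z + Im (period w (Ci * h) m n))%R by [].
  rewrite Im_period_rectangular; ring.
rewrite /in_square e1 e2; lra.
Qed.

Lemma half_odd_integer (m : Z) (x : R) : (0 < x)%R -> x <> (2 * IZR m * x)%R.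
Proof.
move=> x0 E.
have : IZR 1 = IZR (2 * m).
  rewrite mult_IZR; apply: (Rmult_eq_reg_r x); lra.
move=> /eq_IZR; lia.
Qed.

Lemma rectangular_half_periods (w h : R) : (0 < w)%R -> (0 < h)%R ->
  ~ lattice w (Ci * h) w /\ ~ lattice w (Ci * h) (Ci * h) /\
  ~ lattice w (Ci * h) (w - Ci * h).
Proof.
move=> w0 h0; split; last split; move=> [m [n E]].
- have := f_equal Re E; rewrite Re_period_rectangular; exact: half_odd_integer.
- have := f_equal Im E; rewrite Im_period_rectangular.
  have -> : Im (Ci * h) = h by rewrite /Im /=; ring.
  exact: half_odd_integer.
- have := f_equal Re E; rewrite Re_period_rectangular.
  have -> : Re (w - Ci * h) = w by rewrite /Re /=; ring.
  exact: half_odd_integer.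
Qed.

(* The term L' - L^2 is half the Schwarzian derivative of a. *)
Lemma solves_change_of_variables (V W : C -> Prop) (a b s L L1 q Q : C -> C) :
  biholomorphic V W a b ->
  (forall x, V x -> s x <> 0 /\ is_C_derive a x (s x ^ 2) /\
     is_C_derive s x (L x * s x) /\ is_C_derive L x (L1 x) /\
     Q (a x) * s x ^ 4 = L1 x - L x ^ 2 + q x) ->
  forall Psi, solves V q Psi <-> solves W Q (fun z => s (b z) * Psi (b z)).
Proof.
move=> [oV [oW [HV HW]]] H Psi.
(* Chain rule on a (b z) = z, which holds near z because W is open. *)
have db z : W z -> is_C_derive b z (/ s (b z) ^ 2).
  move=> Wz; have [Vb [ab [l0 Hl0]]] := HW z Wz.
  have [l Hl] : exists l : C, is_C_derive b z l by exists l0.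
  have [s0 [Da _]] := H _ Vb.
  have D1 := is_C_derive_comp a b z _ _ Da Hl.
  have D2 : is_C_derive (fun y => y) z (l * s (b z) ^ 2).
    apply: is_C_derive_ext_loc D1; apply: filter_imp (oW z Wz) => y Wy.
    by have [_ []] := HW y Wy.
  have E := is_C_derive_inj _ _ _ _ D2 (is_C_derive_id z).
  apply: is_C_derive_eq Hl _.
  have s2 : s (b z) ^ 2 <> 0 by exact: Cpow_nz.
  have -> : l = l * s (b z) ^ 2 * / s (b z) ^ 2 by field.
  rewrite E; field; exact: s0.
split.
- move=> [Psi1 HP].
  (* The derivative of s Psi in x is s (L Psi + Psi'), and b' = 1 / s^2. The witness of the converse
     solves this relation for Psi'. *)
  exists (fun z => (L (b z) * Psi (b z) + Psi1 (b z)) / s (b z)) => z Wz.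
  have [Vb _] := HW z Wz.
  have [s0 [_ [Ds [DL E]]]] := H _ Vb.
  have [DP DP1] := HP _ Vb.
  have Db := db z Wz.
  split.
    apply: is_C_derive_eq (is_C_derive_mult _ _ _ _ _
      (is_C_derive_comp s b z _ _ Ds Db) (is_C_derive_comp Psi b z _ _ DP Db)) _.
    field; exact: s0.
  have D1 := is_C_derive_plus _ _ _ _ _ (is_C_derive_mult _ _ _ _ _ DL DP) DP1.
  have D2 := is_C_derive_div _ _ _ _ _ D1 Ds s0.
  apply: is_C_derive_eq (is_C_derive_comp (fun x => (L x * Psi x + Psi1 x) / s x) b z _ _ D2 Db) _.
  have [_ [ab _]] := HW z Wz.
  rewrite ab in E.
  have -> : Q z = (L1 (b z) - L (b z) ^ 2 + q (b z)) / s (b z) ^ 4 by rewrite -E; field; exact: s0.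
  cbv beta; field; exact: s0.
- move=> [Xi1 HX].
  exists (fun x => s x * Xi1 (a x) - L x * Psi x) => x Vx.
  have [Wa [ba _]] := HV x Vx.
  have [s0 [Da [Ds [DL E]]]] := H x Vx.
  have [DX DX1] := HX _ Wa.
  (* Differentiability of Psi has to be recovered here: on V, Psi is the quotient by s of Xi
     composed with a. *)
  have DP : is_C_derive Psi x (s x * Xi1 (a x) - L x * Psi x).
    have D1 := is_C_derive_comp (fun z => s (b z) * Psi (b z)) a x _ _ DX Da.
    have D2 := is_C_derive_div _ _ _ _ _ D1 Ds s0.
    have D3 : is_C_derive Psi x ((s x ^ 2 * Xi1 (a x) * s x -
        s (b (a x)) * Psi (b (a x)) * (L x * s x)) / s x ^ 2).
      apply: is_C_derive_ext_loc D2; apply: filter_imp (oV x Vx) => y Vy.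
      have [_ [-> _]] := HV y Vy.
      have [sy _] := H y Vy; field; exact: sy.
    apply: is_C_derive_eq D3 _; rewrite ba; field; exact: s0.
  split=> //.
  apply: is_C_derive_eq (is_C_derive_minus _ _ _ _ _
    (is_C_derive_mult _ _ _ _ _ Ds (is_C_derive_comp Xi1 a x _ _ DX1 Da))
    (is_C_derive_mult _ _ _ _ _ DL DP)) _.
  rewrite ba.
  have -> : q x = Q (a x) * s x ^ 4 - L1 x + L x ^ 2 by rewrite E; ring.
  ring.
Qed.

(** * Singularities of the equation on the torus *)

Lemma holomorphic_at_const (c a : C) : holomorphic_at (fun _ => c) a.
Proof. by apply: filter_forall => y; exists (RtoC 0); exact: is_C_derive_const. Qed.

Lemma holomorphic_at_id (a : C) : holomorphic_at (fun y => y) a.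
Proof. by apply: filter_forall => y; exists (RtoC 1); exact: is_C_derive_id. Qed.

Lemma holomorphic_at_plus (f g : C -> C) (a : C) :
  holomorphic_at f a -> holomorphic_at g a -> holomorphic_at (fun y => f y + g y) a.
Proof.
move=> Hf Hg; apply: filter_imp (filter_and _ _ Hf Hg) => y [[l Hl] [m Hm]].
by exists (Cplus l m); exact: is_C_derive_plus.
Qed.

Lemma holomorphic_at_minus (f g : C -> C) (a : C) :
  holomorphic_at f a -> holomorphic_at g a -> holomorphic_at (fun y => f y - g y) a.
Proof.
move=> Hf Hg; apply: filter_imp (filter_and _ _ Hf Hg) => y [[l Hl] [m Hm]].
by exists (Cminus l m); exact: is_C_derive_minus.
Qed.

Lemma holomorphic_at_mult (f g : C -> C) (a : C) :
  holomorphic_at f a -> holomorphic_at g a -> holomorphic_at (fun y => f y * g y) a.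
Proof.
move=> Hf Hg; apply: filter_imp (filter_and _ _ Hf Hg) => y [[l Hl] [m Hm]].
by exists (Cplus (Cmult l (g y)) (Cmult (f y) m)); exact: is_C_derive_mult.
Qed.

Lemma holomorphic_at_ext (f g : C -> C) (a : C) :
  (forall y, f y = g y) -> holomorphic_at f a -> holomorphic_at g a.
Proof.
move=> E Hf; apply: filter_imp Hf => y [l Hl]; exists l.
by apply: is_C_derive_ext_loc Hl; apply: filter_forall.
Qed.

Lemma holomorphic_at_shift (f : C -> C) (b a : C) :
  holomorphic_at f (a - b) -> holomorphic_at (fun y => f (y - b)) a.
Proof.
move=> Hf.
have c : continuous (fun y => y - b) a.
  apply: C_continuous_minus; [exact: C_continuous_id|exact: C_continuous_const].
have L : locally (T := C_UniformSpace) a (fun y => ex_C_derive f (y - b)) by exact: (c _ Hf).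
apply: filter_imp L => y [l Hl]; exists l.
have e (x : C) : x - b = - b + x by ring.
rewrite e in Hl.
apply: (is_C_derive_ext_loc (fun y => f (- b + y))).
  by apply: filter_forall => x; rewrite e.
exact: is_C_derive_shift.
Qed.

Lemma holomorphic_at_ex_derive (f : C -> C) (a : C) :
  holomorphic_at f a -> ex_C_derive f a.
Proof. exact: locally_singleton. Qed.

Lemma holomorphic_at_continuous (f : C -> C) (a : C) :
  holomorphic_at f a -> continuous f a.
Proof. by move=> /holomorphic_at_ex_derive [l]; exact: is_C_derive_continuous. Qed.

Lemma wp_holomorphic (w w' z : C) : nondegenerate w w' -> ~ lattice w w' z ->
  holomorphic_at (weierstrass_p w w') z.
Proof.
move=> nd H; apply: filter_imp (not_lattice_open _ _ _ nd H) => y Hy.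
by exists (wp_d1 w w' y); exact: wp_derive.
Qed.

Lemma zeta_holomorphic (w w' z : C) : nondegenerate w w' -> ~ lattice w w' z ->
  holomorphic_at (weierstrass_zeta w w') z.
Proof.
move=> nd H; apply: filter_imp (not_lattice_open _ _ _ nd H) => y Hy.
by exists (Copp (weierstrass_p w w' y)); exact: zeta_derive.
Qed.

Lemma wp_reg_holomorphic (w w' : C) : nondegenerate w w' -> holomorphic_at (wp_reg w w') 0.
Proof.
move=> nd; apply: filter_imp (avoids_open _ _ _ nd (nondegenerate_avoids_0 _ _ nd)) => y Hy.
by exists (Cmult (- (2)) (eisenstein3 w w' y)); exact: wp_reg_derive.
Qed.

Lemma zeta_reg_holomorphic (w w' : C) :
  nondegenerate w w' -> holomorphic_at (zeta_reg w w') 0.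
Proof.
move=> nd; apply: filter_imp (avoids_open _ _ _ nd (nondegenerate_avoids_0 _ _ nd)) => y Hy.
by exists (Cmult (- (1)) (wp_reg w w' y)); exact: zeta_reg_derive.
Qed.

(** (y - a)^2 Q y extends holomorphically with the value c2 at a; were Q itself removable, that
    value would be 0. *)
Lemma regular_singular_double_pole (Q g : C -> C) (a c2 c1 : C) :
  c2 <> 0 -> holomorphic_at g a ->
  (forall y, Q y = c2 / (y - a) ^ 2 + c1 / (y - a) + g y) ->
  regular_singular Q a.
Proof.
move=> n2 Hg HQ.
pose k y := c2 + c1 * (y - a) + (y - a) * (y - a) * g y.
have hk : holomorphic_at k a.
  have hy : holomorphic_at (fun y => y - a) a.
    apply: holomorphic_at_minus; [exact: holomorphic_at_id|exact: holomorphic_at_const].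
  apply: holomorphic_at_plus; last by do 2 apply: holomorphic_at_mult => //.
  apply: holomorphic_at_plus; first exact: holomorphic_at_const.
  apply: holomorphic_at_mult => //; exact: holomorphic_at_const.
have ek y : y <> a -> (y - a) ^ 2 * Q y = k y.
  move=> n; rewrite HQ /k; field; exact: Cminus_neq_0.
split; last first.
  exists k; split=> //; apply/C_locally'_iff; exists 1%R; split; first lra.
  by move=> y n _; rewrite ek.
move=> [f [hf /C_locally'_iff [d [d0 Hf]]]]; apply: n2.
pose F y := k y - (y - a) * (y - a) * f y.
have cF : continuous F a.
  have cy : continuous (fun y => y - a) a.
    apply: C_continuous_minus; [exact: C_continuous_id|exact: C_continuous_const].
  apply: C_continuous_minus; first exact: holomorphic_at_continuous.
  apply: C_continuous_mult; first exact: C_continuous_mult.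
  exact: holomorphic_at_continuous.
have -> : c2 = F a by rewrite /F /k; ring.
apply: C_limit_unique cF _ => e e0.
set r := (Rmin e d / 2)%R.
have m0 : (0 < Rmin e d)%R by exact: Rmin_pos.
have m1 := Rmin_l e d. have m2 := Rmin_r e d.
exists (a + r).
have er : a + r - a = r by ring.
have mr : Cmod (a + r - a) = r by rewrite er Cmod_R Rabs_pos_eq // /r; lra.
split; first by rewrite mr /r; lra.
have n : a + r <> a.
  move=> E; have z0 : a - a = 0 by ring.
  by move: mr; rewrite E z0 Cmod_0 /r; lra.
rewrite /F -ek // Hf //; last by rewrite mr /r; lra.
ring.
Qed.

(** The shape of [torus_coeff] with its seven functions as arguments, so that at each singular point
    the polar ones can be replaced by their regular parts. *)
Definition torus_combination (k : C) (p0 p1 p2 p3 p4 z3 z4 : C -> C) (y : C) : C :=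
  - (1 / 4) * (p0 y + p1 y + p2 y) - (3 / 16) * (p3 y + p4 y)
  + (9 / 64) * root4 8 * Ci * (z3 y - z4 y) + k.

Lemma torus_combination_holomorphic (k a : C) (p0 p1 p2 p3 p4 z3 z4 : C -> C) :
  holomorphic_at p0 a -> holomorphic_at p1 a -> holomorphic_at p2 a ->
  holomorphic_at p3 a -> holomorphic_at p4 a ->
  holomorphic_at z3 a -> holomorphic_at z4 a ->
  holomorphic_at (torus_combination k p0 p1 p2 p3 p4 z3 z4) a.
Proof.
move=> *; have hc := holomorphic_at_const.
apply: holomorphic_at_plus => //; apply: holomorphic_at_plus.
  apply: holomorphic_at_minus; apply: holomorphic_at_mult => //.
    by do 2 apply: holomorphic_at_plus => //.
  exact: holomorphic_at_plus.
apply: holomorphic_at_mult => //; exact: holomorphic_at_minus.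
Qed.

Lemma RtoC_fraction_neq_0 (p q : R) : p <> 0%R -> q <> 0%R -> - (p / q) <> 0.
Proof.
move=> Hp Hq; rewrite -RtoC_div // -RtoC_opp; apply: RtoC_neq => E.
apply: Hp; have -> : p = (- - (p / q) * q)%R by field.
by rewrite E; ring.
Qed.

Definition torus_singular (w w' kappa z : C) : Prop :=
  exists a, In a [RtoC 0; w; w'; kappa; - kappa] /\ lattice w w' (z - a).

Lemma torus_nonsingular (w w' kappa z : C) : ~ torus_singular w w' kappa z ->
  ~ lattice w w' z /\ ~ lattice w w' (z - w) /\ ~ lattice w w' (z - w') /\
  ~ lattice w w' (z - kappa) /\ ~ lattice w w' (z + kappa).
Proof.
move=> H; (repeat split) => h; apply: H.
- exists 0; split; [left|]; first done. by have -> : z - 0 = z by ring.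
- exists w; split=> //=; tauto.
- exists w'; split=> //=; tauto.
- exists kappa; split=> //=; tauto.
- exists (- kappa); split=> /=; first tauto. by have -> : z - - kappa = z + kappa by ring.
Qed.

Lemma holomorphic_at_translate (kappa : C) (f : C -> C) (a : C) :
  holomorphic_at f (a + kappa) -> holomorphic_at (fun y => f (y + kappa)) a.
Proof.
have e (x : C) : x + kappa = x - - kappa by ring.
rewrite e => H.
apply: (holomorphic_at_ext (fun y => f (y - - kappa))); first by move=> y; rewrite e.
exact: holomorphic_at_shift.
Qed.

Lemma torus_coeff_holomorphic (w w' kappa z : C) : nondegenerate w w' ->
  ~ lattice w w' z -> ~ lattice w w' (z - w) -> ~ lattice w w' (z - w') ->
  ~ lattice w w' (z - kappa) -> ~ lattice w w' (z + kappa) ->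
  holomorphic_at (torus_coeff w w' kappa) z.
Proof.
move=> nd h0 h1 h2 h3 h4.
apply: torus_combination_holomorphic;
  first [exact: wp_holomorphic
        |apply: holomorphic_at_shift; first [exact: wp_holomorphic|exact: zeta_holomorphic]
        |apply: holomorphic_at_translate; first [exact: wp_holomorphic|exact: zeta_holomorphic]].
Qed.

Lemma torus_coeff_periodic (w w' kappa z p : C) : nondegenerate w w' -> lattice w w' p ->
  ~ lattice w w' z -> ~ lattice w w' (z - w) -> ~ lattice w w' (z - w') ->
  ~ lattice w w' (z - kappa) -> ~ lattice w w' (z + kappa) ->
  torus_coeff w w' kappa (z + p) = torus_coeff w w' kappa z.
Proof.
move=> nd Lp h0 h1 h2 h3 h4; rewrite /torus_coeff.
have e (b : C) : z + p - b = z - b + p by ring.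
have e' : z + p + kappa = z + kappa + p by ring.
have per x : ~ lattice w w' x -> weierstrass_p w w' (x + p) = weierstrass_p w w' x.
  by move=> h; exact: wp_periodic.
rewrite !e e' !per //.
have := zeta_quasi_periodic _ _ _ _ _ nd h3 h4 Lp => E.
have -> : weierstrass_zeta w w' (z - kappa + p) - weierstrass_zeta w w' (z + kappa + p) =
  weierstrass_zeta w w' (z - kappa) - weierstrass_zeta w w' (z + kappa).
  set x := weierstrass_zeta w w' (z - kappa + p) in E *.
  set y := weierstrass_zeta w w' (z - kappa) in E *.
  have -> : x = (x - y) + y by ring.
  rewrite E; ring.
done.
Qed.

(** By pairwise incongruence only the terms centred at a given point of the list are singular there.
    The zeta terms contribute simple poles, and the double pole has coefficient -1/4 or -3/16. *)
Lemma torus_coeff_fuchsian (w w' kappa : C) : nondegenerate w w' ->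
  ForallOrdPairs (fun a b => ~ lattice w w' (a - b)) [RtoC 0; w; w'; kappa; - kappa] ->
  fuchsian_on_torus w w' (torus_coeff w w' kappa) [RtoC 0; w; w'; kappa; - kappa].
Proof.
move=> nd HD.
have HD' := HD.
inversion_clear HD' as [|? ? F0 HD0]. inversion_clear HD0 as [|? ? F1 HD1].
inversion_clear HD1 as [|? ? F2 HD2]. inversion_clear HD2 as [|? ? F3 _].
rewrite !Forall_cons_iff in F0 F1 F2 F3.
move: F0 F1 F2 F3 => [w0 [w'0 [k0 [mk0 _]]]] [ww' [wk [wmk _]]] [w'k [w'mk _]] [kmk _].
have sym (x y : C) : ~ lattice w w' (x - y) -> ~ lattice w w' (y - x).
  by move=> h /lattice_opp h'; apply: h; have -> : x - y = - (y - x) by ring.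
have plus (x y : C) : ~ lattice w w' (x - - y) -> ~ lattice w w' (x + y).
  by have -> : x - - y = x + y by ring.
have s0 := sym _ _ w0. have s1 := sym _ _ w'0. have s2 := sym _ _ k0. have s3 := sym _ _ mk0.
have s4 := sym _ _ ww'. have s5 := sym _ _ wk. have s6 := sym _ _ wmk.
have s7 := sym _ _ w'k. have s8 := sym _ _ w'mk. have s9 := sym _ _ kmk.
have unit (x : C) : ~ lattice w w' (x - 0) -> ~ lattice w w' x.
  by have -> : x - 0 = x by ring.
have p0 := plus _ _ mk0. have p1 := plus _ _ wmk. have p2 := plus _ _ w'mk.
have p3 := plus _ _ kmk.
have u0 := unit _ s0. have u1 := unit _ s1. have u2 := unit _ s2. have u3 := unit _ s3.
have n14 : - (1 / 4) <> 0 by apply: RtoC_fraction_neq_0; lra.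
have n316 : - (3 / 16) <> 0 by apply: RtoC_fraction_neq_0; lra.
pose P := weierstrass_p w w'. pose Z := weierstrass_zeta w w'.
pose PR := wp_reg w w'. pose ZR := zeta_reg w w'.
pose k := (9 / 32) * (root4 8 * Ci * Z kappa + 2 * sqrt 2 + 2).
pose T := torus_combination k.
have hP := wp_holomorphic w w'. have hZ := zeta_holomorphic w w'.
have hPR (a : C) : holomorphic_at (fun y => PR (y - a)) a.
  apply: holomorphic_at_shift; have -> : a - a = 0 by ring. exact: wp_reg_holomorphic.
have hZR (a : C) : holomorphic_at (fun y => ZR (y - a)) a.
  apply: holomorphic_at_shift; have -> : a - a = 0 by ring. exact: zeta_reg_holomorphic.
split.
  move=> z m n Hz; have [h0 [h1 [h2 [h3 h4]]]] := torus_nonsingular _ _ _ _ Hz.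
  apply: torus_coeff_periodic => //; exact: lattice_period.
split.
  move=> z Hz; have [h0 [h1 [h2 [h3 h4]]]] := torus_nonsingular _ _ _ _ Hz.
  exact: torus_coeff_holomorphic.
split; last exact: HD.
have hol (f : C -> C) (b a : C) : (forall z, ~ lattice w w' z -> holomorphic_at f z) ->
   ~ lattice w w' (a - b) -> holomorphic_at (fun y => f (y - b)) a.
  by move=> hf h; apply: holomorphic_at_shift; exact: hf.
have hol' (f : C -> C) (b a : C) : (forall z, ~ lattice w w' z -> holomorphic_at f z) ->
   ~ lattice w w' (a + b) -> holomorphic_at (fun y => f (y + b)) a.
  by move=> hf h; apply: holomorphic_at_translate; exact: hf.
have hP' z : ~ lattice w w' z -> holomorphic_at P z by exact: hP.
have hZ' z : ~ lattice w w' z -> holomorphic_at Z z by exact: hZ.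
move=> a; rewrite /=; move=> [<-|[<-|[<-|[<-|[<-|[]]]]]].
- apply: (regular_singular_double_pole _
    (T (fun y => PR (y - 0)) (fun y => P (y - w)) (fun y => P (y - w')) (fun y => P (y - kappa))
       (fun y => P (y + kappa)) (fun y => Z (y - kappa)) (fun y => Z (y + kappa))) _ _ 0 n14).
    by apply: torus_combination_holomorphic; auto.
  move=> y; rewrite /torus_coeff (weierstrass_p_reg w w' y) /T /torus_combination -/P -/Z -/PR.
  have -> : y - 0 = y by ring.
  rewrite /k /Cdiv; ring.
- apply: (regular_singular_double_pole _
    (T P (fun y => PR (y - w)) (fun y => P (y - w')) (fun y => P (y - kappa))
       (fun y => P (y + kappa)) (fun y => Z (y - kappa)) (fun y => Z (y + kappa))) _ _ 0 n14).
    by apply: torus_combination_holomorphic; auto.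
  move=> y; rewrite /torus_coeff (weierstrass_p_reg w w' (y - w)) /T /torus_combination -/P -/Z -/PR.
  rewrite /k /Cdiv; ring.
- apply: (regular_singular_double_pole _
    (T P (fun y => P (y - w)) (fun y => PR (y - w')) (fun y => P (y - kappa))
       (fun y => P (y + kappa)) (fun y => Z (y - kappa)) (fun y => Z (y + kappa))) _ _ 0 n14).
    by apply: torus_combination_holomorphic; auto.
  move=> y; rewrite /torus_coeff (weierstrass_p_reg w w' (y - w')) /T /torus_combination -/P -/Z -/PR.
  rewrite /k /Cdiv; ring.
- apply: (regular_singular_double_pole _
    (T P (fun y => P (y - w)) (fun y => P (y - w')) (fun y => PR (y - kappa))
       (fun y => P (y + kappa)) (fun y => ZR (y - kappa)) (fun y => Z (y + kappa))) _ _
    (9 / 64 * root4 8 * Ci) n316).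
    by apply: torus_combination_holomorphic; auto.
  move=> y; rewrite /torus_coeff (weierstrass_p_reg w w' (y - kappa))
    (weierstrass_zeta_reg w w' (y - kappa)) /T /torus_combination -/P -/Z -/PR -/ZR.
  rewrite /k /Cdiv; ring.
- apply: (regular_singular_double_pole _
    (T P (fun y => P (y - w)) (fun y => P (y - w')) (fun y => P (y - kappa))
       (fun y => PR (y - - kappa)) (fun y => Z (y - kappa)) (fun y => ZR (y - - kappa))) _ _
    (- (9 / 64 * root4 8 * Ci)) n316).
    by apply: torus_combination_holomorphic; auto.
  move=> y; rewrite /torus_coeff (weierstrass_p_reg w w' (y + kappa))
    (weierstrass_zeta_reg w w' (y + kappa)) /T /torus_combination -/P -/Z -/PR -/ZR.
  have -> : y - - kappa = y + kappa by ring.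
  rewrite /k /Cdiv; ring.
Qed.

(** * The coefficient as a rational function of wp *)

Lemma Cmult_cancel_l (c x y : C) : c <> 0 -> c * x = c * y -> x = y.
Proof.
move=> n E; have -> : x = / c * (c * x) by field.
rewrite E; field; exact: n.
Qed.

Lemma wp_eq_mod_lattice (w w' z b : C) : nondegenerate w w' ->
  ~ lattice w w' b -> lattice w w' (z - b) -> weierstrass_p w w' z = weierstrass_p w w' b.
Proof.
move=> nd Hb H; have -> : z = b + (z - b) by ring.
exact: wp_periodic.
Qed.

(** The differentiated equation has the factor 2 P'(z), which is cancelled; hence the condition
    P'(z) <> 0. *)
Lemma wp_d2_of_ode (w w' e1 e2 e3 z : C) : nondegenerate w w' ->
  let P := weierstrass_p w w' in
  (forall y, ~ lattice w w' y -> wp_d1 w w' y ^ 2 = 4 * (P y - e1) * (P y - e2) * (P y - e3)) ->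
  ~ lattice w w' z -> wp_d1 w w' z <> 0 ->
  wp_d2 w w' z = 2 * ((P z - e2) * (P z - e3) + (P z - e1) * (P z - e3) + (P z - e1) * (P z - e2)).
Proof.
move=> nd P ode Hz n.
have Pe e := is_C_derive_minus _ _ _ _ _ (wp_derive _ _ _ nd Hz) (is_C_derive_const e z).
have D1 := is_C_derive_mult _ _ _ _ _ (is_C_derive_mult _ _ _ _ _
  (is_C_derive_mult _ _ _ _ _ (is_C_derive_const 4 z) (Pe e1)) (Pe e2)) (Pe e3).
have D2 := is_C_derive_pow2 _ _ _ (wp_d1_derive _ _ _ nd Hz).
have L : locally (T := C_UniformSpace) z (fun y =>
    wp_d1 w w' y ^ 2 = 4 * (P y - e1) * (P y - e2) * (P y - e3)).
  exact: filter_imp (not_lattice_open _ _ _ nd Hz).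
have D3 := is_C_derive_ext_loc _ _ _ _ L D2.
have E := is_C_derive_inj _ _ _ _ D3 D1.
have n2 : 2 * wp_d1 w w' z <> 0 by apply: Cmult_neq_0 => //; apply: RtoC_neq; lra.
apply: (Cmult_cancel_l _ _ _ n2).
have -> : 2 * wp_d1 w w' z * wp_d2 w w' z = 2 * wp_d2 w w' z * wp_d1 w w' z by ring.
rewrite E /P; ring.
Qed.

Lemma square_factors_neq_0 (d x y z : C) :
  d ^ 2 = 4 * x * y * z -> d <> 0 -> x <> 0 /\ y <> 0 /\ z <> 0.
Proof.
move=> E n; have n2 : d ^ 2 <> 0 by exact: Cpow_nz.
by split; last split; move=> e; apply: n2; rewrite E e; ring.
Qed.

(** Since b and -b are congruent, both shifted terms of [wp_addition_sum] equal P(z - b). The result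
    is the classical e1 + (e1 - e2) (e1 - e3) / (P(z) - e1), written in the differences P(z) - ei,
    which factor after the substitution. *)
Lemma wp_half_period_shift (w w' e1 e2 e3 b z : C) : nondegenerate w w' -> cocompact w w' ->
  let P := weierstrass_p w w' in
  (forall y, ~ lattice w w' y -> wp_d1 w w' y ^ 2 = 4 * (P y - e1) * (P y - e2) * (P y - e3)) ->
  ~ lattice w w' b -> lattice w w' (b + b) -> P b = e1 ->
  ~ lattice w w' z -> wp_d1 w w' z <> 0 ->
  P (z - b) = P z - (P z - e2) - (P z - e3) + (P z - e2) * (P z - e3) / (P z - e1).
Proof.
move=> nd cc P ode Hb Hbb Eb Hz n.
have Hzz : ~ lattice w w' (z + z) by move=> h; apply: n; exact: wp_d1_half_period.
have [n1 _] := square_factors_neq_0 _ _ _ _ (ode z Hz) n.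
have Hm : ~ lattice w w' (z - b).
  by move=> h; apply: n1; rewrite -Eb /P (wp_eq_mod_lattice _ _ _ _ nd Hb h); ring.
have Hp : P (z + b) = P (z - b).
  have -> : z + b = (z - b) + (b + b) by ring.
  exact: wp_periodic.
have Hs : ~ addition_singular w w' z b.
  move=> [//|[h|//]]; apply: Hm.
  have -> : z - b = z + b - (b + b) by ring.
  exact: lattice_minus.
have E := wp_addition_sum _ _ _ _ nd cc Hz Hzz Hs; cbv zeta in E.
rewrite -/P Hp Eb (wp_d2_of_ode _ _ _ _ _ _ nd ode Hz n) (ode z Hz) -/P in E.
have n2 : (P z - e1) ^ 2 * 2 <> 0.
  by apply: Cmult_neq_0; [exact: Cpow_nz|apply: RtoC_neq; lra].
apply: (Cmult_cancel_l _ _ _ n2).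
have -> : (P z - e1) ^ 2 * 2 * P (z - b) =
  (P z - e1) ^ 2 * 2 * P z - (P z - e1) ^ 2 * (2 * P z - P (z - b) - P (z - b)) by ring.
rewrite E; field; exact: n1.
Qed.

(** [wp_addition_sum] is used at (z, kappa), but [zeta_addition] at (kappa, z): exchanging the roles
    brings in the constant P'(kappa) instead of P'(z), so the outcome is rational in P(z). *)
Lemma torus_coeff_value (w w' kappa e1 e2 e3 z : C) : nondegenerate w w' -> cocompact w w' ->
  let P := weierstrass_p w w' in
  (forall y, ~ lattice w w' y -> wp_d1 w w' y ^ 2 = 4 * (P y - e1) * (P y - e2) * (P y - e3)) ->
  ~ lattice w w' w -> ~ lattice w w' w' -> ~ lattice w w' kappa ->
  P w = e1 -> P w' = e2 -> wp_d1 w w' kappa <> 0 ->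
  ~ lattice w w' z -> wp_d1 w w' z <> 0 -> P z - P kappa <> 0 ->
  let a1 := P z - e1 in let a2 := P z - e2 in let a3 := P z - e3 in
  let N := / (P z - P kappa) in
  torus_coeff w w' kappa z =
  - (1 / 4) * (P z + (P z - a2 - a3 + a2 * a3 / a1) + (P z - a1 - a3 + a1 * a3 / a2))
  - 3 / 16 * (2 * P z - 2 * (a2 * a3 + a1 * a3 + a1 * a2) * N + 4 * a1 * a2 * a3 * N ^ 2)
  + 9 / 64 * (root4 8 * Ci * wp_d1 w w' kappa) * N + 9 / 32 * (2 * sqrt 2 + 2).
Proof.
move=> nd cc P ode Hw Hw' Hk Ew Ew' nk Hz n nK a1 a2 a3 N.
have Lw : lattice w w' (w + w) by exists 1%Z, 0%Z; rewrite /period; ring.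
have Lw' : lattice w w' (w' + w') by exists 0%Z, 1%Z; rewrite /period; ring.
have S1 := wp_half_period_shift _ _ _ _ _ _ _ nd cc ode Hw Lw Ew Hz n.
have ode' y : ~ lattice w w' y -> wp_d1 w w' y ^ 2 = 4 * (P y - e2) * (P y - e1) * (P y - e3).
  by move=> Hy; rewrite ode //; ring.
have S2 := wp_half_period_shift _ _ _ _ _ _ _ nd cc ode' Hw' Lw' Ew' Hz n.
have Hzz : ~ lattice w w' (z + z) by move=> h; apply: n; exact: wp_d1_half_period.
have Hkk : ~ lattice w w' (kappa + kappa) by move=> h; apply: nk; exact: wp_d1_half_period.
have Hm : ~ lattice w w' (z - kappa).
  by move=> h; apply: nK; rewrite /P (wp_eq_mod_lattice _ _ _ _ nd Hk h); ring.
have Hp : ~ lattice w w' (z + kappa).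
  move=> h; apply: nK.
  have h' : lattice w w' (z - - kappa) by have -> : z - - kappa = z + kappa by ring.
  rewrite /P (wp_eq_mod_lattice _ _ _ _ nd (not_lattice_opp _ _ _ Hk) h') wp_even; ring.
have Hs : ~ addition_singular w w' z kappa by move=> [|[|]].
have Hm' : ~ lattice w w' (kappa - z).
  by move=> /lattice_opp h; apply: Hm; have -> : z - kappa = - (kappa - z) by ring.
have Hs' : ~ addition_singular w w' kappa z.
  by move=> [|[|]] //; rewrite Cplus_comm.
have A := wp_addition_sum _ _ _ _ nd cc Hz Hzz Hs; cbv zeta in A.
have B := zeta_addition _ _ _ _ nd cc Hk Hkk Hs'.
have A' : P (z - kappa) + P (z + kappa) =
  2 * P z - 2 * (a2 * a3 + a1 * a3 + a1 * a2) * N + 4 * a1 * a2 * a3 * N ^ 2.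
  rewrite (wp_d2_of_ode _ _ _ _ _ _ nd ode Hz n) (ode z Hz) -/P -/a1 -/a2 -/a3 in A.
  have -> : P (z - kappa) + P (z + kappa) =
    2 * P z - N ^ 2 * ((P z - P kappa) ^ 2 * (2 * P z - P (z + kappa) - P (z - kappa))).
    rewrite /N; field; exact: nK.
  rewrite A /N; field; exact: nK.
have B' : weierstrass_zeta w w' (z - kappa) - weierstrass_zeta w w' (z + kappa) =
   wp_d1 w w' kappa * N - 2 * weierstrass_zeta w w' kappa.
  rewrite -B /zeta_second_difference.
  have -> : kappa - z = - (z - kappa) by ring.
  rewrite zeta_odd // (Cplus_comm kappa z) /N /P; field; exact: nK.
rewrite /torus_coeff -/P.
rewrite -A' -/a1 -/a2 -/a3.
rewrite -/P in S1 S2; rewrite S1 S2 -/a1 -/a2 -/a3.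
have -> : (9 / 64) * root4 8 * Ci * (weierstrass_zeta w w' (z - kappa) - weierstrass_zeta w w' (z + kappa))
  = (9 / 64) * (root4 8 * Ci * (wp_d1 w w' kappa * N - 2 * weierstrass_zeta w w' kappa)).
  rewrite B'; ring.
rewrite /Cdiv; set q := weierstrass_zeta w w' kappa.
have [m1 [m2 _]] := square_factors_neq_0 _ _ _ _ (ode z Hz) n.
field; by split.
Qed.

Lemma is_C_derive_monomial (n : nat) (z : C) :
  is_C_derive (fun y => y ^ S n) z (RtoC (INR (S n)) * z ^ n).
Proof.
elim: n => [|n IH].
  apply: is_C_derive_eq (is_C_derive_mult _ _ _ _ _ (is_C_derive_id z)
    (is_C_derive_const 1 z)) _.
  by rewrite /=; ring.
apply: is_C_derive_eq (is_C_derive_mult _ _ _ _ _ (is_C_derive_id z) IH) _.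
rewrite (S_INR (S n)) RtoC_plus /=; ring.
Qed.

Lemma C_continuous_pow (n : nat) (f : C -> C) (z : C) :
  continuous f z -> continuous (fun y => f y ^ n) z.
Proof.
move=> H; elim: n => [|n IH]; first exact: C_continuous_const.
exact: C_continuous_mult.
Qed.

Lemma C_continuous_div (f g : C -> C) (z : C) :
  continuous f z -> continuous g z -> g z <> 0 -> continuous (fun y => f y / g y) z.
Proof. by move=> Hf Hg n; apply: C_continuous_mult => //; exact: C_continuous_inv. Qed.

Ltac C_continuity :=
  repeat first
    [ exact: C_continuous_const | exact: C_continuous_id | assumption
    | apply: C_continuous_minus | apply: C_continuous_plus | apply: C_continuous_opp
    | apply: C_continuous_div | apply: C_continuous_mult | apply: C_continuous_pow ].

(** Carries an identity proved off the single point r over to r itself, through the nearby points r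
    + h with h > 0. *)
Lemma continuous_zero_extension (F : C -> C) (V : C -> Prop) (x r : C) :
  open (T := C_UniformSpace) V -> V x -> continuous F x ->
  (forall y, V y -> y <> r -> F y = 0) -> F x = 0.
Proof.
move=> oV Vx cF H.
case: (Ceq_dec x r) => [E|]; last exact: H.
have [d [d0 Hd]] := proj1 (C_locally_iff _ _) (oV x Vx).
apply: C_limit_unique cF _ => e e0.
set h := (Rmin e d / 2)%R.
have m0 : (0 < Rmin e d)%R by exact: Rmin_pos.
have m1 := Rmin_l e d. have m2 := Rmin_r e d.
exists (x + h).
have er : x + h - x = h by ring.
have mr : Cmod (x + h - x) = h by rewrite er Cmod_R Rabs_pos_eq // /h; lra.
split; first by rewrite mr /h; lra.
apply: H; first by apply: Hd; rewrite mr /h; lra.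
rewrite -E => E'; have z0 : x - x = 0 by ring.
by move: mr; rewrite E' z0 Cmod_0 /h; lra.
Qed.

(* exp(- i pi/4): since sqrt 2 = r - r^3 and i = - r^2, all the identities below
   can be checked modulo the single relation r^4 = -1. *)
Definition root8 : C := (1 - Ci) / sqrt 2.

Lemma sqrt2_neq_0 : RtoC (sqrt 2) <> 0.
Proof. apply: RtoC_neq; have := sqrt_lt_R0 2; lra. Qed.

Lemma sqrt2_square : RtoC (sqrt 2) ^ 2 = 2.
Proof.
have -> : RtoC (sqrt 2) ^ 2 = RtoC (sqrt 2 * sqrt 2) by rewrite RtoC_mult; ring.
by rewrite sqrt_sqrt //; lra.
Qed.

Lemma Ci_square : Ci ^ 2 = - (1).
Proof. rewrite /Ci /Cpow /Cmult /Copp /RtoC /=; congr pair; ring. Qed.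

Lemma Ci_root8 : Ci = - root8 ^ 2.
Proof.
have n := sqrt2_neq_0. have h := sqrt2_square. have hi := Ci_square.
rewrite /root8; field [h hi]; exact: n.
Qed.

Lemma root8_pow4 : root8 ^ 4 = - (1).
Proof.
have -> : root8 ^ 4 = (- root8 ^ 2) ^ 2 by ring.
rewrite -Ci_root8; exact: Ci_square.
Qed.

Lemma sqrt2_root8 : RtoC (sqrt 2) = root8 - root8 ^ 3.
Proof.
have -> : root8 - root8 ^ 3 = root8 * (1 + - root8 ^ 2) by ring.
have n := sqrt2_neq_0. have h := sqrt2_square. have hi := Ci_square.
rewrite -Ci_root8 /root8; field [h hi]; exact: n.
Qed.

(** As 8 * 32 = 4^4, the fourth root in the zeta coefficient combines with the one in P'(kappa), and
    only sqrt 2 remains. *)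
Lemma root4_8_32 : RtoC (root4 8) * RtoC (root4 32) = 4.
Proof.
rewrite -RtoC_mult /root4; congr RtoC.
rewrite -sqrt_mult_alt; last exact: sqrt_pos.
rewrite -sqrt_mult_alt; last lra.
have -> : (8 * 32 = 16 * 16)%R by ring.
rewrite sqrt_square; last lra.
have -> : (16 = 4 * 4)%R by ring.
rewrite sqrt_square; lra.
Qed.

(** * Rational identities modulo r^4 = -1 *)

Lemma quintic_factors (r x : C) : r ^ 4 = - (1) ->
  x ^ 5 - x = x * ((x + r ^ 2) * (x + 1)) * ((x - 1) * (x - r ^ 2)).
Proof. by move=> H; ring [H]. Qed.

(** X1, X2 and S stand for P(alpha - w), P(alpha - w') and P(alpha - kappa) + P(alpha + kappa), N
    for 1 / (P(alpha) - P(kappa)), and y is the quintic. The quotients a2 a3 / a1 and a1 a3 / a2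
    enter already simplified, which keeps all denominators products of linear factors. *)
Lemma burnside_identity (r t i x : C) : r ^ 4 = - (1) -> t = r - r ^ 3 -> i = - r ^ 2 ->
  x <> 0 -> x - 1 <> 0 -> x - r ^ 2 <> 0 -> x + 1 <> 0 -> x + r ^ 2 <> 0 -> x + r <> 0 ->
  let D := (x + r ^ 2) * (x + 1) in let E := (x - 1) * (x - r ^ 2) in
  let a1 := - ((1 + t) / 2) * E / D in
  let a2 := (1 + t) * (1 - i) * x / D in
  let a3 := - (x - r) ^ 2 / D in
  let P := a2 - (3 + t) / 6 in
  let X1 := P - a2 - a3 + 2 * (1 - i) * x * (x - r) ^ 2 / (D * E) in
  let X2 := P - a1 - a3 + (1 + i) * E * (x - r) ^ 2 / (4 * x * D) in
  let N := (3 - 2 * t) * D / (x + r) ^ 2 in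
  let S := 2 * P - 2 * (a2 * a3 + a1 * a3 + a1 * a2) * N + 4 * a1 * a2 * a3 * N ^ 2 in
  let y := x * D * E in
  let L := (2 / (x + r) - (5 * x ^ 4 - 1) / y) / 4 in
  let L1 := (- (2) / (x + r) ^ 2 - (20 * x ^ 3 * y - (5 * x ^ 4 - 1) ^ 2) / y ^ 2) / 4 in
  (- (1 / 4) * (P + X1 + X2) - 3 / 16 * S + 9 / 64 * - (4 * (7 + 5 * t)) * N
    + 9 / 32 * (2 * t + 2)) * ((1 - i) / 2 * (x + r) ^ 2 / y) =
  L1 - L ^ 2 + - (1 / 4) * ((x ^ 8 + 14 * x ^ 4 + 1) / y ^ 2).
Proof.
move=> H -> -> h1 h2 h3 h4 h5 h6; cbv zeta.
by field [H]; repeat split.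
Qed.

(** * Burnside's change of variables *)

Lemma Cmult_eq_1_neq_0 (x y : C) : x * y = 1 -> x <> 0.
Proof. by move=> E e; move: E; rewrite e Cmult_0_l => /RtoC_inj; lra. Qed.

(** D collects the poles i and -1 of the substitution, E the points 1 and -i over e1. The two double
    points appear as squares: B - e3 = -(x - r)^2 / D and B - P(kappa) = (3 + 2 t) (x + r)^2 / D,
    where 3 + 2 t has the inverse 3 - 2 t. *)
Lemma burnside_subst_values (r t i x : C) : r ^ 4 = - (1) -> t = r - r ^ 3 -> i = - r ^ 2 ->
  x <> 0 -> x - 1 <> 0 -> x - r ^ 2 <> 0 -> x + 1 <> 0 -> x + r ^ 2 <> 0 -> x + r <> 0 ->
  let D := (x + r ^ 2) * (x + 1) in let E := (x - 1) * (x - r ^ 2) in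
  let B := - ((3 + t) / 6) + (1 + t) / (x - i) - i * ((1 + t) / (x + 1)) in
  let a1 := - ((1 + t) / 2) * E / D in
  let a2 := (1 + t) * (1 - i) * x / D in
  let a3 := - (x - r) ^ 2 / D in
  B = a2 - (3 + t) / 6 /\ B - t / 3 = a1 /\ B - - ((3 + t) / 6) = a2 /\
  B - (3 - t) / 6 = a3 /\
  B - (- (7 / 2) - 13 / 6 * t) <> 0 /\
  / (B - (- (7 / 2) - 13 / 6 * t)) = (3 - 2 * t) * D / (x + r) ^ 2.
Proof.
move=> H -> -> h1 h2 h3 h4 h5 h6; cbv zeta.
have e : x - - r ^ 2 = x + r ^ 2 by ring.
rewrite e.
have u : (3 + 2 * (r - r ^ 3)) * (3 - 2 * (r - r ^ 3)) = 1 by ring [H].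
have n := Cmult_eq_1_neq_0 _ _ u.
do 4 (split; first by field [H]; repeat split).
have -> : - ((3 + (r - r ^ 3)) / 6) + (1 + (r - r ^ 3)) / (x + r ^ 2) -
  - r ^ 2 * ((1 + (r - r ^ 3)) / (x + 1)) - (- (7 / 2) - 13 / 6 * (r - r ^ 3)) =
  (3 + 2 * (r - r ^ 3)) * (x + r) ^ 2 / ((x + r ^ 2) * (x + 1)).
  by field [H]; repeat split.
split.
  apply: Cmult_neq_0; last by apply: Cinv_neq_0; exact: Cmult_neq_0.
  apply: Cmult_neq_0 => //; exact: Cpow_nz.
have -> : 3 - 2 * (r - r ^ 3) = / (3 + 2 * (r - r ^ 3)).
  apply: (Cmult_cancel_l _ _ _ n); rewrite u; field; exact: n.
by field; repeat split.
Qed.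

(** The last conjunct is P'(alpha)^2 alpha_x^2 = (dB/dx)^2 with the differential equation inserted;
    it is where the formula for alpha_x^2 comes from. *)
Lemma burnside_subst_ratios (r t i x : C) : r ^ 4 = - (1) -> t = r - r ^ 3 -> i = - r ^ 2 ->
  x <> 0 -> x - 1 <> 0 -> x - r ^ 2 <> 0 -> x + 1 <> 0 -> x + r ^ 2 <> 0 ->
  let D := (x + r ^ 2) * (x + 1) in let E := (x - 1) * (x - r ^ 2) in
  let a1 := - ((1 + t) / 2) * E / D in
  let a2 := (1 + t) * (1 - i) * x / D in
  let a3 := - (x - r) ^ 2 / D in
  a1 <> 0 /\ a2 <> 0 /\
  a2 * a3 / a1 = 2 * (1 - i) * x * (x - r) ^ 2 / (D * E) /\
  a1 * a3 / a2 = (1 + i) * E * (x - r) ^ 2 / (4 * x * D) /\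
  4 * a1 * a2 * a3 * ((1 - i) / 2 * (x + r) ^ 2 / (x * D * E)) =
    (- ((1 + t) * (1 - i) * (x - r) * (x + r)) / D ^ 2) ^ 2.
Proof.
move=> H Et Ei h1 h2 h3 h4 h5 D E a1 a2 a3.
have hD : D <> 0 by exact: Cmult_neq_0.
have hE : E <> 0 by exact: Cmult_neq_0.
(* Explicit inverses show that 1 + t and 1 - i do not vanish. *)
have ut : (1 + t) * (t - 1) = 1 by rewrite Et; ring [H].
have ui : (1 - i) * ((1 + i) / 2) = 1 by rewrite Ei; field [H].
have nt := Cmult_eq_1_neq_0 _ _ ut. have ni := Cmult_eq_1_neq_0 _ _ ui.
have two : RtoC 2 <> 0 by apply: RtoC_neq; lra.
have n1 : a1 <> 0.
  apply: Cmult_neq_0; last exact: Cinv_neq_0.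
  apply: Cmult_neq_0 => // e; apply: nt.
  have -> : 1 + t = - (- ((1 + t) / 2)) * 2 by field.
  rewrite e; ring.
have n2 : a2 <> 0.
  apply: Cmult_neq_0; last exact: Cinv_neq_0.
  apply: Cmult_neq_0 => //; exact: Cmult_neq_0.
split=> //; split=> //.
have ei : (1 + i) = 2 / (1 - i).
  apply: (Cmult_cancel_l _ _ _ ni).
  have -> : (1 - i) * (2 / (1 - i)) = 2 by field.
  have <- : (1 - i) * ((1 + i) / 2) * 2 = 2 by rewrite ui; ring.
  by field.
split; [|split].
- rewrite /a2 /a3 /a1; field; by repeat split.
- rewrite ei /a2 /a3 /a1; field; by repeat split.
- rewrite /a2 /a3 /a1; field; by repeat split.
Qed.

Lemma quintic_neq_0 (r x : C) : r ^ 4 = - (1) -> x ^ 5 - x <> 0 ->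
  x <> 0 /\ x - 1 <> 0 /\ x - r ^ 2 <> 0 /\ x + 1 <> 0 /\ x + r ^ 2 <> 0.
Proof.
move=> H; rewrite (quintic_factors r x H) => n.
by (repeat split) => e; apply: n; rewrite e; ring.
Qed.

Lemma burnside_subst_derive (x : C) : x - Ci <> 0 -> x + 1 <> 0 ->
  is_C_derive burnside_subst x
    (- (1 + sqrt 2) / (x - Ci) ^ 2 + Ci * (1 + sqrt 2) / (x + 1) ^ 2).
Proof.
move=> n1 n2.
have D1 := is_C_derive_minus _ _ _ _ _ (is_C_derive_id x) (is_C_derive_const Ci x).
have D2 := is_C_derive_plus _ _ _ _ _ (is_C_derive_id x) (is_C_derive_const 1 x).
have c := is_C_derive_const (1 + sqrt 2) x.
have D3 := is_C_derive_div _ _ _ _ _ c D1 n1.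
have D4 := is_C_derive_mult _ _ _ _ _ (is_C_derive_const Ci x) (is_C_derive_div _ _ _ _ _ c D2 n2).
have D5 := is_C_derive_minus _ _ _ _ _ (is_C_derive_plus _ _ _ _ _
  (is_C_derive_const (- ((3 + sqrt 2) / 6)) x) D3) D4.
apply: is_C_derive_eq D5 _; field; by split.
Qed.

(** A quarter of the logarithmic derivative of s^4, a constant multiple of (x + r)^2 / (x^5 - x). *)
Definition sqrt_alpha_x_dlog (x : C) : C :=
  (2 / (x + root8) - (5 * x ^ 4 - 1) / (x ^ 5 - x)) / 4.

Definition sqrt_alpha_x_dlog' (x : C) : C :=
  (- (2) / (x + root8) ^ 2
   - (20 * x ^ 3 * (x ^ 5 - x) - (5 * x ^ 4 - 1) ^ 2) / (x ^ 5 - x) ^ 2) / 4.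

Lemma quintic_derive (x : C) : is_C_derive (fun y => y ^ 5 - y) x (5 * x ^ 4 - 1).
Proof.
have D := is_C_derive_minus _ _ _ _ _ (is_C_derive_monomial 4 x) (is_C_derive_id x).
apply: is_C_derive_eq D _; rewrite INR_IZR_INZ; reflexivity.
Qed.

Lemma sqrt_alpha_x_dlog_derive (x : C) : x + root8 <> 0 -> x ^ 5 - x <> 0 ->
  is_C_derive sqrt_alpha_x_dlog x (sqrt_alpha_x_dlog' x).
Proof.
move=> n1 n2.
have D1 := is_C_derive_plus _ _ _ _ _ (is_C_derive_id x) (is_C_derive_const root8 x).
have D2 := is_C_derive_div _ _ _ _ _ (is_C_derive_const 2 x) D1 n1.
have D3 := is_C_derive_minus _ _ _ _ _ (is_C_derive_mult _ _ _ _ _ (is_C_derive_const 5 x)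
  (is_C_derive_monomial 3 x)) (is_C_derive_const 1 x).
have D4 := is_C_derive_div _ _ _ _ _ D3 (quintic_derive x) n2.
have four : RtoC 4 <> 0 by apply: RtoC_neq; lra.
have D5 := is_C_derive_div _ _ _ _ _ (is_C_derive_minus _ _ _ _ _ D2 D4)
  (is_C_derive_const 4 x) four.
apply: is_C_derive_eq D5 _; rewrite /sqrt_alpha_x_dlog'.
have -> : RtoC (INR 4) = 4 by rewrite INR_IZR_INZ.
move: n2; set q := x ^ 5 - x => n2; field; by split.
Qed.

Definition alpha_x_square (x : C) : C :=
  (1 - Ci) / 2 * (x + root8) ^ 2 / (x ^ 5 - x).

Lemma alpha_x_square_derive (x : C) : x + root8 <> 0 -> x ^ 5 - x <> 0 ->
  is_C_derive alpha_x_square x (4 * sqrt_alpha_x_dlog x * alpha_x_square x).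
Proof.
move=> n1 n2.
have D1 := is_C_derive_plus _ _ _ _ _ (is_C_derive_id x) (is_C_derive_const root8 x).
have D2 := is_C_derive_mult _ _ _ _ _ (is_C_derive_const ((1 - Ci) / 2) x)
  (is_C_derive_pow2 _ _ _ D1).
have D3 := is_C_derive_div _ _ _ _ _ D2 (quintic_derive x) n2.
apply: is_C_derive_eq D3 _; rewrite /sqrt_alpha_x_dlog /alpha_x_square.
move: n2; set q := x ^ 5 - x => n2; field; by split.
Qed.

Lemma burnside_transformation (w w' kappa : C) :
  nondegenerate w w' -> cocompact w w' ->
  let P := weierstrass_p w w' in
  (forall z, ~ lattice w w' z -> wp_d1 w w' z ^ 2 =
     4 * (P z - sqrt 2 / 3) * (P z - - ((3 + sqrt 2) / 6)) * (P z - (3 - sqrt 2) / 6)) ->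
  ~ lattice w w' w -> ~ lattice w w' w' -> ~ lattice w w' kappa ->
  P w = sqrt 2 / 3 -> P w' = - ((3 + sqrt 2) / 6) ->
  P kappa = - (7 / 2) - 13 / 6 * sqrt 2 ->
  wp_d1 w w' kappa <> 0 ->
  root4 8 * Ci * wp_d1 w w' kappa = - (4 * (7 + 5 * sqrt 2)) ->
  forall (V W : C -> Prop) (a b s : C -> C),
  biholomorphic V W a b ->
  (forall x : C, V x ->
     x ^ 5 - x <> 0 /\ ~ lattice w w' (a x) /\ P (a x) = burnside_subst x) ->
  (forall x : C, V x -> continuous s x /\ s x ^ 2 = C_derive a x) ->
  forall Psi : C -> C,
    solves V burnside_coeff Psi <->
    solves W (torus_coeff w w' kappa) (fun alpha => s (b alpha) * Psi (b alpha)).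
Proof.
move=> nd cc P ode Hw Hw' Hk Ew Ew' Ek nk dk V W a b s bih HV Hs.
have [oV [oW [HA HB]]] := bih.
have H4 := root8_pow4. have Ht := sqrt2_root8. have Hi := Ci_root8.
set r := root8 in H4 Ht Hi.
have Da x : V x -> is_C_derive a x (s x ^ 2).
  move=> Vx; have [_ [_ ex]] := HA x Vx; have [_ ->] := Hs x Vx.
  exact: C_derive_correct (RtoC 0) ex.
(* The branch has a differentiable inverse, so a' = s^2 cannot vanish. *)
have s0 x : V x -> s x <> 0.
  move=> Vx E; have [Wa [_ _]] := HA x Vx.
  have [_ [_ [l0 Hl0]]] := HB _ Wa.
  have [l Hl] : exists l : C, is_C_derive b (a x) l by exists l0.
  have D1 := is_C_derive_comp b a x _ _ Hl (Da x Vx).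
  have D2 : is_C_derive (fun y => y) x (s x ^ 2 * l).
    apply: is_C_derive_ext_loc D1; apply: filter_imp (oV x Vx) => y Vy.
    by have [_ []] := HA y Vy.
  have := is_C_derive_inj _ _ _ _ D2 (is_C_derive_id x).
  have -> : s x ^ 2 * l = 0 by rewrite E; ring.
  by move=> /RtoC_inj; lra.
have fac x : V x -> x <> 0 /\ x - 1 <> 0 /\ x - r ^ 2 <> 0 /\ x + 1 <> 0 /\ x + r ^ 2 <> 0.
  by move=> Vx; apply: quintic_neq_0 => //; have [] := HV x Vx.
have chain x : V x -> s x ^ 2 * wp_d1 w w' (a x) =
   - ((1 + sqrt 2) * (1 - Ci) * (x - r) * (x + r)) / ((x + r ^ 2) * (x + 1)) ^ 2.
  move=> Vx; have [h1 [h2 [h3 [h4 h5]]]] := fac x Vx.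
  have [_ [La _]] := HV x Vx.
  have D1 := is_C_derive_comp (weierstrass_p w w') a x _ _ (wp_derive _ _ _ nd La) (Da x Vx).
  have D2 : is_C_derive burnside_subst x (s x ^ 2 * wp_d1 w w' (a x)).
    apply: is_C_derive_ext_loc D1; apply: filter_imp (oV x Vx) => y Vy.
    by have [_ [_ h]] := HV y Vy; exact: h.
  have e : x - Ci = x + r ^ 2 by rewrite Hi; ring.
  have n : x - Ci <> 0 by rewrite e.
  rewrite (is_C_derive_inj _ _ _ _ D2 (burnside_subst_derive x n h4)) e Ht Hi.
  by field [H4]; split.
have r0 : r <> 0.
  by move=> E; move: H4; rewrite E => H4; apply: (RtoC_neq 0 (-1)); [lra|rewrite RtoC_opp -H4; ring].
(* At x = -r the derivative of the substitution vanishes but alpha_x does not, so P'(alpha) = 0; yet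
   P(alpha) = P(kappa), and the differential equation gives P'(alpha)^2 = P'(kappa)^2, which is
   non-zero. *)
have xr x : V x -> x + r <> 0.
  move=> Vx E; have [h1 [h2 [h3 [h4 h5]]]] := fac x Vx.
  have := chain x Vx.
  have -> : - ((1 + sqrt 2) * (1 - Ci) * (x - r) * (x + r)) / ((x + r ^ 2) * (x + 1)) ^ 2 = 0.
    rewrite E /Cdiv; ring.
  move=> Z.
  have d0 : wp_d1 w w' (a x) = 0.
    apply: (Cmult_cancel_l (s x ^ 2)); first by apply: Cpow_nz; exact: s0.
    rewrite Z; ring.
  have [_ [La Pa]] := HV x Vx.
  have xE : x = - r.
    have e : x = (x + r) - r by ring.
    rewrite e E; ring.
  (* x = - r is the ramification point of the substitution over P(kappa). *)
  have PK : burnside_subst x = P kappa.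
    rewrite Ek /burnside_subst Ht Hi xE.
    have n1 : - r - - r ^ 2 <> 0.
      by move=> e; apply: h5; rewrite xE -e; ring.
    have n2 : - r + 1 <> 0 by rewrite -xE.
    by field [H4]; split.
  have o1 := ode _ La; have o2 := ode _ Hk.
  rewrite Pa PK d0 -o2 in o1; apply: nk; apply: Cmod_eq_0.
  have := f_equal Cmod o1; rewrite !Cmod_pow Cmod_0.
  have := Cmod_ge_0 (wp_d1 w w' kappa); nra.
have values x (Vx : V x) := let: conj h1 (conj h2 (conj h3 (conj h4 h5))) := fac x Vx in
  burnside_subst_values r _ _ x H4 Ht Hi h1 h2 h3 h4 h5 (xr x Vx).
have ratios x (Vx : V x) := let: conj h1 (conj h2 (conj h3 (conj h4 h5))) := fac x Vx in
  burnside_subst_ratios r _ _ x H4 Ht Hi h1 h2 h3 h4 h5.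
have q5 x : V x -> x ^ 5 - x <> 0 by move=> /HV [].
have dn x : V x -> x <> r -> wp_d1 w w' (a x) <> 0.
  move=> Vx n E; have [h1 [h2 [h3 [h4 h5]]]] := fac x Vx.
  have [n1 [n2 _]] := ratios x Vx.
  have [_ [La Pa]] := HV x Vx.
  have [_ [v1 [v2 [v3 _]]]] := values x Vx.
  have := ode _ La; rewrite Pa E /burnside_subst v1 v2 v3.
  set a1 := - ((1 + sqrt 2) / 2) * _ / _ in n1 *.
  set a2 := (1 + sqrt 2) * (1 - Ci) * _ / _ in n2 *.
  set a3 := - (x - r) ^ 2 / _.
  have n3 : a3 <> 0.
    apply: Cmult_neq_0; last by apply: Cinv_neq_0; exact: Cmult_neq_0.
    have n4 : (x - r) ^ 2 <> 0 by apply: Cpow_nz; exact: Cminus_neq_0.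
    move=> e; apply: n4; have -> : (x - r) ^ 2 = - - (x - r) ^ 2 by ring.
    rewrite e; ring.
  move=> Z; have : 4 * a1 * a2 * a3 <> 0.
    by repeat apply: Cmult_neq_0 => //; apply: RtoC_neq; lra.
  by apply; rewrite -Z; ring.
have cs x : V x -> continuous s x by move=> /Hs [].
(* The squared chain rule can be divided by P'(alpha)^2 except at x = r, where P(alpha) = e3;
   continuity covers that point. *)
have s4 x : V x -> s x ^ 4 = alpha_x_square x.
  move=> Vx; apply: Cminus_eq_0.
  apply: (continuous_zero_extension (fun y => s y ^ 4 - alpha_x_square y) V x r oV Vx).
    apply: C_continuous_minus; first by apply: C_continuous_pow; exact: cs.
    exact: is_C_derive_continuous (alpha_x_square_derive x (xr x Vx) (q5 x Vx)).
  move=> y Vy n.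
  have [_ [La Pa]] := HV y Vy.
  have [_ [v1 [v2 [v3 _]]]] := values y Vy.
  have [_ [_ [_ [_ e]]]] := ratios y Vy.
  have o := ode _ La.
  have d2 : wp_d1 w w' (a y) ^ 2 <> 0 by apply: Cpow_nz; exact: dn.
  have E : s y ^ 4 = alpha_x_square y.
    apply: (Cmult_cancel_l _ _ _ d2).
    have -> : wp_d1 w w' (a y) ^ 2 * s y ^ 4 = (s y ^ 2 * wp_d1 w w' (a y)) ^ 2 by ring.
    rewrite (chain y Vy) -e o Pa /burnside_subst v1 v2 v3 /alpha_x_square (quintic_factors r) //.
  rewrite E; ring.
apply: (solves_change_of_variables V W a b s sqrt_alpha_x_dlog sqrt_alpha_x_dlog') => // x Vx.
have Ds y : V y -> is_C_derive s y (sqrt_alpha_x_dlog y * s y).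
  move=> Vy; have sy := s0 y Vy.
  have s2 : s y ^ 2 <> 0 by exact: Cpow_nz.
  (* s is a continuous fourth root of [alpha_x_square]: the square root rule is applied to s^2
     first, then to s. *)
  have D1 := is_C_derive_sqrt (fun y => s y ^ 2) alpha_x_square y _
    (C_continuous_pow 2 _ _ (cs y Vy)) s2 _ (alpha_x_square_derive y (xr y Vy) (q5 y Vy)).
  have L : locally (T := C_UniformSpace) y (fun y => (s y ^ 2) ^ 2 = alpha_x_square y).
    apply: filter_imp (oV y Vy) => y' Vy'; rewrite -s4 //; ring.
  have L2 : locally (T := C_UniformSpace) y (fun y => s y ^ 2 = s y ^ 2) by exact: filter_forall.
  have D2 := is_C_derive_sqrt s (fun y => s y ^ 2) y _ (cs y Vy) sy L2 (D1 L).
  apply: is_C_derive_eq D2 _; rewrite -s4 //; field; exact: sy.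
split; first exact: s0.
split; first exact: Da.
split; first exact: Ds.
split; first by apply: sqrt_alpha_x_dlog_derive; [exact: xr|exact: q5].
apply: Cminus_eq_0.
(* [torus_coeff_value] divides by P'(alpha), which excludes x = r. Both sides are nevertheless
   continuous on V, because alpha avoids the five singular classes. *)
apply: (continuous_zero_extension (fun y => torus_coeff w w' kappa (a y) * s y ^ 4 -
  (sqrt_alpha_x_dlog' y - sqrt_alpha_x_dlog y ^ 2 + burnside_coeff y)) V x r oV Vx).
  have [_ [La Pa]] := HV x Vx.
  have [n1 [n2 _]] := ratios x Vx.
  have [h1 [h2 [h3 [h4 h5]]]] := fac x Vx.
  have [_ [v1 [v2 [_ [v4 _]]]]] := values x Vx.
  have nK : P (a x) - P kappa <> 0 by rewrite Pa Ek.
  have np (c d : C) : P (a x) - c <> 0 -> ~ lattice w w' d -> P d = c -> ~ lattice w w' (a x - d).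
    move=> h1' h2' E h; apply: h1'; rewrite -E /P (wp_eq_mod_lattice _ _ _ _ nd h2' h); ring.
  have cQ : continuous (torus_coeff w w' kappa) (a x).
    apply: holomorphic_at_continuous; apply: torus_coeff_holomorphic => //.
    - by apply: (np (sqrt 2 / 3)) => //; rewrite Pa /burnside_subst v1.
    - by apply: (np (- ((3 + sqrt 2) / 6))) => //; rewrite Pa /burnside_subst v2.
    - by exact: (np (P kappa)).
    - have -> : a x + kappa = a x - - kappa by ring.
      apply: (np (P kappa)); [done|exact: not_lattice_opp|exact: wp_even].
  have four : RtoC 4 <> 0 by apply: RtoC_neq; lra.
  have qx := q5 x Vx. have xrx := xr x Vx.
  have q2 : (x ^ 5 - x) ^ 2 <> 0 by exact: Cpow_nz.
  have xr2 : (x + root8) ^ 2 <> 0 by exact: Cpow_nz.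
  have csx := cs x Vx.
  apply: C_continuous_minus.
    apply: C_continuous_mult; last exact: C_continuous_pow.
    apply: (C_continuous_comp a) => //; exact: is_C_derive_continuous (Da x Vx).
  rewrite /sqrt_alpha_x_dlog' /sqrt_alpha_x_dlog /burnside_coeff.
  C_continuity.
move=> y Vy n.
have [_ [La Pa]] := HV y Vy.
have [n1 [n2 [ra1 [ra2 _]]]] := ratios y Vy.
have [h1 [h2 [h3 [h4 h5]]]] := fac y Vy.
have [v0 [v1 [v2 [v3 [v4 v5]]]]] := values y Vy.
have nK : P (a y) - P kappa <> 0 by rewrite Pa Ek.
have T := torus_coeff_value _ _ _ _ _ _ _ nd cc ode Hw Hw' Hk Ew Ew' nk La (dn y Vy n) nK.
cbv zeta in T.
rewrite T -/P Pa Ek /burnside_subst v1 v2 v3 v5 ra1 ra2 dk s4 // v0.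
rewrite /alpha_x_square /sqrt_alpha_x_dlog' /sqrt_alpha_x_dlog /burnside_coeff -/r.
rewrite (quintic_factors r) //.
rewrite (burnside_identity r _ _ y H4 Ht Hi) //; last exact: xr.
ring.
Qed.

Theorem proposition3
  (w : R) (w' kappa : C)
  (w_pos : (0 < w)%R)
  (w'_def : w' = Ci / sqrt 2 * w)
  (torus : forall z : C, ~ lattice w w' z ->
     C_derive (weierstrass_p w w') z ^ 2 =
     4 * (weierstrass_p w w' z - sqrt 2 / 3)
       * (weierstrass_p w w' z + (3 + sqrt 2) / 6)
       * (weierstrass_p w w' z - (3 - sqrt 2) / 6))
  (wp_w : weierstrass_p w w' w = sqrt 2 / 3)
  (wp_w' : weierstrass_p w w' w' = - ((3 + sqrt 2) / 6))
  (kappa_finite : ~ lattice w w' kappa)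
  (wp_kappa : weierstrass_p w w' kappa = - (7 / 2) - 13 / 6 * sqrt 2)
  (wp'_kappa : C_derive (weierstrass_p w w') kappa =
     root4 32 * (7 + 5 * sqrt 2) * Ci) :
  (* every local branch of the change of variables, V in the x-plane and W in
     the alpha-plane, with alpha = a(x) and s a branch of sqrt(alpha_x) *)
  (forall (V W : C -> Prop) (a b s : C -> C),
     biholomorphic V W a b ->
     (forall x : C, V x ->
        x ^ 5 - x <> 0 /\ ~ lattice w w' (a x) /\
        weierstrass_p w w' (a x) = burnside_subst x) ->
     (forall x : C, V x -> continuous s x /\ s x ^ 2 = C_derive a x) ->
     forall Psi : C -> C,
       solves V burnside_coeff Psi <->
       solves W (torus_coeff w w' kappa)
         (fun alpha => s (b alpha) * Psi (b alpha))) /\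
  fuchsian_on_torus w w' (torus_coeff w w' kappa)
    [RtoC 0; RtoC w; w'; kappa; - kappa].
Proof.
have q0 : (0 < sqrt 2)%R by apply: sqrt_lt_R0; lra.
have h0 : (0 < w / sqrt 2)%R by exact: Rdiv_lt_0_compat.
have Ew' : w' = Ci * (w / sqrt 2)%R.
  rewrite w'_def RtoC_div; last lra.
  rewrite /Cdiv; ring.
have nd : nondegenerate w w' by rewrite Ew'; exact: rectangular_nondegenerate.
have cc : cocompact w w' by rewrite Ew'; exact: rectangular_cocompact.
have [Hw [Hw' Hww']] :
  ~ lattice w w' w /\ ~ lattice w w' w' /\ ~ lattice w w' (w - w').
  by rewrite Ew'; exact: rectangular_half_periods.
have dE z : ~ lattice w w' z -> C_derive (weierstrass_p w w') z = wp_d1 w w' z.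
  by move=> Hz; apply: is_C_derive_unique; exact: wp_derive.
rewrite dE // in wp'_kappa.
have t2 := sqrt2_square.
(* The constants come from P(w) - P(kappa) = (7 + 5 sqrt 2) / 2 and P(w') - P(kappa) = 3 + 2 sqrt 2;
   explicit inverses show that they are non-zero. *)
have u7 : (7 + 5 * sqrt 2) * (5 * sqrt 2 - 7) = 1 by ring [t2].
have u3 : (3 + 2 * sqrt 2) * (3 - 2 * sqrt 2) = 1 by ring [t2].
have n7 := Cmult_eq_1_neq_0 _ _ u7.
have n3 := Cmult_eq_1_neq_0 _ _ u3.
have dk : root4 8 * Ci * wp_d1 w w' kappa = - (4 * (7 + 5 * sqrt 2)).
  have hi := Ci_square.
  rewrite wp'_kappa -root4_8_32; ring [hi].
have nk : wp_d1 w w' kappa <> 0.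
  move=> E; rewrite E in dk; apply: n7.
  apply: (Cmult_cancel_l (- (4))); first by rewrite -RtoC_opp; apply: RtoC_neq; lra.
  have -> : - (4) * (7 + 5 * sqrt 2) = - (4 * (7 + 5 * sqrt 2)) by ring.
  rewrite -dk; ring.
split.
  apply: burnside_transformation => //.
  by move=> z Hz; rewrite -dE // torus //; ring.
apply: torus_coeff_fuchsian => //.
(* Points with different wp values are incongruent, and as wp is even one comparison settles both x
   and -x. *)
have sub (b : C) (x : C) : ~ lattice w w' b -> ~ lattice w w' x ->
  weierstrass_p w w' b - weierstrass_p w w' x <> 0 ->
  ~ lattice w w' (b - x) /\ ~ lattice w w' (b - - x).
  move=> Hb Hx n; split=> h; apply: n.
    rewrite (wp_eq_mod_lattice _ _ _ _ nd Hx h); ring.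
  rewrite (wp_eq_mod_lattice _ _ _ _ nd (not_lattice_opp _ _ _ Hx) h) wp_even; ring.
have [wk wmk] := sub w kappa Hw kappa_finite ltac:(
  rewrite wp_w wp_kappa => E; apply: n7;
  apply: (Cmult_cancel_l (/ 2)); [apply: Cinv_neq_0; apply: RtoC_neq; lra|];
  rewrite Cmult_0_r -E; field).
have [w'k w'mk] := sub w' kappa Hw' kappa_finite ltac:(
  rewrite wp_w' wp_kappa => E; apply: n3; rewrite -E; field).
have kk : ~ lattice w w' (kappa - - kappa).
  have -> : kappa - - kappa = kappa + kappa by ring.
  by move=> h; apply: nk; exact: wp_d1_half_period.
have neg (x : C) : ~ lattice w w' x -> ~ lattice w w' (0 - x) /\ ~ lattice w w' (0 - - x).
  move=> Hx; split.
    have -> : 0 - x = - x by ring. exact: not_lattice_opp.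
  by have -> : 0 - - x = x by ring.
have [zw _] := neg _ Hw. have [zw' _] := neg _ Hw'. have [zk zmk] := neg _ kappa_finite.
by repeat constructor.
Qed.
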